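(* Let $n\geqslant 1$ be an integer, let $\beta>0$, and let $p>1$ be such that $$p<\infty \ \text{ if } n=1,\qquad p\leqslant p_{\mathrm{Gla}}(n)=\frac{n+1}{n-1}\ \text{ if } n\geqslant 2 .$$ Let $(u_0,u_1,u_2)\in H^2(\mathbb{R}^n)\times H^1(\mathbb{R}^n)\times L^2(\mathbb{R}^n)$ be nonnegative and compactly supported functions with supports contained in $B_R$ for some $R>0$, such that $u_1$ or $u_2$ is not identically zero. For $\varepsilon>0$, let $u$ be the energy solution to the Cauchy problem $$\begin{cases} \beta u_{ttt}+u_{tt}-\Delta u-\beta \Delta u_t=|u_t|^p, & x\in\mathbb{R}^n,\ t>0,\\ (u,u_t,u_{tt})(0,x)=\varepsilon(u_0,u_1,u_2)(x), & x\in\mathbb{R}^n, \end{cases}$$ with lifespan $T(\varepsilon)$, satisfying $$\mathrm{supp}\,u(t,\cdot)\subset B_{t+R}\quad\text{for any } t\in(0,T(\varepsilon)).$$ Then there exists a positive constant $\varepsilon_0=\varepsilon_0(u_0,u_1,u_2,n,p,R,\beta)$ such that for any $\varepsilon\in(0,\varepsilon_0]$ the solution $u$ blows up in finite time. Furthermore, the upper bound estimate for the lifespan $$T(\varepsilon)\leqslant \begin{cases} C\,\varepsilon^{-\left(\frac{1}{p-1}-\frac{n-1}{2}\right)^{-1}} & \text{if } 1<p<p_{\mathrm{Gla}}(n),\\ \exp\left(C\varepsilon^{-(p-1)}\right) & \text{if } p=p_{\mathrm{Gla}}(n) \end{cases}$$ holds for any $\varepsilon\in(0,\varepsilon_0]$,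 where $C>0$ is a constant independent of $\varepsilon$.
   Context: $B_R$ denotes the ball in $\mathbb{R}^n$ centered at the origin with radius $R$. The Glassey exponent is $p_{\mathrm{Gla}}(n)=(n+1)/(n-1)$ for $n\geqslant 2$; for $n=1$ it is understood as $p_{\mathrm{Gla}}(1)=\infty$, so that for $n=1$ every $p>1$ falls in the case $1<p<p_{\mathrm{Gla}}(n)$. Functions are real-valued. Energy solution: let $(u_0,u_1,u_2)\in H^2(\mathbb{R}^n)\times H^1(\mathbb{R}^n)\times L^2(\mathbb{R}^n)$ and $\varepsilon>0$. A function $u$ is an energy solution of the Cauchy problem in the claim on $[0,T)$ if $$u\in\mathcal{C}([0,T),H^2(\mathbb{R}^n))\cap\mathcal{C}^1([0,T),H^1(\mathbb{R}^n))\cap\mathcal{C}^2([0,T),L^2(\mathbb{R}^n))\quad\text{with}\quad u_t\in L^p_{\mathrm{loc}}([0,T)\times\mathbb{R}^n),$$ $u(0,\cdot)=\varepsilon u_0$ in $H^2(\mathbb{R}^n)$, $u_t(0,\cdot)=\varepsilon u_1$ in $H^1(\mathbb{R}^n)$, and the integral relation $$\begin{aligned} &\beta\int_{\mathbb{R}^n}u_{tt}(t,x)\phi(t,x)\,\mathrm{d}x+\int_{\mathbb{R}^n}u_t(t,x)\phi(t,x)\,\mathrm{d}x-\beta\varepsilon\int_{\mathbb{R}^n}u_2(x)\phi(0,x)\,\mathrm{d}x-\varepsilon\int_{\mathbb{R}^n}u_1(x)\phi(0,x)\,\mathrm{d}x\\ &\quad+\beta\int_0^t\int_{\mathbb{R}^n}\big(\nabla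 u_t(s,x)\cdot\nabla\phi(s,x)-u_{tt}(s,x)\phi_t(s,x)\big)\,\mathrm{d}x\,\mathrm{d}s\\ &\quad+\int_0^t\int_{\mathbb{R}^n}\big(\nabla u(s,x)\cdot\nabla\phi(s,x)-u_t(s,x)\phi_t(s,x)\big)\,\mathrm{d}x\,\mathrm{d}s\\ &=\int_0^t\int_{\mathbb{R}^n}|u_t(s,x)|^p\phi(s,x)\,\mathrm{d}x\,\mathrm{d}s \end{aligned}$$ holds for any $\phi\in\mathcal{C}_0^\infty([0,T)\times\mathbb{R}^n)$ and any $t\in(0,T)$. The lifespan $T(\varepsilon)\in(0,\infty]$ is the maximal existence time of the energy solution $u$ (so $u$ is an energy solution on $[0,T(\varepsilon))$), and ''$u$ blows up in finite time'' means $T(\varepsilon)<\infty$. *)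

(* Defs.v *)
From HB Require Import structures.
From mathcomp Require Import all_boot all_order all_algebra.
From mathcomp Require Import all_classical all_reals all_analysis.

Set Implicit Arguments.
Unset Strict Implicit.
Unset Printing Implicit Defensive.

Import Order.TTheory GRing.Theory Num.Theory.
Import numFieldNormedType.Exports.

Local Open Scope classical_set_scope.
Local Open Scope ring_scope.

(* MathComp-Analysis puts a topology but no sigma-algebra on row vectors: we use
   the one generated by the coordinates, i.e. the Borel sets of R^n.            *)

Definition rV_display : measure_display.
Proof. exact: default_measure_display. Qed.

Section rV_measurable.
Context {R : realType} (n : nat).

Definition rV_coord (i : 'I_n) (x : 'rV[R]_n) : measurableTypeR R := x ord0 i.

Let rV_set0 : g_sigma_preimage rV_coord set0.
Proof. exact: sigma_algebra0. Qed.

Let rV_setC A : g_sigma_preimage rV_coord A -> g_sigma_preimage rV_coord (~` A).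
Proof. exact: sigma_algebraC. Qed.

Let rV_bigcup (F : _^nat) : (forall i, g_sigma_preimage rV_coord (F i)) ->
  g_sigma_preimage rV_coord (\bigcup_i (F i)).
Proof. exact: sigma_algebra_bigcup. Qed.

HB.instance Definition _ := @isMeasurable.Build rV_display 'rV[R]_n
  (g_sigma_preimage rV_coord) rV_set0 rV_setC rV_bigcup.

End rV_measurable.

Section rV_measurable_fun.
Context {R : realType}.

Lemma measurable_rV_coord n (i : 'I_n) :
  measurable_fun [set: 'rV[R]_n] (rV_coord i).
Proof.
move=> _ Y mY; rewrite setTI; apply: sub_sigma_algebra => /=.
rewrite -bigcup_seq/=; exists i => /=; first by rewrite mem_index_enum.
by exists Y => //; rewrite setTI.
Qed.

Lemma measurable_fun_rV d (T : measurableType d) n (f : T -> 'rV[R]_n) :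
  (forall i, measurable_fun [set: T] (rV_coord i \o f)) ->
  measurable_fun [set: T] f.
Proof.
move=> mf _ A mA.
suff : preimage_set_system [set: T] f (g_sigma_preimage (@rV_coord R n))
    `<=` measurable by apply; exists A.
rewrite -g_sigma_preimage_comp.
apply: smallest_sub; first exact: sigma_algebra_measurable.
case: n => [|n] in f mf A mA *; first by rewrite big_ord0.
rewrite -bigcup_mkord_ord; apply: bigcup_sub => i Ii.
by move=> B [C mC <-]; exact: mf.
Qed.

Definition rV_cons n (z : measurableTypeR R * 'rV[R]_n) : 'rV[R]_n.+1 :=
  row_mx (z.1 : R)%:M z.2.

Definition rV_uncons n (x : 'rV[R]_n.+1) : measurableTypeR R * 'rV[R]_n :=
  (x ord0 ord0, \row_j x ord0 (lift ord0 j)).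

Lemma rV_consK n : cancel (@rV_cons n) (@rV_uncons n).
Proof.
move=> [t x]; congr pair; first by rewrite mxE split1 unlift_none /= mxE mulr1n.
by apply/rowP => j; rewrite !mxE split1 liftK.
Qed.

Lemma measurable_rV_cons n : measurable_fun [set: _] (@rV_cons n).
Proof.
apply: measurable_fun_rV => i.
have [j|] := unliftP ord0 i => ->.
  rewrite (_ : _ \o _ = rV_coord j \o snd).
    exact: (measurableT_comp (@measurable_rV_coord n j) measurable_snd).
  by apply/funext => z; rewrite /= /rV_coord mxE split1 liftK.
rewrite (_ : _ \o _ = fst); first exact: measurable_fst.
apply/funext => z.
by rewrite /= /rV_coord mxE split1 unlift_none /= mxE mulr1n.
Qed.

Lemma measurable_rV_uncons n : measurable_fun [set: _] (@rV_uncons n).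
Proof.
apply/measurable_fun_pairP; split; first exact: (@measurable_rV_coord n.+1).
apply: measurable_fun_rV => i.
rewrite (_ : _ \o _ = rV_coord (lift ord0 i)).
  exact: measurable_rV_coord.
by apply/funext => x; rewrite /rV_coord /= mxE.
Qed.

End rV_measurable_fun.

Section rV_measure_cons.
Context {R : realType} (n : nat).
Variable mu : {sigma_finite_measure set 'rV[R]_n -> \bar R}.

Definition measure_rV_cons : set 'rV[R]_n.+1 -> \bar R :=
  pushforward (@lebesgue_measure R \x mu)%E (@rV_cons R n).

Let measure_rV_cons0 : measure_rV_cons set0 = 0%E.
Proof. by rewrite /measure_rV_cons /pushforward preimage_set0 measure0. Qed.

Let measure_rV_cons_ge0 A : (0 <= measure_rV_cons A)%E.
Proof. exact: (measure_ge0 (@lebesgue_measure R \x mu)%E). Qed.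

Let measurable_preimage_rV_cons A :
  measurable A -> measurable (@rV_cons R n @^-1` A).
Proof. by move=> mA; rewrite -[X in measurable X]setTI; exact: measurable_rV_cons. Qed.

Let measure_rV_cons_sigma_additive : semi_sigma_additive measure_rV_cons.
Proof.
move=> F mF tF mUF; rewrite /measure_rV_cons /pushforward preimage_bigcup.
apply: measure_semi_sigma_additive.
- by move=> k; exact: measurable_preimage_rV_cons.
- apply/trivIsetP => /= i j _ _ ij; rewrite -preimage_setI.
  by move/trivIsetP : tF => /(_ _ _ _ _ ij) ->//; rewrite preimage_set0.
- by rewrite -preimage_bigcup; exact: measurable_preimage_rV_cons.
Qed.

HB.instance Definition _ := isMeasure.Build _ _ _ measure_rV_cons
  measure_rV_cons0 measure_rV_cons_ge0 measure_rV_cons_sigma_additive.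

Let measure_rV_cons_sigma_finite : sigma_finite setT measure_rV_cons.
Proof.
have /sigma_finiteP[F [TF ndF Foo]] := sigma_finiteT (@lebesgue_measure R).
have /sigma_finiteP[G [TG ndG Goo]] := sigma_finiteT mu.
exists (fun k => @rV_uncons R n @^-1` (F k `*` G k)).
  rewrite predeqE => x; split=> // _.
  have [k _ Fx] : (\bigcup_k F k) (rV_uncons x).1 by rewrite -TF.
  have [l _ Gx] : (\bigcup_k G k) (rV_uncons x).2 by rewrite -TG.
  exists (maxn k l) => //; split.
    by move: Fx; exact/subsetPset/ndF/leq_maxl.
  by move: Gx; exact/subsetPset/ndG/leq_maxr.
move=> k; have [mF Fy] := Foo k; have [mG Gy] := Goo k; split.
  rewrite -[X in measurable X]setTI; apply: measurable_rV_uncons => //.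
  exact: measurableX.
rewrite /measure_rV_cons /pushforward -comp_preimage.
rewrite (_ : _ \o _ = id) ?preimage_id.
  by rewrite product_measure1E// lte_mul_pinfty// ge0_fin_numE.
by apply/funext => z; rewrite /= rV_consK.
Qed.

HB.instance Definition _ := @Measure_isSigmaFinite.Build _ _ _
  measure_rV_cons measure_rV_cons_sigma_finite.

End rV_measure_cons.

(* n-dimensional Lebesgue measure, as an iterated product *)
Fixpoint lebesgue_rV (R : realType) (n : nat) :
    {sigma_finite_measure set 'rV[R]_n -> \bar R} :=
  match n with
  | 0 => @dirac _ 'rV[R]_0 0 R
  | m.+1 => measure_rV_cons (lebesgue_rV R m)
  end.

Lemma lebesgue_rV_box (R : realType) n (A : 'I_n -> set (measurableTypeR R)) :
  (forall i, measurable (A i)) ->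
  lebesgue_rV R n [set x | forall i, A i (x ord0 i)] =
  (\prod_(i < n) lebesgue_measure (A i))%E.
Proof.
elim: n A => [|n IHn] A mA.
  by rewrite big_ord0 /= diracE mem_set// => -[].
rewrite big_ord_recl -IHn//= /measure_rV_cons /pushforward.
set B := (X in _ = (_ * lebesgue_rV R n X)%E).
have mB : measurable B.
  rewrite (_ : B =
      \bigcap_(i in [set: 'I_n]) (rV_coord i @^-1` A (lift ord0 i))).
    apply: fin_bigcap_measurable => [|i _]; first exact: finite_finset.
    by rewrite -[X in measurable X]setTI; exact: measurable_rV_coord.
  by apply/seteqP; split => x /= Bx i; [move=> _|]; exact: Bx.
rewrite -product_measure1E//; congr (_ _).
apply/seteqP; split => -[t x] /= Atx.
  split=> [|i].
    by have := Atx ord0; rewrite mxE split1 unlift_none /= mxE mulr1n.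
  by have := Atx (lift ord0 i); rewrite mxE split1 liftK.
move=> i; have [j|] := unliftP ord0 i => ->; rewrite mxE split1.
  by rewrite liftK; exact: Atx.2.
by rewrite unlift_none /= mxE mulr1n; exact: Atx.1.
Qed.

Section test_functions.
Context {R : realType}.

(* In finite dimension this is the usual C^k. *)
Fixpoint Ck (V : normedModType R) (k : nat) (f : V -> R) : Prop :=
  continuous f /\
  match k with
  | 0 => True
  | m.+1 => forall v : V, (forall x, derivable f x v) /\ Ck m ('D_v f)
  end.

Definition smooth (V : normedModType R) (f : V -> R) := forall k, Ck k f.

Definition tsupport (V : normedModType R) (f : V -> R) : set V :=
  closure [set x | f x != 0].

(* C_0^oo(V) *)
Definition test_function (V : normedModType R) (f : V -> R) :=
  smooth f /\ compact (tsupport f).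

(* C_0^oo([0, T) x R^n): smooth up to t = 0 and possibly nonzero there. Such a
   function is the restriction to t >= 0 of a smooth function on R x R^n with
   compact support in ]-oo, T[ x R^n.                                         *)
Definition spacetime_test_function n (T : \bar R) (phi : R * 'rV[R]_n -> R) :=
  test_function phi /\ tsupport phi `<=` [set z | (z.1%:E < T)%E].

End test_functions.

Section sobolev.
Context {R : realType} {n : nat}.
Local Notation E := 'rV[R]_n.
Local Notation mu := (lebesgue_rV R n).
Implicit Types (f g : E -> R) (i : 'I_n).

Definition basis_vector i : E := delta_mx ord0 i.

Definition L2 f : Prop := f \in Lfun mu 2%:E.

Definition L2norm f : R := fine ('N[mu]_2%:E[EFin \o f])%E.

Definition is_weak_derivative i f g :=
  forall psi : E -> R, test_function psi ->
    \int[mu]_x (f x * 'D_(basis_vector i) psi x) = - \int[mu]_x (g x * psi x).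

(* H^k(R^n), as a set of representatives of classes modulo a.e. equality *)
Fixpoint sobolev (k : nat) f : Prop :=
  L2 f /\
  match k with
  | 0 => True
  | m.+1 => forall i, exists g, is_weak_derivative i f g /\ sobolev m g
  end.

(* A representative of the weak derivative in L^2, determined up to a.e. equality;
   0 if there is none.                                                         *)
Definition weak_derivative i f : E -> R :=
  xget (fun=> 0) [set g | L2 g /\ is_weak_derivative i f g].

(* The H^k norm: the square is the sum of the squared L^2 norms of all
   iterated weak derivatives of length at most k. *)
Fixpoint sobolev_norm (k : nat) f : R :=
  match k with
  | 0 => L2norm f
  | m.+1 => Num.sqrt (L2norm f ^+ 2 +
      \sum_i sobolev_norm m (weak_derivative i f) ^+ 2)
  end.

(* The essential support: the complement of the largest open set on which f
   vanishes almost everywhere. *)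
Definition ess_support f : set E :=
  ~` \bigcup_(U in [set U | open U /\ {ae mu, forall x, U x -> f x = 0}]) U.

(* The library norm on row vectors is the sup norm. *)
Definition euclidean_ball (r : R) : set E :=
  [set x | Num.sqrt (\sum_i x ord0 i ^+ 2) <= r].

End sobolev.

Section energy_solution.
Context {R : realType} {n : nat}.
Local Notation E := 'rV[R]_n.
Local Notation mu := (lebesgue_rV R n).
Local Notation leb := (@lebesgue_measure R).
Implicit Types (T : \bar R) (u v w : R -> E -> R).

Definition time_interval T : set R := [set t | 0 <= t /\ (t%:E < T)%E].

(* u \in C([0, T), H^k) *)
Definition sobolev_continuous (k : nat) T u :=
  (forall t, time_interval T t -> sobolev k (u t)) /\
  forall t, time_interval T t ->
    sobolev_norm k (u s \- u t) @[s --> within (time_interval T) (nbhs t)] --> 0.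

(* v is the derivative of u : [0, T) -> H^k *)
Definition sobolev_derivative (k : nat) T u v :=
  forall t, time_interval T t ->
    sobolev_norm k (fun x => (u (t + h) x - u t x) / h - v t x)
      @[h --> within [set h | time_interval T (t + h)] 0^'] --> 0.

(* v \in L^p_loc([0, T) x R^n). The curve t |-> v t consists of classes modulo
   a.e. equality in x, whence the jointly measurable representative w. *)
Definition Lp_loc (p : R) T v :=
  exists w : measurableTypeR R * E -> R,
    [/\ @measurable_fun _ _ (measurableTypeR R * E)%type (measurableTypeR R)
          (time_interval T `*` [set: E]) w,
        forall t, time_interval T t -> {ae mu, forall x, w (t, x) = v t x} &
        forall K : set (R * E), compact K ->
          K `<=` time_interval T `*` [set: E] ->
          (\int[leb \x mu]_(z in K) (`|w z| `^ p)%:E < +oo)%E].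

Definition d_t (phi : R * E -> R) : R * E -> R := 'D_((1, 0) : R * E) phi.

Definition d_x (i : 'I_n) (phi : R * E -> R) : R * E -> R :=
  'D_((0, basis_vector i) : R * E) phi.

(* ut and utt are the first two time derivatives of u *)
Definition weak_formulation (beta p eps : R) (u1 u2 : E -> R) T u
    (ut utt : R -> E -> R) :=
  forall phi : R * E -> R, spacetime_test_function T phi ->
  forall t : R, 0 < t -> (t%:E < T)%E ->
    beta * \int[mu]_x (utt t x * phi (t, x))
    + \int[mu]_x (ut t x * phi (t, x))
    - beta * eps * \int[mu]_x (u2 x * phi (0, x))
    - eps * \int[mu]_x (u1 x * phi (0, x))
    + beta * \int[leb]_(s in `[0, t]) \int[mu]_x
        (\sum_i weak_derivative i (ut s) x * d_x i phi (s, x)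
         - utt s x * d_t phi (s, x))
    + \int[leb]_(s in `[0, t]) \int[mu]_x
        (\sum_i weak_derivative i (u s) x * d_x i phi (s, x)
         - ut s x * d_t phi (s, x))
    = \int[leb]_(s in `[0, t]) \int[mu]_x (`|ut s x| `^ p * phi (s, x)).

Definition energy_solution (beta p eps : R) (u0 u1 u2 : E -> R) T u :=
  exists ut utt : R -> E -> R,
    [/\ [/\ sobolev_continuous 2 T u,
            sobolev_derivative 1 T u ut & sobolev_continuous 1 T ut],
        sobolev_derivative 0 T ut utt /\ sobolev_continuous 0 T utt,
        Lp_loc p T ut,
        {ae mu, forall x, u 0 x = eps * u0 x} /\
        {ae mu, forall x, ut 0 x = eps * u1 x} &
        weak_formulation beta p eps u1 u2 T u ut utt].

(* T is the maximal existence time of the energy solution u *)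
Definition lifespan (beta p eps : R) (u0 u1 u2 : E -> R) u T :=
  [/\ (0 < T)%E, energy_solution beta p eps u0 u1 u2 T u &
      forall T' v, (T < T')%E ->
        energy_solution beta p eps u0 u1 u2 T' v ->
        ~ forall t, time_interval T t -> {ae mu, forall x, v t x = u t x}].

End energy_solution.

(* The Glassey exponent *)
Definition p_Gla (R : realType) (n : nat) : \bar R :=
  if n == 1 then +oo%E else ((n%:R + 1) / (n%:R - 1))%:E.

(* Main.v *)
Require Import Defs.
From mathcomp Require Import all_boot all_order all_algebra.
From mathcomp Require Import all_classical all_reals all_analysis.
From mathcomp Require Import measurable_realfun ring lra.

Import Order.TTheory GRing.Theory Num.Theory.
Import numFieldNormedType.Exports.

Local Open Scope classical_set_scope.
Local Open Scope ring_scope.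

Set Implicit Arguments.
Unset Strict Implicit.

(* The equation is tested with the plane wave e^(x_1 - t), truncated outside the support
   of the solution, rather than with a spherical average of plane waves: its integral over
   B_(t+R) is also O((1+t)^((n-1)/2)), because the slice of the ball at height x_1 lies in
   a cube of half-side sqrt(2 (t+R) (t+R-x_1)). Put f = e^(-t) int u_t e^(x_1) dx and
   a = e^(-t) int u e^(x_1) dx. Then a' = f - a and
     beta f' + (2 beta + 1) f + a = Q,
   where Q(t) = eps I + int_0^t int |u_t|^p e^(x_1 - s) dx ds with I > 0. The function
   m = f + a solves beta m' + (beta + 1) m = Q; as Q is nondecreasing, m <= kappa Q with
   kappa < 1, that is f' + 2 f >= c Q with c > 0. By Hoelder's inequality Q' dominates
   k (1+t)^(-gamma) |f|^p with gamma = (n-1)(p-1)/2 <= 1, so f >= c h for a solution of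
   h'' + 2 h' >= k' (1+t)^(-gamma) h^p. A barrier argument turns this into the first order
   inequality h' >= l (1+t)^(-gamma) / (h^(-p) + h^(-(p+1)/2)), which bounds
   int_1^t (1+s)^(-gamma) ds by a multiple of eps^(-(p-1)). *)

(** * Real derivatives and comparison of differential inequalities *)

(** [Q] is only known to be nondecreasing, since the density of its integral is merely integrable in
    time. This is why m <= kappa Q at time t is obtained by comparing m on [0, t] with the constant
    kappa Q(t), and why Q then gives way to a C^1 minorant q, built from the continuous lower bound
    k (1+t)^(-gamma) |f|^p of that density. The constant kappa must exceed two ratios: 1/(beta+1),
    the equilibrium of m against a constant Q, and the initial ratio m(0)/Q(0). The latter is below
    1 because Q(0) - m(0) = eps beta int (u_1 + u_2) e^(x_1) dx, which is where the data have to be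
    nontrivial; neither ratio depends on eps. No blow-up time is ever constructed: the final
    inequality holds at every tau in [1, T), and as int (1+s)^(-gamma) ds diverges for gamma <= 1,
    that is for p <= p_Gla, it bounds T. The integration starts at time 1 because h vanishes at 0,
    where the integral of 1/h^p in h would diverge. *)

Section real_derivatives.
Context {R : realType}.
Implicit Types (f g h df dg z dz : R -> R) (x a b c : R).

Lemma der_eq f x (a b : R) : is_derive x 1 f a -> a = b -> is_derive x 1 f b.
Proof. by move=> fa <-. Qed.

Lemma derD f g x (a b : R) : is_derive x 1 f a -> is_derive x 1 g b ->
  is_derive x 1 (fun y => f y + g y) (a + b).
Proof. exact: is_deriveD. Qed.

Lemma derB f g x (a b : R) : is_derive x 1 f a -> is_derive x 1 g b ->
  is_derive x 1 (fun y => f y - g y) (a - b).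
Proof. exact: is_deriveB. Qed.

Lemma derZ f x (c a : R) : is_derive x 1 f a ->
  is_derive x 1 (fun y => c * f y) (c * a).
Proof. exact: is_deriveZ. Qed.

Lemma derM f g x (a b : R) : is_derive x 1 f a -> is_derive x 1 g b ->
  is_derive x 1 (fun y => f y * g y) (a * g x + f x * b).
Proof.
move=> fa gb; rewrite (_ : a * g x + f x * b = f x *: b + g x *: a).
  exact: is_deriveM.
by rewrite /GRing.scale/=; ring.
Qed.

Lemma der_comp f g x (a b : R) : is_derive (g x) 1 f a -> is_derive x 1 g b ->
  is_derive x 1 (fun y => f (g y)) (a * b).
Proof. exact: is_derive1_comp. Qed.

Lemma derV f x (a : R) : f x != 0 -> is_derive x 1 f a ->
  is_derive x 1 (fun y => (f y)^-1) (- a / f x ^+ 2).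
Proof.
move=> fx0 [df <-]; apply: DeriveDef; first exact: derivableV.
by rewrite deriveV// /GRing.scale/=; ring.
Qed.

Lemma der_expR_lin x c : is_derive x 1 (fun y => expR (c * y)) (c * expR (c * x)).
Proof.
apply: (der_eq (der_comp (is_derive_expR (c * x)) (derZ c (is_derive_id x 1)))).
by ring.
Qed.

Lemma der_powR_comp h x (dh a : R) : is_derive x 1 h dh -> 0 < h x ->
  is_derive x 1 (fun y => h y `^ a) (a * h x `^ (a - 1) * dh).
Proof. by move=> hdh h0; exact: (der_comp (is_derive1_powR a h0) hdh). Qed.

Lemma der_continuous f x (a : R) : is_derive x 1 f a -> {for x, continuous f}.
Proof. by move=> [/derivable1_diffP/differentiable_continuous]. Qed.

(** Differentiability is asked only inside the interval: the functions of the solution, frozen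
    outside [0, tau], are not differentiable at its ends. *)
Lemma ge0_is_derive_le f df a b : a <= b ->
  (forall x, x \in `]a, b[ -> is_derive x 1 f (df x)) ->
  {within `[a, b], continuous f} ->
  (forall x, x \in `]a, b[ -> 0 <= df x) -> f a <= f b.
Proof.
rewrite le_eqVlt => /predU1P[->//|ab] fdf cf df0.
have [c cab fE] := MVT ab fdf cf.
by rewrite -subr_ge0 fE mulr_ge0 ?subr_ge0 ?(ltW ab)// df0.
Qed.

Lemma der_ge0_le f df a b : a <= b ->
  (forall x, a <= x <= b -> is_derive x 1 f (df x)) ->
  (forall x, a < x < b -> 0 <= df x) -> f a <= f b.
Proof.
move=> ab fdf df0; apply: (@ge0_is_derive_le f df a b ab).
- by move=> x; rewrite in_itv/= => /andP[ax xb]; apply: fdf; rewrite !ltW.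
- apply: derivable_within_continuous => x; rewrite in_itv/= => xab.
  by have [] := fdf x xab.
- by move=> x; rewrite in_itv/=; exact: df0.
Qed.

(** If z(b) < 0, let s be the supremum of the points where z >= 0. By continuity z(s) >= 0, and z <
    0 on ]s, b], so that z is nondecreasing there and z(b) >= z(s). The sign of the derivative is
    thus needed only where the barrier is violated. *)
Lemma der_barrier z dz a b : a <= b ->
  (forall x, a <= x <= b -> is_derive x 1 z (dz x)) ->
  0 <= z a -> (forall x, a < x <= b -> z x < 0 -> 0 <= dz x) -> 0 <= z b.
Proof.
move=> ab zdz za dz0; rewrite leNgt; apply/negP => zb.
pose S := [set x | a <= x <= b /\ 0 <= z x].
have Sa : S a by split => //; rewrite lexx.
have supS : has_sup S by split; [exists a|exists b => x [/andP[]]].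
set s := sup S.
have as_ : a <= s by apply: sup_upper_bound.
have sb : s <= b by apply: ge_sup; [exists a|move=> x [/andP[]]].
have zs0 : 0 <= z s.
  rewrite leNgt; apply/negP => zs.
  have cz : {for s, continuous z} by apply: (der_continuous (zdz s _)); rewrite as_.
  have /nbhs_ballP[e /= e0 He] : \forall x \near s, z x < 0.
    exact: (cvgr_lt (z s) cz).
  have [y Sy] := sup_adherent e0 supS.
  rewrite -/s => sey; have ys : y <= s by apply: sup_upper_bound.
  have : z y < 0.
    by apply: He; rewrite /ball/= ger0_norm ?subr_ge0//; lra.
  by case: Sy => _; rewrite leNgt => /negbTE ->.
have : z s <= z b.
  apply: (@der_ge0_le z dz s b sb).
    by move=> x /andP[sx xb]; apply: zdz; rewrite xb (le_trans as_ sx).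
  move=> x /andP[sx xb]; apply: dz0; first by rewrite ltW// andbT (le_lt_trans as_).
  rewrite ltNge; apply/negP => zx.
  have : x <= s.
    by apply: sup_upper_bound => //; split => //; rewrite (le_trans as_ (ltW sx)) ltW.
  by rewrite leNgt sx.
by move=> zsb; move: (le_lt_trans (le_trans zs0 zsb) zb); rewrite ltxx.
Qed.

(* The primitive is based at -1 so that it is differentiable at 0 as well. *)
Lemma primitive_exists g : continuous g ->
  exists G : R -> R, [/\ G 0 = 0,
    forall x, -1 < x -> is_derive x 1 G (g x) &
    forall t, 0 <= t -> G t = \int[lebesgue_measure]_(s in `[0, t]) g s].
Proof.
move=> cg.
pose H x : R := \int[lebesgue_measure]_(s in `[-1, x]) g s.
have gi (x y : R) : lebesgue_measure.-integrable `[x, y] (EFin \o g).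
  apply: continuous_compact_integrable; first exact: segment_compact.
  exact: continuous_subspaceT.
exists (fun x => H x - H 0); split; first by rewrite subrr.
- move=> x x1.
  have [dH HE] := @continuous_FTC1_closed R g (-1) x (x + 1)
    ltac:(lra) (gi _ _) x1 (cg x).
  have dHx : is_derive x 1 H (g x) by apply: DeriveDef; [exact: dH|rewrite -derive1E].
  by apply: (der_eq (derB dHx (is_derive_cst (H 0) x 1))); rewrite subr0.
- move=> t t0; rewrite /H (@Rintegral_itvB _ g (BLeft (-1)) (BRight t) 0)//.
  + rewrite Rintegral_itv_obnd_cbnd//; apply: integrableS (gi 0 t) => //.
    by apply: subset_itvr; rewrite bnd_simp.
  + by rewrite bnd_simp; lra.
Qed.

End real_derivatives.

Section comparison.
Context {R : realType}.
Implicit Types (f h q m Q : R -> R).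

Lemma continuous_norm_powR (p : R) : 0 < p -> continuous (fun x : R => `|x| `^ p).
Proof.
move=> p0 x; have [->|x0] := eqVneq x 0.
  apply/cvgrPdist_lt => e e0; rewrite normr0 powR0 ?gt_eqF//.
  apply/nbhs_ballP; exists (e `^ p^-1) => /=; first exact: powR_gt0.
  move=> y; rewrite /ball/= !sub0r !normrN => ye.
  rewrite ger0_norm ?powR_ge0//.
  apply: lt_le_trans (gt0_ltr_powR p0 _ _ ye) _; rewrite ?nnegrE ?powR_ge0//.
  by rewrite -powRrM mulVf ?gt_eqF// powRr1// ltW.
apply: (@continuous_comp _ _ _ (fun y : R => `|y|) (fun y : R => y `^ p)).
  exact: norm_continuous.
by apply: (der_continuous (is_derive1_powR p _)); rewrite normr_gt0.
Qed.

Lemma continuous_weighted_powR (k g p : R) f : 0 < p -> continuous f ->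
  continuous (fun s => k * (1 + `|s|) `^ (- g) * `|f s| `^ p).
Proof.
move=> p0 cf s; apply: cvgM; last first.
  apply: (@continuous_comp _ _ _ f (fun y : R => `|y| `^ p)); first exact: cf.
  exact: continuous_norm_powR.
apply: cvgM; first exact: cvg_cst.
have s1 : 0 < 1 + `|s| by rewrite ltr_pwDl.
apply: (@continuous_comp _ _ _ (fun y : R => 1 + `|y|) (fun y : R => y `^ (- g))).
  by apply: cvgD; [exact: cvg_cst|exact: norm_continuous].
exact: (der_continuous (is_derive1_powR (- g) s1)).
Qed.

(** The constant kap Q(t) is a supersolution on [0, t], because Q(s) <= Q(t) <= kap (b + 1) Q(t).
    Multiplication by the integrating factor e^(nu s) turns this into monotonicity, and Q is never
    differentiated. *)
Lemma relaxation_bound (b kap t : R) (m dm Q : R -> R) : 0 < b -> (b + 1)^-1 <= kap ->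
  0 <= t -> continuous m ->
  (forall s, 0 < s < t -> is_derive s 1 m (dm s)) ->
  (forall s, 0 < s < t -> b * dm s + (b + 1) * m s = Q s) ->
  (forall s, 0 < s < t -> Q s <= Q t) -> 0 <= Q t ->
  m 0 <= kap * Q t -> m t <= kap * Q t.
Proof.
move=> b0 kb t0 cm mdm mQ Qt Qt0 m0.
pose nu := (b + 1) / b.
pose y s := expR (nu * s) * (kap * Q t - m s).
have : y 0 <= y t.
  apply: (@ge0_is_derive_le _ y
    (fun s => nu * expR (nu * s) * (kap * Q t - m s) + expR (nu * s) * (0 - dm s))).
  - exact: t0.
  - move=> s; rewrite in_itv/= => st; apply: (derM (der_expR_lin _ _)).
    exact: (derB (is_derive_cst _ _ _) (mdm s st)).
  - apply: continuous_subspaceT => s; apply: cvgM.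
      exact: (der_continuous (der_expR_lin _ _)).
    by apply: cvgB; [exact: cvg_cst|exact: cm].
  - move=> s; rewrite in_itv/= => st.
    have -> : nu * expR (nu * s) * (kap * Q t - m s) + expR (nu * s) * (0 - dm s) =
        expR (nu * s) * b^-1 * (kap * (b + 1) * Q t - (b * dm s + (b + 1) * m s)).
      by rewrite /nu; field; rewrite gt_eqF.
    rewrite mQ// mulr_ge0 ?mulr_ge0 ?expR_ge0 ?invr_ge0 ?(ltW b0)// subr_ge0.
    apply: (le_trans (Qt s st)).
    rewrite -[X in X <= _]mul1r ler_wpM2r//.
    by rewrite -ler_pdivrMr ?div1r//; lra.
rewrite /y mulr0 expR0 mul1r => ym.
have : 0 <= expR (nu * t) * (kap * Q t - m t) by apply: le_trans ym; lra.
by rewrite pmulr_rge0 ?expR_gt0// subr_ge0.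
Qed.

(* [1 / (h^-p + h^-((p+1)/2))] is comparable to [h^p] for small [h] but grows only
   like [h^((p+1)/2)] for large [h], so that [h'] dominates a multiple of it
   even though the equation [h'' + 2 h' >= h^p] is of second order. *)
Lemma damped_lower_rate (p k g l t : R) (q dq h : R -> R) :
  1 < p -> 0 <= g -> 0 < l -> l <= 1 -> l * (p + 2) <= k -> 0 < q 0 -> h 0 = 0 ->
  (forall x : R, - (1 / 2) < x -> is_derive x 1 q (dq x)) ->
  (forall x : R, - (1 / 2) < x -> is_derive x 1 h (q x - 2 * h x)) ->
  (forall x : R, 0 <= x <= t -> k * (1 + x) `^ (- g) * h x `^ p <= dq x) ->
  forall x : R, 0 < x <= t ->
    q 0 * (1 - expR (- 2 * x)) / 2 <= h x /\
    l * (1 + x) `^ (- g) <=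
      (q x - 2 * h x) * (h x `^ (- p) + h x `^ (- ((p + 1) / 2))).
Proof.
move=> p1 g0 l0 l1 lk q0 h0 dq_ dh_ dq_ge.
have k0 : 0 < k by apply: lt_le_trans lk; rewrite mulr_gt0//; lra.
have dq0 (x : R) : 0 <= x <= t -> 0 <= dq x.
  by move=> xt; apply: le_trans (dq_ge x xt); rewrite !mulr_ge0 ?powR_ge0// ltW.
have q_ge (x : R) : 0 <= x <= t -> q 0 <= q x.
  move=> /andP[x0 xt]; apply: (@der_ge0_le _ q dq) => //.
    by move=> y /andP[y0 yx]; apply: dq_; lra.
  by move=> y /andP[y0 yx]; apply: dq0; lra.
(* Integrate (e^(2s) h)' = e^(2s) q >= e^(2s) q(0) from 0, where h vanishes. *)
have h_ge (x : R) : 0 <= x <= t -> q 0 * (1 - expR (- 2 * x)) / 2 <= h x.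
  move=> /andP[x0 xt].
  pose y s := expR (2 * s) * h s - q 0 / 2 * expR (2 * s).
  have : y 0 <= y x.
    apply: (@der_ge0_le _ y (fun s => (2 * expR (2 * s) * h s + expR (2 * s) *
       (q s - 2 * h s)) - q 0 / 2 * (2 * expR (2 * s)))) => //.
      move=> s /andP[s0 sx]; have s1 : - (1 / 2) < s by lra.
      exact: (derB (derM (der_expR_lin _ _) (dh_ s s1)) (derZ _ (der_expR_lin _ _))).
    move=> s /andP[s0 sx].
    have -> : 2 * expR (2 * s) * h s + expR (2 * s) * (q s - 2 * h s) -
       q 0 / 2 * (2 * expR (2 * s)) = expR (2 * s) * (q s - q 0) by field.
    by rewrite mulr_ge0 ?expR_ge0// subr_ge0 q_ge//; lra.
  rewrite /y mulr0 expR0 h0 mul1r mulr1 sub0r => yx.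
  have -> : q 0 * (1 - expR (- 2 * x)) / 2 =
      expR (- 2 * x) * (q 0 / 2 * expR (2 * x) - q 0 / 2).
    have E : expR (- 2 * x) * expR (2 * x) = 1.
      by rewrite -expRD -mulrDl addNr mul0r expR0.
    have -> : forall u v w : R, u * (w / 2 * v - w / 2) = w * (u * v - u) / 2.
      by move=> u v w; field.
    by rewrite E.
  have -> : h x = expR (- 2 * x) * (expR (2 * x) * h x).
    by rewrite mulrA -expRD -mulrDl addNr mul0r expR0 mul1r.
  by rewrite ler_pM2l ?expR_gt0//; lra.
have h_gt (x : R) : 0 < x <= t -> 0 < h x.
  move=> /andP[x0 xt]; apply: lt_le_trans (h_ge x _); last by rewrite ltW.
  by rewrite divr_gt0// mulr_gt0// subr_gt0 expR_lt1; lra.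
move=> x /andP[x0 xt]; split; first by apply: h_ge; rewrite ltW.
pose r := (p + 1) / 2.
have r0 : 0 < r by rewrite /r; lra.
pose a s := h s `^ (- p); pose b s := h s `^ (- r).
pose la s := l * (1 + s) `^ (- g).
(* [z] is h' minus its claimed lower bound. In [der_barrier] the sign of z' matters only where z <
   0, and there h' is small enough for the source in q' to dominate all other terms. *)
pose z s := q s - 2 * h s - la s * (a s + b s)^-1.
suff zx : 0 <= z x.
  have abx : 0 < a x + b x by rewrite addr_gt0 ?powR_gt0 ?h_gt// x0 xt.
  by move: zx; rewrite /z subr_ge0 ler_pdivrMr.
have la_le (s : R) : 0 <= s -> 0 <= la s <= l.
  move=> s0; rewrite /la mulr_ge0 ?powR_ge0 ?(ltW l0)//= ger_pMr//.
  rewrite powRN invf_le1 ?powR_gt0 ?ltr_wpDr//.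
  rewrite -[X in X <= _](congr1 (fun F : R -> R => F g) (powR1 R)).
  by rewrite ge0_ler_powR ?nnegrE//; lra.
pose da s := - p * h s `^ (- p - 1) * (q s - 2 * h s).
pose db s := - r * h s `^ (- r - 1) * (q s - 2 * h s).
pose dla s := l * (- g * (1 + s) `^ (- g - 1) * (0 + 1)).
pose dz s := (dq s - 2 * (q s - 2 * h s)) -
   (dla s * (a s + b s)^-1 + la s * (- (da s + db s) / (a s + b s) ^+ 2)).
have zdz (s : R) : 0 < s <= t -> is_derive s 1 z (dz s).
  move=> /andP[s0 st]; have hs : 0 < h s by rewrite h_gt// s0.
  have s1 : - (1 / 2) < s by lra.
  have s2 : 0 < 1 + s by lra.
  have abs0 : a s + b s != 0 by rewrite gt_eqF// addr_gt0// powR_gt0.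
  have dla_ : is_derive s 1 la (dla s).
    have d1 : is_derive s 1 (fun y : R => 1 + y) (0 + 1).
      exact: (derD (is_derive_cst (1 : R) s 1) (is_derive_id s 1)).
    exact: (derZ l (der_powR_comp (- g) d1 s2)).
  have dab : is_derive s 1 (fun y => a y + b y) (da s + db s).
    exact: (derD (der_powR_comp _ (dh_ s s1) hs) (der_powR_comp _ (dh_ s s1) hs)).
  have dX := @derV _ (fun y => a y + b y) s _ abs0 dab.
  have dlaX := derM dla_ dX.
  have dD := derB (dq_ s s1) (derZ 2 (dh_ s s1)).
  exact: (derB dD dlaX).
have dz0 (s : R) : 0 < s <= t -> z s < 0 -> 0 <= dz s.
  move=> /andP[s0 st] zs; have hs : 0 < h s by rewrite h_gt// s0.
  set H := h s in hs *; set D := q s - 2 * h s.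
  have as0 : 0 < a s by rewrite powR_gt0.
  have bs0 : 0 < b s by rewrite powR_gt0.
  have ls : 0 < la s by rewrite mulr_gt0// powR_gt0; lra.
  have /andP[_ ls1] : 0 <= la s <= l by apply: la_le; lra.
  have daE : da s = - p * (a s / H) * D.
    by rewrite /da powRB ?powRr1 ?ltW// (gt_eqF hs) implybT.
  have dbE : db s = - r * (b s / H) * D.
    by rewrite /db powRB ?powRr1 ?ltW// (gt_eqF hs) implybT.
  (* The exponent r = (p + 1) / 2 is chosen for this identity: it gives X^2 / H <= 1 / (b^2 H) = 1 /
     a, so that the term coming from (a + b)' is comparable to the source h^p = 1 / a. *)
  have b2 : b s ^+ 2 = a s / H.
    rewrite expr2 /b -powRD; last by rewrite (gt_eqF hs) implybT.
    rewrite /a -[X in _ / X]powRr1 ?(ltW hs)// -powRB ?(gt_eqF hs) ?implybT//.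
    by congr (_ `^ _); rewrite /r; field.
  have hpE : H `^ p = (a s)^-1 by rewrite /a powRN invrK.
  have D_lt : D < la s / (a s + b s) by move: zs; rewrite /z -/D subr_lt0.
  have dqs := dq_ge s ltac:(lra).
  rewrite hpE in dqs.
  have dlas : dla s <= 0.
    have -> : dla s = - (l * g * (1 + s) `^ (- g - 1)) by rewrite /dla; ring.
    by rewrite oppr_le0 !mulr_ge0 ?powR_ge0// ltW.
  have dla0 : dla s * (a s + b s)^-1 <= 0.
    by rewrite mulr_le0_ge0// invr_ge0 addr_ge0// ltW.
  have ab0 : 0 < a s + b s by rewrite addr_gt0.
  set X := (a s + b s)^-1 in dla0 D_lt *.
  have X0 : 0 < X by rewrite invr_gt0.
  have Xa : X <= (a s)^-1 by rewrite lef_pV2 ?posrE// lerDl ltW.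
  (* This term of z' is linear in D = h'; inserting D < la X, which is z < 0, makes it quadratic in
     [la]. *)
  have key : la s * ((p * a s + r * b s) / H * D) * X ^+ 2 <= p * la s ^+ 2 / a s.
    have pr : p * a s + r * b s <= p * (a s + b s).
      by rewrite mulrDr lerD2l ler_wpM2r ?(ltW bs0)// /r; lra.
    apply: (@le_trans _ _ (la s * (p * (a s + b s) / H * (la s * X)) * X ^+ 2)).
      rewrite ler_wpM2r ?exprn_ge0 ?(ltW X0)// ler_wpM2l ?(ltW ls)//.
      apply: (@le_trans _ _ ((p * a s + r * b s) / H * (la s * X))).
        rewrite ler_wpM2l ?(ltW D_lt)// divr_ge0 ?(ltW hs)//.
        by rewrite addr_ge0// mulr_ge0 ?ltW//; lra.
      apply: ler_wpM2r; first by rewrite mulr_ge0 ?(ltW ls) ?(ltW X0).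
      by apply: ler_wpM2r => //; rewrite invr_ge0 ltW.
    have -> : la s * (p * (a s + b s) / H * (la s * X)) * X ^+ 2 =
        p * la s ^+ 2 * (X ^+ 2 / H).
      by rewrite /X; field; rewrite !gt_eqF.
    apply: ler_wpM2l; first by rewrite mulr_ge0 ?exprn_ge0 ?(ltW ls)//; lra.
    have -> : (a s)^-1 = (b s ^+ 2)^-1 / H by rewrite b2; field; rewrite !gt_eqF.
    apply: ler_wpM2r; first by rewrite invr_ge0 ltW.
    rewrite -exprVn ler_pXn2r ?nnegrE//.
    - by rewrite lef_pV2 ?posrE// lerDr ltW.
    - exact: ltW.
    - by rewrite invr_ge0 ltW.
  have Dle : D <= la s / a s.
    by apply: le_trans (ltW D_lt) _; rewrite ler_wpM2l// ltW.
  have las2 : la s ^+ 2 <= l * la s by rewrite expr2 ler_wpM2r ?(ltW ls).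
  have kla : l * (1 + s) `^ (- g) * (p + 2) <= k * (1 + s) `^ (- g).
    by rewrite mulrAC ler_wpM2r ?powR_ge0.
  (* The source pays for p la / a, which bounds [key] since la <= 1, and for 2 la / a, which bounds
     2 D. This is the origin of the factor p + 2 in the hypothesis on l. *)
  have A : (la s * (p + 2)) / a s <= dq s.
    by apply: le_trans dqs; rewrite ler_wpM2r// invr_ge0 ltW.
  have B : p * la s ^+ 2 / a s <= p * la s / a s.
    rewrite ler_wpM2r ?invr_ge0 ?(ltW as0)// ler_wpM2l//; first by lra.
    by apply: le_trans las2 _; rewrite ger_pMl.
  have -> : dz s = dq s - 2 * D - dla s * X -
      la s * ((p * a s + r * b s) / H * D) * X ^+ 2.
    by rewrite /dz daE dbE -/D -/X /X; field; rewrite !gt_eqF.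
  have C : (la s * (p + 2)) / a s = p * la s / a s + 2 * (la s / a s) by ring.
  move: (le_trans key B) A dla0 Dle; rewrite C; set U := la s * _ * _; lra.
(* Near 0 the sign of [z] is clear, since [h] vanishes there and [q] does not. *)
have [d /andP[d0 dx] zd] : exists2 d, 0 < d <= x & 0 <= z d.
  have ch : h y @[y --> 0] --> h 0 by by apply: (der_continuous (dh_ 0 _)); lra.
  rewrite h0 in ch.
  have e0 : 0 < Num.min 1 (q 0 / 4) by rewrite lt_min ltr01 divr_gt0.
  have /nbhs_ballP[e /= ep He] : \forall y \near 0, h y < Num.min 1 (q 0 / 4).
    exact: (cvgr_lt 0 ch).
  pose d := Num.min x (e / 2).
  have d0 : 0 < d by rewrite lt_min x0 divr_gt0.
  have dx : d <= x by rewrite ge_min lexx.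
  exists d; first by rewrite d0.
  have : h d < Num.min 1 (q 0 / 4).
    apply: He; rewrite /ball/= sub0r normrN gtr0_norm//.
    by rewrite gt_min (_ : e / 2 < e) ?orbT//; lra.
  rewrite lt_min => /andP[hd1 hd2].
  have hd : 0 < h d by rewrite h_gt// d0 (le_trans dx).
  have qd : q 0 <= q d by rewrite q_ge// ltW//= (le_trans dx).
  have /andP[ld0 ld1] : 0 <= la d <= l by apply: la_le; exact: ltW.
  have ad : (h d)^-1 <= a d + b d.
    rewrite -[X in X <= _]addr0 lerD ?powR_ge0// /a powRN lef_pV2 ?posrE ?powR_gt0//.
    by apply: ge1r_powR; [rewrite hd ltW|exact: ltW].
  have abd : (a d + b d)^-1 <= h d.
    by rewrite -[X in _ <= X]invrK lef_pV2 ?posrE ?invr_gt0// addr_gt0// powR_gt0.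
  have : la d * (a d + b d)^-1 <= h d.
    apply: le_trans abd; rewrite ger_pMl ?(le_trans ld1)//.
    by rewrite invr_gt0 addr_gt0// powR_gt0.
  by rewrite /z; lra.
apply: (@der_barrier _ z dz d x) => //.
- by move=> s /andP[ds sx]; apply: zdz; lra.
- by move=> s /andP[ds sx]; apply: dz0; lra.
Qed.

End comparison.

(** * Lifespan inequality for the system of scalar differential relations *)

Section ode_lifespan.
Context {R : realType}.

(** [Lam] is any primitive of the weight (1 + x)^(-g): one argument serves the subcritical case,
    where it is a power, and the critical one, where it is a logarithm. *)
Lemma ode_lifespan (p k g b kap c l q0 tau : R) (f df al Q Lam : R -> R) :
  1 < p -> 0 <= k -> 0 <= g -> 0 < b -> (b + 1)^-1 <= kap -> kap < 1 -> 0 < q0 ->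
  1 <= tau -> c = (1 - kap) / b -> 0 < l -> l <= 1 -> l * (p + 2) <= k * c `^ p ->
  continuous f -> continuous al ->
  (forall x : R, 0 < x < tau -> is_derive x 1 f (df x)) ->
  (forall x : R, 0 < x < tau -> is_derive x 1 al (f x - al x)) ->
  (forall x : R, 0 < x < tau -> b * df x + (2 * b + 1) * f x + al x = Q x) ->
  (forall x y : R, 0 <= x -> x <= y -> y <= tau -> Q x <= Q y) ->
  (forall x : R, 0 <= x <= tau ->
    q0 + \int[lebesgue_measure]_(s in `[0, x]) (k * (1 + `|s|) `^ (- g) * `|f s| `^ p)
      <= Q x) ->
  0 <= f 0 -> f 0 + al 0 <= kap * q0 ->
  (forall x : R, 0 < x -> is_derive x 1 Lam ((1 + x) `^ (- g))) ->
  l * (Lam tau - Lam 1) <=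
    ((q0 / 3) `^ (- (p - 1)) + 2 * (q0 / 3) `^ (- ((p - 1) / 2))) / (p - 1).
Proof.
move=> p1 k0 g0 b0 bk k1 q00 tau1 cE l0 l1 lk cf cal fdf aldal feq Qnd Qint f0 m0 dLam.
have c0 : 0 < c by rewrite cE divr_gt0// subr_gt0.
pose G0 s := k * (1 + `|s|) `^ (- g) * `|f s| `^ p.
have cG0 : continuous G0 by apply: continuous_weighted_powR cf; exact: lt_trans p1.
have [G [G00 dG GE]] := primitive_exists cG0.
pose q s := q0 + G s.
have q0E : q 0 = q0 by rewrite /q G00 addr0.
have dq (x : R) : -1 < x -> is_derive x 1 q (G0 x).
  by move=> x1; apply: (der_eq (derD (is_derive_cst q0 x 1) (dG x x1))); rewrite add0r.
have qQ (x : R) : 0 <= x <= tau -> q x <= Q x.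
  by move=> xt; rewrite /q GE; [exact: Qint|case/andP: xt].
have Q_ge (x : R) : 0 <= x <= tau -> q0 <= Q x.
  move=> xt; apply: le_trans (qQ x xt); rewrite lerDl GE; last by case/andP: xt.
  by apply: Rintegral_ge0 => s _; rewrite !mulr_ge0 ?powR_ge0.
(* The equation for f reads f' + 2 f = (Q - m) / b with m = f + al, and m <= kap Q leaves the
   fraction (1 - kap) / b = c of Q, hence of q. *)
have rate (x : R) : 0 < x < tau -> c * q x <= df x + 2 * f x.
  move=> /andP[x0 xt].
  have mx : f x + al x <= kap * Q x.
    apply: (@relaxation_bound R b kap x (fun s => f s + al s)
      (fun s => df s + (f s - al s)) Q).
    - exact: b0.
    - exact: bk.
    - exact: ltW.
    - by move=> s; apply: cvgD; [exact: cf|exact: cal].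
    - move=> s /andP[s0 sx]; have st : 0 < s < tau by rewrite s0 (lt_trans sx).
      exact: (derD (fdf s st) (aldal s st)).
    - move=> s /andP[s0 sx]; rewrite -feq ?s0 ?(lt_trans sx)//; ring.
    - by move=> s /andP[s0 sx]; apply: Qnd; lra.
    - by apply: le_trans (Q_ge x _); lra.
    - apply: le_trans m0 _; rewrite ler_wpM2l ?Q_ge//; last by lra.
      by apply: le_trans bk; rewrite invr_ge0; lra.
  have -> : df x + 2 * f x = (Q x - (f x + al x)) / b.
    by rewrite -feq ?x0//; field; rewrite gt_eqF.
  rewrite ler_pdivlMr// cE mulrAC divfK ?gt_eqF//.
  have : (1 - kap) * q x <= (1 - kap) * Q x.
    by rewrite ler_wpM2l ?qQ//; lra.
  by move: mx; lra.
(* [h t := e^(-2t) H t] will solve [h' + 2 h = q]; since [q] is only known to be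
   continuous on ]-1, +oo[, its argument is truncated. *)
have [H [H0 dH]] : exists H : R -> R, H 0 = 0 /\
    forall x : R, -1 < x -> is_derive x 1 H (expR (2 * x) * q (Num.max x (- (1 / 2)))).
  have cqm : continuous (fun x : R => expR (2 * x) * q (Num.max x (- (1 / 2)))).
    move=> x; apply: cvgM; first exact: (der_continuous (der_expR_lin x 2)).
    apply: (@continuous_comp _ _ _ (fun y : R => Num.max y (- (1 / 2))) q).
      apply: continuous_max; [exact: cvg_id|exact: cvg_cst].
    apply: (der_continuous (dq _ _)).
    by rewrite lt_max; apply/orP; right; lra.
  by have [H [H0 dH _]] := primitive_exists cqm; exists H.
pose h s := expR (- 2 * s) * H s.
have h0 : h 0 = 0 by rewrite /h H0 mulr0.
have dh (x : R) : - (1 / 2) < x -> is_derive x 1 h (q x - 2 * h x).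
  move=> x2; have x1 : -1 < x by lra.
  have xmax : Num.max x (- (1 / 2)) = x by apply/max_idPl; exact: ltW.
  apply: (der_eq (derM (der_expR_lin x (- 2)) (dH x x1))).
  by rewrite xmax mulrA -expRD -mulrDl addNr mul0r expR0 mul1r /h; ring.
(* The function e^(2s) (f - c h) has derivative e^(2s) (f' + 2 f - c q) >= 0 and starts at f(0) >=
   0. *)
have fh (x : R) : 0 <= x <= tau -> c * h x <= f x.
  move=> /andP[x0 xt].
  pose y s := expR (2 * s) * f s - c * H s.
  have : y 0 <= y x.
    apply: (@ge0_is_derive_le _ y (fun s => (2 * expR (2 * s) * f s +
      expR (2 * s) * df s) - c * (expR (2 * s) * q (Num.max s (- (1 / 2)))))).
    - exact: x0.
    - move=> s; rewrite in_itv/= => /andP[s0 sx].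
      have s1 : -1 < s by lra.
      have st : 0 < s < tau by rewrite s0 (lt_le_trans sx).
      exact: (derB (derM (der_expR_lin s 2) (fdf s st)) (derZ c (dH s s1))).
    - apply: continuous_in_subspaceT => s; rewrite inE/= in_itv/= => /andP[s0 _].
      have s1 : -1 < s by lra.
      apply: cvgB; last exact: (der_continuous (derZ c (dH s s1))).
      by apply: cvgM; [exact: (der_continuous (der_expR_lin s 2))|exact: cf].
    - move=> s; rewrite in_itv/= => /andP[s0 sx].
      have -> : Num.max s (- (1 / 2)) = s by apply/max_idPl; lra.
      have st : 0 < s < tau by rewrite s0 (lt_le_trans sx).
      have -> : 2 * expR (2 * s) * f s + expR (2 * s) * df s - c * (expR (2 * s) * q s)
          = expR (2 * s) * (df s + 2 * f s - c * q s) by ring.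
      by rewrite mulr_ge0 ?expR_ge0// subr_ge0 rate.
  rewrite /y mulr0 expR0 H0 mul1r mulr0 subr0 => yx.
  have -> : f x = expR (- 2 * x) * (expR (2 * x) * f x).
    by rewrite mulrA -expRD -mulrDl addNr mul0r expR0 mul1r.
  rewrite /h mulrCA ler_pM2l ?expR_gt0//; lra.
have q0_gt : 0 < q 0 by rewrite q0E.
have dqh (x : R) : - (1 / 2) < x -> is_derive x 1 q (G0 x) by move=> x2; apply: dq; lra.
have qQ' (x : R) : 0 <= x <= tau -> q 0 <= q x.
  by move=> /andP[x0 xt]; rewrite q0E lerDl GE//; apply: Rintegral_ge0 => s _;
    rewrite !mulr_ge0 ?powR_ge0.
have h_ge0 (x : R) : 0 <= x <= tau -> 0 <= h x.
  move=> /andP[x0 xt]; rewrite mulr_ge0 ?expR_ge0//.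
  rewrite -H0; apply: (@der_ge0_le _ H _ _ _ x0).
    by move=> s /andP[s0 _]; apply: dH; lra.
  move=> s /andP[s0 sx]; rewrite mulr_ge0 ?expR_ge0//.
  have -> : Num.max s (- (1 / 2)) = s by apply/max_idPl; lra.
  by rewrite (le_trans (ltW q0_gt))// qQ'//; lra.
have G0_ge (x : R) : 0 <= x <= tau ->
    (k * c `^ p) * (1 + x) `^ (- g) * h x `^ p <= G0 x.
  move=> xt; have /andP[x0 _] := xt.
  have -> : k * c `^ p * (1 + x) `^ (- g) * h x `^ p =
      k * (1 + x) `^ (- g) * (c * h x) `^ p.
    by rewrite powRM ?h_ge0 ?(ltW c0)//; ring.
  rewrite /G0 (ger0_norm x0) ler_wpM2l ?mulr_ge0 ?powR_ge0//.
  have chx : 0 <= c * h x by apply: mulr_ge0; [exact: ltW|exact: h_ge0].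
  apply: ge0_ler_powR; rewrite ?nnegrE//.
    exact: ltW (lt_trans ltr01 p1).
  exact: le_trans (fh x xt) (ler_norm _).
have hrate := damped_lower_rate p1 g0 l0 l1 lk q0_gt h0 dqh dh G0_ge.
have h_gt (x : R) : 0 < x <= tau -> 0 < h x.
  move=> xt; have [+ _] := hrate x xt; apply: lt_le_trans.
  by rewrite divr_gt0// mulr_gt0// subr_gt0 expR_lt1; lra.
(* -Y is a primitive of y^(-p) + y^(-(p+1)/2), so the rate of [hrate] integrates to Y(h(1)) -
   Y(h(tau)). Since Y blows up at 0, the integration starts at time 1. *)
pose Y y : R := (y `^ (- (p - 1)) + 2 * y `^ (- ((p - 1) / 2))) / (p - 1).
have Yh : l * (Lam tau - Lam 1) <= Y (h 1) - Y (h tau).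
  pose y s := 0 - ((p - 1)^-1 * (h s `^ (- (p - 1)) + 2 * h s `^ (- ((p - 1) / 2)))
     + l * Lam s).
  have : y 1 <= y tau.
    apply: (@der_ge0_le _ y (fun s => 0 - ((p - 1)^-1 *
       (- (p - 1) * h s `^ (- (p - 1) - 1) * (q s - 2 * h s) +
        2 * (- ((p - 1) / 2) * h s `^ (- ((p - 1) / 2) - 1) * (q s - 2 * h s))) +
       l * (1 + s) `^ (- g)))).
    - exact: tau1.
    - move=> s /andP[s1 st].
      have hs : 0 < h s by apply: h_gt; lra.
      have s2 : - (1 / 2) < s by lra.
      have s0 : 0 < s by lra.
      have dpow a := der_powR_comp a (dh s s2) hs.
      apply: (derB (is_derive_cst (0 : R) s 1)).
      exact: (derD (derZ _ (derD (dpow _) (derZ 2 (dpow _)))) (derZ l (dLam s s0))).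
    - move=> s /andP[s1 st].
      have [_] := hrate s ltac:(lra).
      have -> : - (p - 1) - 1 = - p by ring.
      have -> : - ((p - 1) / 2) - 1 = - ((p + 1) / 2) by field.
      set A := h s `^ _; set B := h s `^ _; set D := q s - 2 * h s => DAB.
      have -> : 0 - ((p - 1)^-1 * (- (p - 1) * A * D + 2 * (- ((p - 1) / 2) * B * D))
         + l * (1 + s) `^ (- g)) = D * (A + B) - l * (1 + s) `^ (- g).
        by field; rewrite subr_eq0 gt_eqF.
      by rewrite subr_ge0.
  by rewrite /y /Y ![_ / (p - 1)]mulrC; lra.
rewrite -[X in _ <= X]/(Y (q0 / 3)).
have Yt : 0 <= Y (h tau).
  by apply: divr_ge0; [rewrite addr_ge0 ?mulr_ge0 ?powR_ge0|lra].
(* The 3 comes from (1 - e^(-2)) / 2 >= 1/3, as e^2 >= 1 + 2. *)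
have h1 : q0 / 3 <= h 1.
  have [h1_ge _] := hrate 1 ltac:(lra); apply: le_trans h1_ge.
  have e3 : expR (- 2 * 1) <= 3^-1 :> R.
    rewrite mulr1 expRN lef_pV2 ?posrE ?expR_gt0//.
    by have := expR_ge1Dx (2 : R); lra.
  rewrite q0E; move: e3 q00; set e := expR _ => e3 q00.
  rewrite -mulrA ler_pM2l//; lra.
suff : Y (h 1) <= Y (q0 / 3) by move: Yh Yt; lra.
have h10 : 0 < h 1 by apply: h_gt; lra.
have q30 : 0 < q0 / 3 by lra.
rewrite ler_pM2r ?invr_gt0 ?subr_gt0// lerD// ?ler_pM2l//.
- rewrite !powRN lef_pV2 ?posrE ?powR_gt0//.
  by apply: ge0_ler_powR; rewrite ?nnegrE ?(ltW h10) ?(ltW q30)//; lra.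
- rewrite !powRN lef_pV2 ?posrE ?powR_gt0//.
  by apply: ge0_ler_powR; rewrite ?nnegrE ?(ltW h10) ?(ltW q30)//; lra.
Qed.

End ode_lifespan.

(** * Solving the lifespan inequality for the time *)

Section lifespan_constants.
Context {R : realType}.
Implicit Types p g l : R.

Lemma powR_ge1N (e a : R) : 0 < e -> e <= 1 -> 0 <= a -> 1 <= e `^ (- a).
Proof.
move=> e0 e1 a0; rewrite -[X in X <= _](powRr0 e).
by apply: ger_powR; rewrite ?e0 ?e1// oppr_le0.
Qed.

(** For e <= 1 the power e^(-(p-1)) dominates e^(-(p-1)/2). This is where eps has to be small: the
    term with the smaller exponent reflects the regime of large h. *)
Lemma initial_bound p (q1 : R) : 1 < p -> 0 < q1 ->
  exists2 M, 0 < M & forall e : R, 0 < e -> e <= 1 ->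
    ((e * q1 / 3) `^ (- (p - 1)) + 2 * (e * q1 / 3) `^ (- ((p - 1) / 2))) / (p - 1)
      <= M * e `^ (- (p - 1)).
Proof.
move=> p1 q10.
exists (((q1 / 3) `^ (- (p - 1)) + 2 * (q1 / 3) `^ (- ((p - 1) / 2))) / (p - 1)).
  by apply: divr_gt0; [rewrite addr_gt0 ?mulr_gt0// powR_gt0 ?divr_gt0|lra].
move=> e e0 e1.
rewrite [X in _ <= X]mulrAC; apply: ler_wpM2r; first by rewrite invr_ge0; lra.
have q3 : 0 <= q1 / 3 by rewrite divr_ge0// ltW.
rewrite -(mulrA e) !(powRM _ (ltW e0) q3) [X in _ <= X]mulrDl; apply: lerD.
  by rewrite mulrC.
rewrite -mulrA ler_pM2l// mulrC.
by rewrite ler_wpM2l ?powR_ge0// ger_powR ?e0// lerN2; lra.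
Qed.

Lemma algebraic_lifespan p g l (q1 : R) : 1 < p -> g < 1 -> 0 < l -> 0 < q1 ->
  exists2 C, 0 < C & forall e t : R, 0 < e -> e <= 1 ->
    (1 <= t -> l * ((1 + t) `^ (1 - g) / (1 - g) - (1 + 1) `^ (1 - g) / (1 - g)) <=
      ((e * q1 / 3) `^ (- (p - 1)) + 2 * (e * q1 / 3) `^ (- ((p - 1) / 2))) / (p - 1)) ->
    t <= C * e `^ (- ((p - 1) / (1 - g))).
Proof.
move=> p1 g1 l0 q10; have [M M0 HM] := initial_bound p1 q10.
have g0 : 0 < 1 - g by lra.
pose K := (1 + 1) `^ (1 - g) + (1 - g) / l * M.
have K0 : 0 < K by rewrite addr_gt0 ?powR_gt0// mulr_gt0// divr_gt0.
(* The summand 1 covers t < 1, for which the hypothesis says nothing; the power of e is at least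
   1. *)
exists (1 + K `^ (1 - g)^-1); first by rewrite ltr_wpDr ?powR_ge0.
move=> e t e0 e1 Ht.
have pg0 : 0 <= (p - 1) / (1 - g) by rewrite divr_ge0//; lra.
have E1 : 1 <= e `^ (- ((p - 1) / (1 - g))) by exact: powR_ge1N.
rewrite mulrDl mul1r.
have [t1|t1] := leP 1 t; last first.
  by rewrite (le_trans (ltW t1))// (le_trans E1)// lerDl mulr_ge0// powR_ge0.
have {}Ht := le_trans (Ht t1) (HM e e0 e1).
set E := e `^ (- (p - 1)) in Ht.
have E1' : 1 <= E by apply: powR_ge1N => //; lra.
have tK : (1 + t) `^ (1 - g) <= K * E.
  have -> : (1 + t) `^ (1 - g) = (1 + 1) `^ (1 - g) + (1 - g) / l *
      (l * ((1 + t) `^ (1 - g) / (1 - g) - (1 + 1) `^ (1 - g) / (1 - g))).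
    by field; rewrite !gt_eqF.
  rewrite /K [X in _ <= X]mulrDl; apply: lerD; first by rewrite ler_peMr ?powR_ge0.
  by rewrite -[X in _ <= X]mulrA ler_pM2l ?divr_gt0.
have : ((1 + t) `^ (1 - g)) `^ (1 - g)^-1 <= (K * E) `^ (1 - g)^-1.
  apply: ge0_ler_powR tK; rewrite ?nnegrE ?powR_ge0 ?invr_ge0 ?(ltW g0)//.
  by rewrite mulr_ge0 ?powR_ge0// ltW.
rewrite -powRrM mulfV ?gt_eqF// powRr1; last by lra.
rewrite powRM ?powR_ge0 ?(ltW K0)// -powRrM mulNr.
by move=> tKE; move: E1 tKE; lra.
Qed.

Lemma exponential_lifespan p l (q1 : R) : 1 < p -> 0 < l -> 0 < q1 ->
  exists2 C, 0 < C & forall e t : R, 0 < e -> e <= 1 ->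
    (1 <= t -> l * (ln (1 + t) - ln (1 + 1)) <=
      ((e * q1 / 3) `^ (- (p - 1)) + 2 * (e * q1 / 3) `^ (- ((p - 1) / 2))) / (p - 1)) ->
    t <= expR (C * e `^ (- (p - 1))).
Proof.
move=> p1 l0 q10; have [M M0 HM] := initial_bound p1 q10.
have ln2 : 0 <= ln (1 + 1) :> R by apply: ln_ge0; lra.
exists (1 + (ln (1 + 1) + M / l)).
  by rewrite ltr_wpDr// addr_ge0// divr_ge0// ltW.
move=> e t e0 e1 Ht.
have E1 : 1 <= e `^ (- (p - 1)) by apply: powR_ge1N => //; lra.
set E := e `^ _ in E1 *.
have [t1|t1] := leP 1 t; last first.
  rewrite (le_trans (ltW t1))// -[X in X <= _]expR0 ler_expR; apply: mulr_ge0; last by lra.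
  have Ml : 0 <= M / l by rewrite divr_ge0 ?(ltW M0) ?(ltW l0).
  by apply: addr_ge0; [exact: ler01|exact: addr_ge0].
have {}Ht := le_trans (Ht t1) (HM e e0 e1); rewrite -/E in Ht.
have t0 : 0 < 1 + t by lra.
apply: (@le_trans _ _ (1 + t)); first by lra.
rewrite -[X in X <= _](@lnK R) ?posrE// ler_expR.
have -> : ln (1 + t) = ln (1 + 1) + l^-1 * (l * (ln (1 + t) - ln (1 + 1))).
  by field; rewrite gt_eqF.
have : l^-1 * (l * (ln (1 + t) - ln (1 + 1))) <= l^-1 * (M * E).
  by rewrite ler_pM2l ?invr_gt0.
have : ln (1 + 1) <= ln (1 + 1) * E :> R by rewrite ler_peMr.
by rewrite mulrA; lra.
Qed.

End lifespan_constants.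

(** * Smooth cutoff functions *)

Section smooth_functions.
Context {R : realType}.

Lemma CkS (V : normedModType R) k (f : V -> R) : Ck k.+1 f -> Ck k f.
Proof.
elim: k f => [|k IH] f [cf df]; first by split.
by split=> // v; have [dfv Cdf] := df v; split=> //; exact: IH.
Qed.

Lemma Ck_continuous (V : normedModType R) k (f : V -> R) : Ck k f -> continuous f.
Proof. by case: k => [|k] []. Qed.

Lemma Ck_cst (V : normedModType R) k (c : R) : Ck k (fun _ : V => c).
Proof.
elim: k c => [|k IH] c; split=> //; try exact: cst_continuous.
move=> v; split; first by move=> x; exact: derivable_cst.
rewrite (_ : 'D_v _ = fun=> 0); first exact: IH.
by apply/funext => x; rewrite derive_cst.
Qed.

Lemma CkD (V : normedModType R) k (f g : V -> R) : Ck k f -> Ck k g ->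
  Ck k (fun x => f x + g x).
Proof.
elim: k f g => [|k IH] f g [cf df] [cg dg]; split=> //; try by
  move=> x; apply: cvgD; [exact: cf|exact: cg].
move=> v; have [dfv Cf] := df v; have [dgv Cg] := dg v; split.
  by move=> x; apply: derivableD.
rewrite (_ : 'D_v _ = fun x => 'D_v f x + 'D_v g x); first exact: IH.
by apply/funext => x; rewrite deriveD.
Qed.

Lemma CkM (V : normedModType R) k (f g : V -> R) : Ck k f -> Ck k g ->
  Ck k (fun x => f x * g x).
Proof.
elim: k f g => [|k IH] f g Cf Cg; have [cf df] := Cf; have [cg dg] := Cg; split=> //;
  try by move=> x; apply: cvgM; [exact: cf|exact: cg].
move=> v; have [dfv Cdf] := df v; have [dgv Cdg] := dg v; split.
  by move=> x; apply: derivableM.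
rewrite (_ : 'D_v _ = fun x => f x * 'D_v g x + g x * 'D_v f x).
  by apply: CkD; apply: IH => //; exact: CkS.
by apply/funext => x; rewrite deriveM.
Qed.

(** The derivative of 1/f is a polynomial in 1/f and the derivative of f, so the induction
    hypothesis applies to 1/f itself at the lower order. *)
Lemma Ck_inv (V : normedModType R) k (f : V -> R) : (forall x, f x != 0) ->
  Ck k f -> Ck k (fun x => (f x)^-1).
Proof.
move=> f0; elim: k => [|k IH] Cf; have [cf df] := Cf; split=> //;
  try by move=> x; apply: cvgV; [exact: f0|exact: cf].
move=> v; have [dfv Cdf] := df v; split; first by move=> x; exact: derivableV.
rewrite (_ : 'D_v _ = fun x => -1 * ((f x)^-1 * (f x)^-1 * 'D_v f x)).
  have CV := IH (CkS Cf).
  by apply: CkM; [exact: Ck_cst|apply: CkM => //; exact: CkM].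
by apply/funext => x; rewrite deriveV// /GRing.scale/= expr2 invfM mulN1r mulNr.
Qed.

(** [L] is the linear part of the affine map [l]. Along v the difference quotients of g o l are
    those of g along L v, so every derivative is again a function composed with [l]. *)
Lemma Ck_comp_affine (V W : normedModType R) k (l L : V -> W) (g : W -> R) :
  (forall (h : R) v x, l (h *: v + x) = h *: L v + l x) -> continuous l ->
  Ck k g -> Ck k (fun x => g (l x)).
Proof.
move=> lL cl; elim: k g => [|k IH] g [cg dg]; split=> //; try by
  move=> x; apply: (@continuous_comp _ _ _ l g); [exact: cl|exact: cg].
have E v x : (fun h : R => h^-1 *: (((fun y => g (l y)) \o shift x) (h *: v) - g (l x)))
    = (fun h : R => h^-1 *: ((g \o shift (l x)) (h *: L v) - g (l x))).
  by apply/funext => h /=; rewrite lL.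
move=> v; have [dgv Cg] := dg (L v); split.
  by move=> x; rewrite /derivable E; exact: dgv.
rewrite (_ : 'D_v _ = fun x => 'D_(L v) g (l x)); first exact: (IH _ Cg).
by apply/funext => x; rewrite /derive E.
Qed.

Lemma Ck_prod (V : normedModType R) k (I : Type) (s : seq I) (f : I -> V -> R) :
  (forall i, Ck k (f i)) -> Ck k (fun x => \prod_(i <- s) f i x).
Proof.
move=> Cf; elim: s => [|i s IH].
  rewrite (_ : (fun x => _) = fun=> 1); first exact: Ck_cst.
  by apply/funext => x; rewrite big_nil.
rewrite (_ : (fun x => _) = fun x => f i x * \prod_(j <- s) f j x); first exact: CkM.
by apply/funext => x; rewrite big_cons.
Qed.

Lemma derive_real (f : R -> R) (d v x : R) : is_derive x 1 f d ->
  is_derive x v f (v * d).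
Proof.
move=> [/derivable1_diffP df fd]; apply: DeriveDef; first exact/diff_derivable.
by rewrite -fd !deriveE// -[X in 'd f x X]mulr1 linearZ.
Qed.

(** A family closed under differentiation consists of smooth functions; no formula for iterated
    derivatives is needed. It serves for multiples of an exponential and for [flat]. *)
Lemma Ck_real_family (I : Type) (f : I -> R -> R) (s : I -> I) :
  (forall i (x : R), is_derive x 1 (f i) (f (s i) x)) ->
  forall k i, Ck k (f i).
Proof.
move=> df; elim=> [|k IH] i; split=> //; try by move=> x; exact: (der_continuous (df i x)).
move=> v; split; first by move=> x; have [] := derive_real v (df i x).
rewrite (_ : 'D_v _ = fun x => v * f (s i) x); first by apply: CkM; [exact: Ck_cst|].
by apply/funext => x; have [] := derive_real v (df i x).
Qed.

Lemma Ck_expR k (c : R) : Ck k (fun x => expR (c * x)).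
Proof.
suff : Ck k (fun x => 1 * expR (c * x)).
  by congr Ck; apply/funext => x; rewrite mul1r.
apply: (@Ck_real_family _ (fun a x => a * expR (c * x)) (fun a => a * c)) => a x.
by apply: (der_eq (derZ a (der_expR_lin x c))); rewrite mulrA.
Qed.

(* The derivatives of [flat P] belong to the same family. *)
Definition flat (P : {poly R}) (x : R) : R :=
  if 0 < x then P.[x^-1] * expR (- x^-1) else 0.

Lemma horner_bound (P : {poly R}) : exists2 C, 0 <= C &
  forall y : R, 1 <= y -> `|P.[y]| <= C * y ^+ size P.
Proof.
exists (\sum_(i < size P) `|P`_i|); first exact: sumr_ge0.
move=> y y1; rewrite horner_coef mulr_suml; apply: le_trans (ler_norm_sum _ _ _) _.
apply: ler_sum => i _; rewrite normrM ler_wpM2l// normrX.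
rewrite ger0_norm ?(le_trans ler01)//.
by apply: ler_weXn2l => //; exact: ltnW.
Qed.

(** The exponential e^(-1/x) beats every power of 1/x. The order x^2 is what makes [flat P]
    differentiable at 0 with derivative 0. *)
Lemma flat_quadratic (P : {poly R}) : exists2 C, 0 <= C &
  forall x, x <= 1 -> `|flat P x| <= C * x ^+ 2.
Proof.
have [C C0 HC] := horner_bound P.
(* The exponential series is used at order N + 1 = size P + 2: [size P] powers for the polynomial
   and two for x^2. *)
pose N := (size P).+1.
exists (C * N.+1`!%:R); first by rewrite mulr_ge0.
move=> x x1; rewrite /flat; case: ifPn => [x0|_]; last first.
  by rewrite normr0; apply: mulr_ge0; [exact: mulr_ge0|exact: sqr_ge0].
set y := x^-1.
have y1 : 1 <= y by rewrite invf_ge1.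
have y0 : 0 < y by rewrite invr_gt0.
have E : y ^+ N.+1 / N.+1`!%:R <= expR y.
  by apply: le_trans (expR_ge1Dxn N (ltW y0)); rewrite lerDr.
have {}E : y ^+ size P * expR (- y) <= N.+1`!%:R * x ^+ 2.
  rewrite expRN ler_pdivrMr ?expR_gt0//.
  have -> : y ^+ size P = y ^+ N.+1 / N.+1`!%:R * (N.+1`!%:R * x ^+ 2).
    rewrite mulrA divfK ?pnatr_eq0 -?lt0n ?fact_gt0// /N -addn2 exprD.
    by rewrite -mulrA -exprMn mulVf ?gt_eqF// expr1n mulr1.
  by rewrite mulrC ler_wpM2l// mulr_ge0// sqr_ge0.
rewrite normrM [X in _ * X]ger0_norm ?expR_ge0//.
apply: le_trans (ler_wpM2r (expR_ge0 _) (HC y y1)) _.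
by rewrite -!mulrA ler_wpM2l.
Qed.

(** For x > 0 the derivative of P(1/x) e^(-1/x) is x^(-2) (P - P')(1/x) e^(-1/x). At 0 the slope is
    flat P z / z, which tends to 0 by the quadratic bound. *)
Lemma flat_derive (P : {poly R}) (x : R) :
  is_derive x 1 (flat P) (flat ('X^2 * (P - P^`())) x).
Proof.
have [x0|x0|->] := ltgtP x 0.
- rewrite {2}/flat ltNge (ltW x0)/=.
  apply: (@near_eq_is_derive _ _ _ (fun=> 0)).
  near=> y; rewrite /flat ltNge ltW//.
  by near: y; exact: lt_nbhsl.
- rewrite {2}/flat x0.
  have xn0 : x != 0 by rewrite gt_eqF.
  have dV := derV xn0 (is_derive_id x 1).
  have dP := der_comp (is_derive_poly P x^-1) dV.
  have dE := der_comp (der_expR_lin x^-1 (-1)) dV.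
  have := derM dP dE.
  rewrite (_ : (fun y => _) = fun y => P.[y^-1] * expR (- y^-1)); last first.
    by apply/funext => y /=; rewrite mulN1r.
  move=> H; apply: der_eq.
    apply: (near_eq_is_derive _ H).
    by near=> y; rewrite /flat ifT//; near: y; exact: lt_nbhsr.
  by rewrite !hornerE/= mulN1r; field.
- rewrite {2}/flat ltxx.
  have [C C0 HC] := flat_quadratic P.
  have f00 : flat P 0 = 0 by rewrite /flat ltxx.
  apply/is_derive1_caratheodory; exists (fun z => flat P z / z); split.
  + move=> z; rewrite f00 !subr0; have [->|z0] := eqVneq z 0; first by rewrite f00 mulr0.
    by rewrite divfK.
  + rewrite /prop_for /continuous_at f00 mul0r; apply/cvgrPdist_le => e e0.
    near=> z; rewrite sub0r normrN normrM.
    have [->|z0] := eqVneq z 0; first by rewrite f00 normr0 mul0r ltW.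
    have z1 : z <= 1 by apply: ltW; near: z; exact: lt_nbhsl.
    apply: (@le_trans _ _ (C * z ^+ 2 * `|z^-1|)); first by rewrite ler_wpM2r// HC.
    have -> : C * z ^+ 2 * `|z^-1| = C * `|z|.
      rewrite -normr_id -mulrA -[z ^+ 2]ger0_norm ?sqr_ge0// -normrM normr_id.
      by rewrite expr2 mulfK// normr_id.
    have : `|z| <= e / (C + 1).
      near: z; apply/nbhs_ballP; exists (e / (C + 1)) => /=.
        by rewrite divr_gt0// ltr_wpDl.
      by move=> z; rewrite /ball/= sub0r normrN => /ltW.
    move=> ze; apply: (@le_trans _ _ (C * (e / (C + 1)))); first by rewrite ler_wpM2l.
    by rewrite mulrCA ger_pMr// ler_pdivrMr ?mul1r ?ltr_wpDl// lerDl.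
  + by rewrite f00 mul0r.
Unshelve. all: by end_near. Qed.

Lemma flat1_ge0 (x : R) : 0 <= flat 1 x.
Proof. by rewrite /flat; case: ifP => // _; rewrite hornerC mul1r expR_ge0. Qed.

Lemma flat1_gt0 (x : R) : (0 < flat 1 x) = (0 < x).
Proof. by rewrite /flat; case: ifP => // _; rewrite ?ltxx// hornerC mul1r expR_gt0. Qed.

Lemma Ck_flat k P : Ck k (flat P).
Proof. exact: (Ck_real_family (fun Q x => flat_derive Q x)). Qed.

Definition smooth_step (x : R) : R := flat 1 x / (flat 1 x + flat 1 (1 - x)).

Lemma smooth_step_den (x : R) : 0 < flat 1 x + flat 1 (1 - x).
Proof.
have [x0|x0] := leP x 0.
  by rewrite ltr_wpDl ?flat1_ge0// flat1_gt0; lra.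
by rewrite ltr_wpDr ?flat1_ge0// flat1_gt0.
Qed.

Lemma Ck_smooth_step k : Ck k smooth_step.
Proof.
apply: CkM; first exact: Ck_flat.
apply: Ck_inv; first by move=> x; rewrite gt_eqF// smooth_step_den.
apply: CkD; first exact: Ck_flat.
apply: (@Ck_comp_affine _ _ k (fun x : R => 1 - x) (fun v : R => - v)) => //.
- by move=> h v x; rewrite /GRing.scale/=; ring.
- by move=> x; apply: cvgB; [exact: cvg_cst|exact: cvg_id].
- exact: Ck_flat.
Qed.

Lemma smooth_step_ge0 (x : R) : 0 <= smooth_step x.
Proof. by rewrite divr_ge0 ?flat1_ge0// ltW// smooth_step_den. Qed.

Lemma smooth_step0 (x : R) : x <= 0 -> smooth_step x = 0.
Proof. by move=> x0; rewrite /smooth_step /flat ltNge x0 mul0r. Qed.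

Lemma smooth_step1 (x : R) : 1 <= x -> smooth_step x = 1.
Proof.
move=> x1; rewrite /smooth_step [flat 1 (1 - x)]/flat ltNge subr_le0 x1/= addr0.
by rewrite divff// gt_eqF// flat1_gt0 (lt_le_trans ltr01).
Qed.

(** A smooth plateau of height 1 over [a, b] with ramps of width d; the shift by 1 places the ramps
    outside [a, b]. *)
Definition cutoff (a b d x : R) : R :=
  smooth_step ((x - a) / d + 1) * smooth_step ((b - x) / d + 1).

Lemma Ck_cutoff k a b d : Ck k (cutoff a b d).
Proof.
apply: CkM.
- apply: (@Ck_comp_affine _ _ k (fun x : R => (x - a) / d + 1) (fun v : R => v / d)).
  + by move=> h v x; rewrite /GRing.scale/=; ring.
  + move=> x; apply: cvgD; last exact: cvg_cst.
    by apply: cvgM; [apply: cvgB; [exact: cvg_id|exact: cvg_cst]|exact: cvg_cst].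
  + exact: Ck_smooth_step.
- apply: (@Ck_comp_affine _ _ k (fun x : R => (b - x) / d + 1) (fun v : R => - v / d)).
  + by move=> h v x; rewrite /GRing.scale/=; ring.
  + move=> x; apply: cvgD; last exact: cvg_cst.
    by apply: cvgM; [apply: cvgB; [exact: cvg_cst|exact: cvg_id]|exact: cvg_cst].
  + exact: Ck_smooth_step.
Qed.

Lemma cutoff_ge0 a b d x : 0 <= cutoff a b d x.
Proof. by rewrite mulr_ge0 ?smooth_step_ge0. Qed.

Lemma cutoff1 a b d x : 0 < d -> a <= x <= b -> cutoff a b d x = 1.
Proof.
move=> d0 /andP[ax xb].
by rewrite /cutoff !smooth_step1 ?mulr1// lerDr divr_ge0 ?subr_ge0// ltW.
Qed.

Lemma cutoff_neq0 a b d x : 0 < d -> cutoff a b d x != 0 -> a - d <= x <= b + d.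
Proof.
move=> d0; rewrite /cutoff mulf_eq0 negb_or => /andP[s1 s2].
rewrite !leNgt -negb_or; apply: contraNN s1 => /orP[] xd.
  rewrite smooth_step0// -lerBrDr sub0r ler_pdivrMr// mulN1r; lra.
by move: s2; rewrite smooth_step0 ?eqxx// -lerBrDr sub0r ler_pdivrMr// mulN1r; lra.
Qed.

End smooth_functions.

(** * Truncated plane waves as test functions *)

Section test_function_lemmas.
Context {R : realType}.

Lemma derive_tsupport (V : normedModType R) (f : V -> R) v :
  tsupport ('D_v f) `<=` tsupport f.
Proof.
have : [set x | 'D_v f x != 0] `<=` closure [set x | f x != 0].
  move=> x; apply: contraPP => nfx.
  apply/negP; rewrite negbK; apply/eqP.
  have op : open (~` closure [set x | f x != 0]) by apply/closed_openC/closed_closure.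
  have nx : \forall y \near x, (~` closure [set x | f x != 0]) y.
    exact: (open_nbhs_nbhs (conj op nfx)).
  rewrite (@near_eq_derive _ _ _ _ (fun=> 0)) ?derive_cst//.
  near=> y; apply: contrapT => /eqP fy.
  have : (~` closure [set x | f x != 0]) y by near: y.
  by apply; apply: subset_closure.
move=> sub; rewrite /tsupport; apply: (subset_trans (closureS sub)).
by rewrite -(closure_id _).1//; exact: closed_closure.
Unshelve. all: by end_near. Qed.

Lemma test_function_derive (V : normedModType R) (f : V -> R) v :
  test_function f -> test_function ('D_v f).
Proof.
move=> [sf cf]; split.
  by move=> k; have [_ /(_ v)[]] := sf k.+1.
by apply: subclosed_compact cf (@derive_tsupport _ _ _); exact: closed_closure.
Qed.

Definition cube n (M : R) : set 'rV[R]_n := [set x | forall i, - M <= x ord0 i <= M].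

Lemma compact_cube n (M : R) : compact (@cube n M).
Proof.
have -> : cube M = [set v : 'rV[R]_n | forall i, `[- M, M]%classic (v ord0 i)].
  by apply/seteqP; split=> x /= + i => /(_ i); rewrite in_itv.
by apply: (@rV_compact _ n (fun=> `[- M, M]%classic)) => i; exact: segment_compact.
Qed.

Lemma closed_cube n (M : R) : closed (@cube n M).
Proof.
rewrite (_ : cube M =
  \bigcap_(i in [set: 'I_n]) ((fun x : 'rV[R]_n => x ord0 i) @^-1` `[- M, M]%classic)).
  apply: closed_bigI => i _; apply: closed_comp; last exact: interval_closed.
  by move=> x _; exact: coord_continuous.
apply/seteqP; split=> x /= Mx i; first by move=> _; rewrite /= in_itv/=; exact: Mx.
by have := Mx i I; rewrite /= in_itv.
Qed.

(** The truncation is by a cube rather than a ball, so that smoothness reduces to functions of one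
    coordinate. *)
Definition wave_bump n (i0 : 'I_n) (M : R) (x : 'rV[R]_n) : R :=
  expR (x ord0 i0) * \prod_(i < n) cutoff (- M) M 1 (x ord0 i).

Section wave_bump.
Context (n : nat) (i0 : 'I_n) (M : R).
Local Notation psi := (wave_bump i0 M).

Lemma Ck_coord k (i : 'I_n) (g : R -> R) : Ck k g ->
  Ck k (fun x : 'rV[R]_n => g (x ord0 i)).
Proof.
apply: (@Ck_comp_affine _ _ _ k (fun x : 'rV[R]_n => x ord0 i)
  (fun x : 'rV[R]_n => x ord0 i)).
- by move=> h v x; rewrite !mxE.
- exact: coord_continuous.
Qed.

Lemma smooth_wave_bump : smooth psi.
Proof.
move=> k; apply: CkM.
  have := Ck_coord i0 (@Ck_expR R k 1).
  by congr Ck; apply/funext => x; rewrite mul1r.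
by apply: Ck_prod => i; apply: Ck_coord; exact: Ck_cutoff.
Qed.

Lemma wave_bump_ge0 x : 0 <= psi x.
Proof. by rewrite mulr_ge0 ?expR_ge0 ?prodr_ge0// => i _; exact: cutoff_ge0. Qed.

Lemma wave_bump_cube x : cube M x -> psi x = expR (x ord0 i0).
Proof.
by move=> Mx; rewrite /wave_bump big1 ?mulr1// => i _; rewrite cutoff1.
Qed.

Lemma wave_bump_support x : psi x != 0 -> cube (M + 1) x.
Proof.
rewrite mulf_eq0 negb_or => /andP[_ /prodf_neq0 px] i.
by have := cutoff_neq0 ltr01 (px i isT); rewrite opprD.
Qed.

Lemma test_function_wave_bump : test_function psi.
Proof.
split; first exact: smooth_wave_bump.
have cM := @compact_cube n (M + 1).
apply: subclosed_compact cM _; first exact: closed_closure.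
have /closure_id -> : closed (@cube n (M + 1)).
  exact: closed_cube.
by apply: closureS => x; exact: wave_bump_support.
Qed.

Lemma near_cube_interior (x : 'rV[R]_n) : (forall j, - M < x ord0 j < M) ->
  \forall y \near x, forall j : 'I_n, - M < (y : 'rV[R]_n) ord0 j < M.
Proof.
move=> Mx.
apply: (@filter_forall _ _ (fun j (y : 'rV[R]_n) => - M < y ord0 j < M) (nbhs x) _) => j.
have oM : open ((fun y : 'rV[R]_n => y ord0 j) @^-1` `]- M, M[%classic).
  apply: open_comp; last exact: interval_open.
  by move=> y _; exact: coord_continuous.
have xM : ((fun y : 'rV[R]_n => y ord0 j) @^-1` `]- M, M[%classic) x.
  by rewrite /= in_itv/=; exact: Mx.
by apply: filterS (open_nbhs_nbhs (conj oM xM)) => y; rewrite /= in_itv.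
Qed.

Lemma derive_wave_bump i (x : 'rV[R]_n) : (forall j, - M < x ord0 j < M) ->
  'D_(basis_vector i) psi x = (i == i0)%:R * expR (x ord0 i0).
Proof.
move=> Mx; have Mnear := near_cube_interior Mx.
rewrite (@near_eq_derive _ _ _ _ (fun y : 'rV[R]_n => expR (y ord0 i0))); last first.
  near=> y; apply: wave_bump_cube => j.
  have : forall i, - M < y ord0 i < M by near: y.
  by move=> /(_ j)/andP[/ltW -> /ltW ->].
rewrite /derive.
rewrite (_ : (fun h => _) = (fun h => h^-1 *:
    ((expR \o shift (x ord0 i0)) (h *: ((i == i0)%:R : R)) - expR (x ord0 i0)))).
  have [_ E] := derive_real (i == i0)%:R (is_derive_expR (x ord0 i0)).
  exact: E.
by apply/funext => h /=; rewrite !mxE eqxx/= eq_sym.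
Unshelve. all: by end_near. Qed.

(** Summed over i, this says that the Laplacian of the truncated wave is the wave itself inside the
    open cube. *)
Lemma derive2_wave_bump i (x : 'rV[R]_n) : (forall j, - M < x ord0 j < M) ->
  'D_(basis_vector i) ('D_(basis_vector i) psi) x = (i == i0)%:R * expR (x ord0 i0).
Proof.
move=> Mx; have Mnear := near_cube_interior Mx.
rewrite (@near_eq_derive _ _ _ _ (fun y => (i == i0)%:R * psi y)); last first.
  near=> y; have My : forall i, - M < y ord0 i < M by near: y.
  rewrite derive_wave_bump// wave_bump_cube// => j.
  by have /andP[/ltW -> /ltW ->] := My j.
have [_ /(_ (basis_vector i))[dpsi _]] := smooth_wave_bump 1.
have [_ E] := @is_deriveZ _ _ _ psi (i == i0)%:R x (basis_vector i) _ (derivableP (dpsi x)).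
rewrite -[LHS]/('D_(basis_vector i) ((i == i0)%:R \*: psi) x) E derive_wave_bump//.
by rewrite /GRing.scale/= mulrA -natrM mulnb andbb.
Unshelve. all: by end_near. Qed.

End wave_bump.

Section spacetime.
Context (n : nat) (th : R -> R) (psi : 'rV[R]_n -> R).
Hypotheses (sth : smooth th) (tpsi : test_function psi).
Let phi (z : R * 'rV[R]_n) : R := th z.1 * psi z.2.

Lemma spacetime_test_function_prod (T : \bar R) (a b : R) : (b%:E < T)%E ->
  (forall s, th s != 0 -> a <= s <= b) -> spacetime_test_function T phi.
Proof.
move=> bT thab.
have sub : tsupport phi `<=` `[a, b]%classic `*` tsupport psi.
  have cl : closed (`[a, b]%classic `*` tsupport psi).
    apply: (@closedI _ (fst @^-1` `[a, b]%classic) (snd @^-1` tsupport psi)).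
      apply: closed_comp; last exact: interval_closed.
      by move=> z _; exact: cvg_fst.
    apply: closed_comp; last exact: closed_closure.
    by move=> z _; exact: cvg_snd.
  have /closure_id -> := cl; apply: closureS => -[s x].
  rewrite /phi/= mulf_eq0 negb_or => /andP[sth0 px]; split => /=.
    by rewrite in_itv/=; exact: thab.
  exact: subset_closure.
split; last first.
  move=> z /sub[/= + _]; rewrite in_itv/= => /andP[_ zb].
  by apply: le_lt_trans bT; rewrite lee_fin.
split.
  move=> k; apply: CkM.
    apply: (@Ck_comp_affine _ _ _ k (fun z : R * 'rV[R]_n => z.1)
      (fun z : R * 'rV[R]_n => z.1)) => //.
    by move=> z; exact: cvg_fst.
  apply: (@Ck_comp_affine _ _ _ k (fun z : R * 'rV[R]_n => z.2)
    (fun z : R * 'rV[R]_n => z.2)) => //; last exact: (tpsi.1 k).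
  by move=> z; exact: cvg_snd.
apply: subclosed_compact sub; first exact: closed_closure.
by apply: compact_setX; [exact: segment_compact|exact: tpsi.2].
Qed.

Lemma d_t_prod (s : R) x : d_t phi (s, x) = 'D_1 th s * psi x.
Proof.
have [_ /(_ 1)[dth _]] := sth 1.
have [_ E] := @is_deriveZ _ _ _ th (psi x) s 1 _ (derivableP (dth s)).
rewrite mulrC -[RHS]E /d_t /derive.
rewrite (_ : (fun h : R => h^-1 *: ((phi \o shift (s, x)) (h *: (1, 0)) - phi (s, x))) =
  fun h : R => h^-1 *: (((psi x \*: th) \o shift s) (h *: 1) - (psi x \*: th) s))//.
by apply/funext => h /=; rewrite /phi/= scaler0 add0r /GRing.scale/=; ring.
Qed.

Lemma d_x_prod (s : R) x i : d_x i phi (s, x) = th s * 'D_(basis_vector i) psi x.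
Proof.
have [_ /(_ (basis_vector i))[dpsi _]] := tpsi.1 1.
have [_ E] := @is_deriveZ _ _ _ psi (th s) x (basis_vector i) _ (derivableP (dpsi x)).
rewrite -[RHS]E /d_x /derive.
rewrite (_ : (fun h : R => h^-1 *: ((phi \o shift (s, x)) (h *: (0, basis_vector i)) -
    phi (s, x))) = fun h : R => h^-1 *: (((th s \*: psi) \o shift x)
    (h *: basis_vector i) - (th s \*: psi) x))//.
by apply/funext => h /=; rewrite /phi/= scaler0 add0r.
Qed.

End spacetime.

Section decaying_cutoff.
Context (t d : R).
Hypothesis d0 : 0 < d.

(** The plateau [-1, t + d] is a neighbourhood of [0, t], so that the two-sided derivative is that
    of e^(-s) even at 0 and t. With the ramp the support reaches t + 2 d, which has to stay below
    the lifespan. *)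
Definition decay_cutoff (s : R) : R := expR (- 1 * s) * cutoff (- 1) (t + d) d s.

Lemma smooth_decay_cutoff : smooth decay_cutoff.
Proof. by move=> k; apply: CkM; [exact: Ck_expR|exact: Ck_cutoff]. Qed.

Lemma decay_cutoffE s : 0 <= s <= t -> decay_cutoff s = expR (- s).
Proof.
move=> /andP[s0 st]; rewrite /decay_cutoff cutoff1 ?mulr1 ?mulN1r//.
by have := d0; lra.
Qed.

Lemma decay_cutoff_support s : decay_cutoff s != 0 -> - 1 - d <= s <= t + d + d.
Proof. by rewrite mulf_eq0 negb_or => /andP[_]; exact: cutoff_neq0. Qed.

Lemma derive_decay_cutoff (s : R) : 0 <= s <= t -> 'D_1 decay_cutoff s = - expR (- s).
Proof.
move=> /andP[s0 st].
rewrite (@near_eq_derive _ _ _ _ (fun s : R => expR (- 1 * s))).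
  by have [_ ->] := der_expR_lin s (- 1); rewrite !mulN1r.
near=> r; rewrite /decay_cutoff cutoff1 ?mulr1//; apply/andP; split.
  by apply: ltW; near: r; apply: lt_nbhsr; lra.
by apply: ltW; near: r; apply: lt_nbhsl; have := d0; lra.
Unshelve. all: by end_near. Qed.

End decaying_cutoff.

End test_function_lemmas.

(** * Borel sets and square integrable functions *)

Section rV_borel.
Context {R : realType} (n : nat).
Local Notation E := 'rV[R]_n.

(** These boxes form a countable base of the topology. They connect it with the sigma-algebra, which
    is generated by the coordinates and not by the open sets. *)
Definition rat_box (c : 'I_n -> rat) (k : nat) : set E :=
  [set x | forall i, `|x ord0 i - ratr (c i)| < k.+1%:R^-1].

Lemma measurable_rat_box c k : measurable (rat_box c k).
Proof.
rewrite (_ : rat_box c k = \bigcap_(i in [set: 'I_n]) ((fun x : E => rV_coord i x) @^-1`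
    `](ratr (c i) - k.+1%:R^-1), (ratr (c i) + k.+1%:R^-1)[%classic)).
  apply: fin_bigcap_measurable => [|i _]; first exact: finite_finset.
  by rewrite -[X in measurable X]setTI; apply: measurable_rV_coord => //.
apply/seteqP; split=> x /= xk i; have := xk i; rewrite /rV_coord /= in_itv/= ltr_distl//.
by apply.
Qed.

Lemma rat_box_basis (U : set E) x : open U -> U x ->
  exists c k, rat_box c k x /\ rat_box c k `<=` U.
Proof.
move=> oU Ux; have := open_nbhs_nbhs (conj oU Ux) => /nbhs_ballP[e /= e0 xe].
(* The factor 2 arises because two points of one box are compared through its centre. *)
have [k ke] : exists k : nat, 2 * k.+1%:R^-1 < e.
  have [k _ /(_ k (leqnn k)) ke] := near_infty_natSinv_lt (PosNum (divr_gt0 e0 (ltr0n R 2))).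
  by exists k; move: ke; rewrite /= ltr_pdivlMr// mulrC.
have k0 : 0 < k.+1%:R^-1 :> R by rewrite invr_gt0.
have /choice[c Hc] : forall i : 'I_n, exists q : rat, `|x ord0 i - ratr q| < k.+1%:R^-1.
  move=> i; have [|q] := @rat_in_itvoo R (x ord0 i - k.+1%:R^-1) (x ord0 i + k.+1%:R^-1).
    by rewrite ltrD2l gtrN.
  by rewrite in_itv/= => qi; exists q; rewrite distrC ltr_distl.
exists c, k; split=> // y Hy; apply: xe; split=> // i j; rewrite (ord1 i).
suff : `|x ord0 j - y ord0 j| < e by [].
have := Hc j; have := Hy j; move: ke k0; move: (k.+1%:R^-1) => d ke k0.
rewrite !ltr_distl => /andP[? ?] /andP[? ?].
by apply/andP; split; lra.
Qed.

Definition rat_box_enum (m : nat) : set E :=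
  if unpickle m is Some (c, k) then rat_box (fun i => (c : {ffun 'I_n -> rat}) i) k
  else set0.

Lemma rat_box_enum_basis (U : set E) : open U ->
  U = \bigcup_(m in [set m | rat_box_enum m `<=` U]) rat_box_enum m.
Proof.
move=> oU; apply/seteqP; split=> [x Ux|x [m /=]]; last exact.
have [c [k [xk kU]]] := rat_box_basis oU Ux.
have E : rat_box_enum (pickle ([ffun i => c i], k)) = rat_box c k.
  by rewrite /rat_box_enum pickleK; congr rat_box; apply/funext => i; rewrite ffunE.
by exists (pickle ([ffun i => c i], k)); rewrite /= E.
Qed.

Lemma measurable_rat_box_enum m : measurable (rat_box_enum m).
Proof.
by rewrite /rat_box_enum; case: (unpickle m) => [[c k]|//]; exact: measurable_rat_box.
Qed.

Lemma open_measurable_rV (U : set E) : open U -> measurable U.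
Proof.
move=> /rat_box_enum_basis ->; apply: bigcup_measurable => m _.
exact: measurable_rat_box_enum.
Qed.

Lemma continuous_measurable_rV (f : E -> R) : continuous f ->
  measurable_fun [set: E] (f : E -> measurableTypeR R).
Proof.
move=> /continuousP cf; apply: (measurability _ (measurable_realfun.RGenOpens.measurableE R)).
move=> _ [_ [a [b ->] <-]]; rewrite setTI; apply: open_measurable_rV.
exact/cf/interval_open.
Qed.

(** The complement of the essential support is an arbitrary union of open sets; by the countable
    base it is a countable union of boxes on each of which f vanishes almost everywhere. *)
Lemma ess_support_ae (f : E -> R) (A : set E) : ess_support f `<=` A ->
  {ae lebesgue_rV R n, forall x, ~ A x -> f x = 0}.
Proof.
move=> fA.
pose P := [set m | {ae lebesgue_rV R n, forall x, rat_box_enum m x -> f x = 0}].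
have : (lebesgue_rV R n).-negligible
    (\bigcup_m (if `[< P m >] then rat_box_enum m `&` [set x | f x <> 0] else set0)).
  apply: negligible_bigcup => m; case: asboolP => [|_]; last exact: negligible_set0.
  by apply: negligibleS => x [/= mx fx] /(_ mx).
apply: negligibleS => x /= /not_implyP[nAx fx].
have [U [oU Uf] Ux] : (\bigcup_(U in [set U | open U /\
    {ae lebesgue_rV R n, forall x, U x -> f x = 0}]) U) x.
  by apply: contrapT => nx; apply: nAx; apply: fA.
have := rat_box_enum_basis oU => UE; rewrite UE in Ux.
case: Ux => m /= mU mx; exists m => //; rewrite ifT//; apply/asboolP.
by apply: filterS Uf => y + my; apply; exact: mU.
Qed.

End rV_borel.

Section L2_pairing.
Context {R : realType} {n : nat}.
Local Notation E := 'rV[R]_n.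
Local Notation mu := (lebesgue_rV R n).
Implicit Types f g : E -> R.

Lemma L2_measurable f : L2 f -> measurable_fun [set: E] (f : E -> measurableTypeR R).
Proof. by rewrite /L2 inE => /andP[/[!inE]]. Qed.

Lemma L2_lty f : L2 f -> ('N[mu]_2%:E[EFin \o f] < +oo)%E.
Proof. by rewrite /L2 inE => /andP[_ /[!inE]]. Qed.

Lemma L2_normE f : L2 f -> (L2norm f)%:E = ('N[mu]_2%:E[EFin \o f])%E.
Proof.
by move=> /L2_lty f2; rewrite /L2norm fineK// ge0_fin_numE// Lnorm_ge0.
Qed.

Lemma L2norm_ge0 f : 0 <= L2norm f.
Proof. by rewrite /L2norm fine_ge0// Lnorm_ge0. Qed.

Lemma L2_mul_integrable f g : L2 f -> L2 g ->
  mu.-integrable setT (EFin \o (fun x => f x * g x)).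
Proof. by move=> f2 g2; apply/Lfun1_integrable; exact: Lfun2_mul_Lfun1. Qed.

Lemma L2_cauchy_schwarz f g : L2 f -> L2 g ->
  `|\int[mu]_x (f x * g x)| <= L2norm f * L2norm g.
Proof.
move=> f2 g2.
apply: le_trans (le_normr_Rintegral measurableT (L2_mul_integrable f2 g2)) _.
have : ('N[mu]_1[EFin \o (f \* g)%R] <= (L2norm f * L2norm g)%:E)%E.
  rewrite EFinM !L2_normE//; apply: hoelder => //; try exact: L2_measurable.
  by rewrite [RHS]splitr !div1r.
rewrite Lnorm1 /Rintegral -lee_fin => le1; apply: le_trans le1.
rewrite fineK//; apply: integrable_fin_num => //=.
by have := integrable_norm (L2_mul_integrable f2 g2).
Qed.

Lemma L2D f g : L2 f -> L2 g -> L2 (fun x => f x + g x).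
Proof. by have [_ H] := @Lfun_addr_closed _ _ _ mu 2%:E (lee1n 2); exact: H. Qed.

End L2_pairing.

Section L2_test.
Context {R : realType} {n : nat}.
Local Notation E := 'rV[R]_n.
Local Notation mu := (lebesgue_rV R n).
Implicit Types f g psi : E -> R.

Lemma L2Z (a : R) f : L2 f -> L2 (fun x => a * f x).
Proof.
move=> f2; have := @Lfun_scale _ _ _ mu f a 2 (ler1n _ 2) f2.
by rewrite /L2 (_ : (fun x => _) = a \o* f)//; apply/funext => x /=; rewrite mulrC.
Qed.

Lemma L2B f g : L2 f -> L2 g -> L2 (fun x => f x - g x).
Proof.
move=> f2 g2; have := L2D f2 (L2Z (- 1) g2).
by rewrite (_ : (fun x => _) = fun x => f x - g x)//; apply/funext => x; rewrite mulN1r.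
Qed.

Lemma measurable_cube M : measurable (@cube R n M).
Proof.
rewrite -[X in measurable X]setCK; apply: measurableC; apply: open_measurable_rV.
by apply: closed_openC; exact: closed_cube.
Qed.

Lemma cube_lty M : (mu (@cube R n M) < +oo)%E.
Proof.
rewrite -ge0_fin_numE//.
rewrite (_ : cube M = [set x | forall i : 'I_n, `[- M, M]%classic (x ord0 i)]).
  rewrite (@lebesgue_rV_box R n (fun=> `[- M, M]%classic)) => [|i]; last exact: measurable_itv.
  elim/big_ind : _ => [//|x y x0 y0|i _]; first exact: fin_numM.
  by rewrite lebesgue_measure_itv/=; case: ifP => _.
by apply/seteqP; split=> x /= + i => /(_ i); rewrite in_itv.
Qed.

Lemma L2_bounded_support f (B M : R) :
  measurable_fun [set: E] (f : E -> measurableTypeR R) ->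
  (forall x, `|f x| <= B) -> (forall x, f x != 0 -> cube M x) -> L2 f.
Proof.
move=> mf fB fM; rewrite /L2 inE; apply/andP; split; first by rewrite inE.
rewrite inE/= /finite_norm unlock poweR_lty//.
have B0 : 0 <= B by apply: le_trans (fB 0).
apply: (@le_lt_trans _ _ (\int[mu]_x ((B ^+ 2)%:E * (\1_(cube M) x)%:E))%E).
  apply: ge0_le_integral => //=.
  - apply/measurable_EFinP; apply: (measurableT_comp (measurable_powR 2)).
    exact: measurableT_comp.
  - apply: measurable_funeM; apply/measurable_EFinP.
    exact: measurable_indic (measurable_cube M).
  - move=> x _; rewrite -EFinM lee_fin powR_mulrn//.
    have [fx|fx] := eqVneq (f x) 0.
      by rewrite fx normr0 expr0n/= mulr_ge0 ?exprn_ge0.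
    by rewrite indicE mem_set ?mulr1 ?lerXn2r ?nnegrE//; exact: fM.
rewrite ge0_integralZl//=.
- rewrite integral_indic//; last exact: measurable_cube.
  by rewrite setIT lte_mul_pinfty ?lee_fin ?exprn_ge0// cube_lty.
- by apply/measurable_EFinP; exact: measurable_indic (measurable_cube M).
- by rewrite lee_fin exprn_ge0.
Qed.

Lemma test_function_bounded (psi : E -> R) : test_function psi ->
  exists2 B : R, 0 <= B & forall x, `|psi x| <= B.
Proof.
move=> [spsi cpsi]; have cont := Ck_continuous (spsi 0%N).
have [B [_ HB]] := compact_bounded (continuous_compact (continuous_subspaceT cont) cpsi).
exists (`|B| + 1) => // x; have [->|px] := eqVneq (psi x) 0; first by rewrite normr0.
apply: (HB (`|B| + 1)); first by rewrite (le_lt_trans (ler_norm B))// ltrDl.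
by exists x => //; exact: subset_closure.
Qed.

Lemma test_function_L2 psi : test_function psi -> L2 psi.
Proof.
move=> tpsi; have [B _ HB] := test_function_bounded tpsi.
have [spsi cpsi] := tpsi.
have [M [_ HM]] := compact_bounded cpsi.
apply: (@L2_bounded_support _ B (`|M| + 1)).
- exact: (continuous_measurable_rV (Ck_continuous (spsi 0%N))).
- exact: HB.
- move=> x px i.
  have sx : tsupport psi x by exact: subset_closure.
  have := HM (`|M| + 1) _ x sx.
  rewrite (le_lt_trans (ler_norm M)) ?ltrDl// => /(_ isT).
  move=> xM; rewrite -ler_norml; apply: le_trans xM.
  by rewrite [leRHS]/Num.Def.normr/= mx_normrE; apply/bigmax_geP; right => /=; exists (ord0, i).
Qed.

End L2_test.

(** * Pairings of Sobolev-valued curves with a fixed function *)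

Section sobolev_lemmas.
Context {R : realType} {n : nat}.
Local Notation E := 'rV[R]_n.
Local Notation mu := (lebesgue_rV R n).
Implicit Types f g psi : E -> R.

Lemma sobolev_L2 k f : sobolev k f -> L2 f.
Proof. by case: k => [|k] []. Qed.

Lemma sobolev_norm_ge k f : L2norm f <= sobolev_norm k f.
Proof.
case: k => [//|k] /=; rewrite -[X in X <= _](ger0_norm (L2norm_ge0 f)) -sqrtr_sqr.
by rewrite ler_wsqrtr// lerDl sumr_ge0// => i _; exact: sqr_ge0.
Qed.

(** Membership in the Sobolev space provides a witness, so [xget] does not return its default value
    0. *)
Lemma weak_derivativeP k i f : sobolev k.+1 f ->
  L2 (weak_derivative i f) /\ is_weak_derivative i f (weak_derivative i f).
Proof.
move=> [_ /(_ i)[g [fg /sobolev_L2 g2]]].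
by apply: (@xgetPex _ (fun=> 0) [set g | L2 g /\ is_weak_derivative i f g]); exists g.
Qed.

(** A pairing is continuous for every H^k norm, so continuity and differentiability of a curve in
    H^k pass to its scalar pairings. *)
Lemma L2_pairing_le k f psi : L2 f -> L2 psi ->
  `|\int[mu]_x (f x * psi x)| <= sobolev_norm k f * L2norm psi.
Proof.
move=> f2 p2; apply: le_trans (L2_cauchy_schwarz f2 p2) _.
by rewrite ler_wpM2r ?L2norm_ge0 ?sobolev_norm_ge.
Qed.

Lemma L2_pairingB f g psi : L2 f -> L2 g -> L2 psi ->
  \int[mu]_x ((f x - g x) * psi x) = \int[mu]_x (f x * psi x) - \int[mu]_x (g x * psi x).
Proof.
move=> f2 g2 p2; rewrite -RintegralB//; try exact: L2_mul_integrable.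
by apply: eq_Rintegral => x _; rewrite mulrBl.
Qed.

Lemma L2_pairingZ (a : R) f psi : L2 f -> L2 psi ->
  \int[mu]_x (a * f x * psi x) = a * \int[mu]_x (f x * psi x).
Proof.
move=> f2 p2; rewrite -RintegralZl//; last exact: L2_mul_integrable.
by apply: eq_Rintegral => x _; rewrite mulrA.
Qed.

Lemma ae_eq_Rintegral f g :
  measurable_fun [set: E] (f : E -> measurableTypeR R) ->
  measurable_fun [set: E] (g : E -> measurableTypeR R) ->
  {ae mu, forall x, f x = g x} -> \int[mu]_x f x = \int[mu]_x g x.
Proof.
move=> mf mg fg; congr fine; apply: ae_eq_integral => //; try exact/measurable_EFinP.
by apply: filterS fg => x /= -> _.
Qed.

Variables (T : \bar R) (psi : E -> R).
Hypothesis p2 : L2 psi.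

Lemma sobolev_continuous_pairing k (u : R -> E -> R) : sobolev_continuous k T u ->
  forall t, time_interval T t ->
    \int[mu]_x (u s x * psi x) @[s --> within (time_interval T) (nbhs t)]
      --> \int[mu]_x (u t x * psi x).
Proof.
move=> [su cu] t tT; apply/cvgrPdist_lt => e e0.
have N0 : 0 < L2norm psi + 1 by rewrite ltr_wpDl ?L2norm_ge0.
have /cvgrPdist_lt/(_ (e / (L2norm psi + 1))) := cu t tT.
rewrite divr_gt0// => /(_ isT) H.
near=> s; have sT : time_interval T s by near: s; exact: withinT.
have us2 := sobolev_L2 (su _ sT); have ut2 := sobolev_L2 (su _ tT).
rewrite distrC -L2_pairingB//.
apply: le_lt_trans (L2_pairing_le k (L2B us2 ut2) p2) _.
have : sobolev_norm k (u s \- u t) < e / (L2norm psi + 1).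
  have : `|0 - sobolev_norm k (u s \- u t)| < e / (L2norm psi + 1) by near: s.
  by rewrite sub0r normrN; apply: le_lt_trans; exact: ler_norm.
rewrite ltr_pdivlMr// => H1; apply: le_lt_trans H1.
rewrite ler_wpM2l ?lerDl//.
exact: le_trans (L2norm_ge0 _) (sobolev_norm_ge k _).
Unshelve. all: by end_near. Qed.

Lemma sobolev_derivative_pairing k (u v : R -> E -> R) : 
  (forall t, time_interval T t -> L2 (u t)) ->
  (forall t, time_interval T t -> L2 (v t)) ->
  sobolev_derivative k T u v ->
  forall t : R, 0 < t -> (t%:E < T)%E ->
    is_derive t 1 (fun s => \int[mu]_x (u s x * psi x)) (\int[mu]_x (v t x * psi x)).
Proof.
move=> u2 v2 duv t t0 tT.
have tiT : time_interval T t by split=> //; exact: ltW.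
pose a s := \int[mu]_x (u s x * psi x).
suff : h^-1 *: (a (h *: 1 + t) - a t) @[h --> 0^'] --> \int[mu]_x (v t x * psi x).
  move=> H; apply: DeriveDef; first by apply/cvg_ex; eexists; exact: H.
  exact: cvg_lim H.
have N0 : 0 < L2norm psi + 1 by rewrite ltr_wpDl ?L2norm_ge0.
(* The derivative of the curve is taken within [0, T); at an interior time small increments of both
   signs stay there, whence a two-sided derivative. The real number T' handles an infinite T. *)
have Dnear : \forall h \near 0^', time_interval T (t + h).
  have [T' [tT' T'T]] : exists T' : R, t < T' /\ (T'%:E <= T)%E.
    case: T tT => [r| |]//= tr; first by exists r; rewrite lexx -lte_fin.
    by exists (t + 1); rewrite ltrDl ltr01 leey.
  have tT0 : 0 < T' - t by rewrite subr_gt0.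
  near=> h.
  have h1 : `|h| < t by near: h; exact: dnbhs0_lt.
  have h2 : `|h| < T' - t by near: h; exact: dnbhs0_lt.
  move: h1 h2; rewrite !ltr_norml => /andP[h1 _] /andP[_ h2]; split; first by lra.
  by apply: lt_le_trans T'T; rewrite lte_fin; lra.
apply/cvgrPdist_lt => e e0.
have /cvgrPdist_lt/(_ (e / (L2norm psi + 1))) := duv t tiT.
rewrite divr_gt0// => /(_ isT) H.
have {}H : \forall h \near 0^', `|0 - sobolev_norm k
   (fun x => (u (t + h) x - u t x) / h - v t x)| < e / (L2norm psi + 1).
  have H' : \forall h \near 0^', time_interval T (t + h) -> `|0 - sobolev_norm k
   (fun x => (u (t + h) x - u t x) / h - v t x)| < e / (L2norm psi + 1) by exact: H.
  near=> h; have hT : time_interval T (t + h) by near: h.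
  by move: hT; near: h.
near=> h.
have hT : time_interval T (t + h) by near: h.
have d2 : L2 (fun x => h^-1 * (u (t + h) x - u t x)).
  by apply: L2Z; apply: L2B; exact: u2.
rewrite distrC /GRing.scale/= mulr1 [h + t]addrC.
have -> : h^-1 * (a (t + h) - a t) - \int[mu]_x (v t x * psi x) =
    \int[mu]_x (((u (t + h) x - u t x) / h - v t x) * psi x).
  have E1 := L2_pairingB (u2 _ hT) (u2 _ tiT) p2.
  have E2 := L2_pairingZ h^-1 (L2B (u2 _ hT) (u2 _ tiT)) p2.
  have E3 := L2_pairingB d2 (v2 _ tiT) p2.
  rewrite /a -E1 -E2 -E3; apply: eq_Rintegral => x _.
  by rewrite [(_ - _) / _]mulrC.
have w2 : L2 (fun x => (u (t + h) x - u t x) / h - v t x).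
  have := L2B d2 (v2 _ tiT).
  by congr L2; apply/funext => x; rewrite mulrC.
apply: le_lt_trans (L2_pairing_le k w2 p2) _.
have : `|0 - sobolev_norm k (fun x => (u (t + h) x - u t x) / h - v t x)|
    < e / (L2norm psi + 1) by near: h.
rewrite sub0r normrN => /(le_lt_trans (ler_norm _)).
rewrite ltr_pdivlMr// => H1; apply: le_lt_trans H1.
rewrite ler_wpM2l ?lerDl//.
exact: le_trans (L2norm_ge0 _) (sobolev_norm_ge k _).
Unshelve. all: by end_near. Qed.

End sobolev_lemmas.

(** * The integral of a plane wave over a ball *)

Section ball_integral.
Context {R : realType}.

Lemma measurable_euclidean_ball n (r : R) : measurable (euclidean_ball r : set 'rV[R]_n).
Proof.
have mf : measurable_fun [set: 'rV[R]_n]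
    ((fun x => Num.sqrt (\sum_i x ord0 i ^+ 2)) : 'rV[R]_n -> measurableTypeR R).
  apply: (@measurableT_comp _ _ _ _ _ _ (@Num.sqrt R)).
    by apply: continuous_measurable_fun; exact: sqrt_continuous.
  apply: measurable_sum => i; apply: measurable_funX.
  exact: measurable_rV_coord.
rewrite (_ : euclidean_ball r = [set: 'rV[R]_n] `&`
  ((fun x => Num.sqrt (\sum_i x ord0 i ^+ 2)) : 'rV[R]_n -> measurableTypeR R)
     @^-1` `]-oo, r]%classic).
  by apply: mf => //; exact: measurable_itv.
by rewrite setTI; apply/seteqP; split=> x /=; rewrite in_itv.
Qed.

Lemma euclidean_ball_coord n (r : R) (x : 'rV[R]_n) i : euclidean_ball r x ->
  `|x ord0 i| <= r.
Proof.
apply: le_trans; rewrite -sqrtr_sqr ler_wsqrtr// (bigD1 i)//= lerDl.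
by apply: sumr_ge0 => j _; exact: sqr_ge0.
Qed.

Lemma exprn_le_expR m (y : R) : 0 <= y -> y ^+ m <= m`!%:R * expR y.
Proof.
move=> y0; case: m => [|m].
  by rewrite expr0 fact0 mul1r; apply: le_trans (expR_ge1Dx y); rewrite lerDl.
have m0 : 0 < m.+1`!%:R :> R by rewrite ltr0n fact_gt0.
rewrite mulrC -ler_pdivrMr//; apply: le_trans (expR_ge1Dxn m y0).
by rewrite lerDr.
Qed.

(** Use sqrt y <= 1 + y/2 in the exponential. Half of the exponential decay away from the top of the
    ball thus absorbs the growth of the slices, and the other half remains integrable. *)
Lemma sqrt_exprn_le m (y : R) : 0 <= y ->
  Num.sqrt y ^+ m <= m`!%:R * expR 1 * expR (y / 2).
Proof.
move=> y0; apply: (le_trans (exprn_le_expR m (sqrtr_ge0 y))).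
rewrite -mulrA ler_wpM2l// -expRD ler_expR.
have := sqr_ge0 (Num.sqrt y - 1); rewrite sqrrB sqr_sqrtr// expr1n mulr1; lra.
Qed.

Lemma integral_expR_half (rho : R) : 0 < rho ->
  (\int[lebesgue_measure]_(t in `[(- rho)%R, rho]) (expR (2^-1 * t))%:E
    <= (2 * expR (2^-1 * rho))%:E)%E.
Proof.
move=> r0; pose F (x : R) := 2 * expR (2^-1 * x).
have dF (x : R) : is_derive x 1 F (expR (2^-1 * x)).
  by apply: (der_eq (derZ 2 (der_expR_lin x 2^-1))); rewrite mulrA mulfV ?mul1r.
rewrite (@continuous_FTC2 R _ F); [|lra| | |].
- by rewrite -EFinB lee_fin lerBlDr lerDl mulr_ge0// expR_ge0.
- by apply: continuous_subspaceT => x; exact: (der_continuous (der_expR_lin x 2^-1)).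
- split.
  + by move=> x _; have [] := dF x.
  + by apply: cvg_at_right_filter; exact: (der_continuous (dF (- rho))).
  + by apply: cvg_at_left_filter; exact: (der_continuous (dF rho)).
- by move=> x _; rewrite derive1E; have [] := dF x.
Qed.

(** A cube around the slice at height t of the ball of radius rho: the squared radius (rho - t) (rho
    + t) of the slice is at most 2 rho (rho - t). *)
Definition slab m (rho t : R) : set 'rV[R]_m :=
  [set y | forall j, `[- Num.sqrt (2 * rho * (rho - t)), Num.sqrt (2 * rho * (rho - t))]%classic
     (y ord0 j)].

Lemma euclidean_ball_slab m (rho : R) (x : 'rV[R]_m.+1) : 0 < rho ->
  euclidean_ball rho x ->
  `|x ord0 ord0| <= rho /\ slab rho (x ord0 ord0) (\row_j x ord0 (lift ord0 j)).
Proof.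
move=> r0 xr; have x0 := euclidean_ball_coord ord0 xr; split=> // j /=.
rewrite in_itv/= -ler_norml mxE -sqrtr_sqr ler_wsqrtr//.
have : x ord0 ord0 ^+ 2 + x ord0 (lift ord0 j) ^+ 2 <= rho ^+ 2.
  have s0 : 0 <= \sum_i x ord0 i ^+ 2 by apply: sumr_ge0 => i _; exact: sqr_ge0.
  rewrite -[X in _ <= X](ger0_norm (sqr_ge0 rho)).
  apply: (@le_trans _ _ (\sum_i x ord0 i ^+ 2)).
    rewrite big_ord_recl lerD2l (bigD1 j)//= lerDl.
    by apply: sumr_ge0 => i _; exact: sqr_ge0.
  rewrite ger0_norm ?sqr_ge0// -[X in X <= _](sqr_sqrtr s0) lerXn2r ?nnegrE//.
    exact: ltW.
move: x0; rewrite ler_norml => /andP[x1 x2] x3.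
have -> : 2 * rho * (rho - x ord0 ord0) =
    (rho ^+ 2 - x ord0 ord0 ^+ 2) + (rho - x ord0 ord0) ^+ 2 by ring.
by have := sqr_ge0 (rho - x ord0 ord0); lra.
Qed.

Lemma slab_measure m (rho t : R) : 0 < rho -> t <= rho ->
  (lebesgue_rV R m (slab rho t) =
   ((2 * Num.sqrt (2 * rho * (rho - t))) ^+ m)%:E)%E.
Proof.
move=> r0 tr; set a := Num.sqrt _.
rewrite (@lebesgue_rV_box R m (fun=> `[- a, a]%classic)); last first.
  by move=> i; exact: measurable_itv.
have a0 : 0 <= a by exact: sqrtr_ge0.
rewrite lebesgue_measure_itv/=.
have -> : (if ((- a)%:E < a%:E)%E then (a%:E - (- a)%:E)%E else 0%E) = (2 * a)%:E.
  rewrite lte_fin; case: ifPn => [_|]; first by rewrite -EFinB; congr EFin; ring.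
  by rewrite -leNgt => aa; congr EFin; lra.
elim: m => [|m IH]; first by rewrite big_ord0 expr0.
by rewrite big_ord_recl IH -EFinM exprS.
Qed.

Lemma integral_rV_cons m (G : 'rV[R]_m.+1 -> \bar R) :
  measurable_fun [set: 'rV[R]_m.+1] G -> (forall x, (0 <= G x)%E) ->
  (\int[lebesgue_rV R m.+1]_x G x =
   \int[lebesgue_measure]_t \int[lebesgue_rV R m]_y G (rV_cons (t, y)))%E.
Proof.
move=> mG G0.
rewrite -[LHS]/(\int[pushforward (@lebesgue_measure R \x lebesgue_rV R m)%E
  (@rV_cons R m)]_x G x)%E.
rewrite ge0_integral_pushforward//; last exact: measurable_rV_cons.
rewrite preimage_setT fubini_tonelli1//; last by move=> z; exact: G0.
by apply: measurableT_comp => //; exact: measurable_rV_cons.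
Qed.

(** The weight e^(x_1) concentrates the integral at bounded distance from the top of the ball, where
    slices have side of order sqrt rho. This gives rho^(m/2) and not the rho^m of a central
    slice. *)
Lemma ball_integral_bound m : exists2 C : R, 0 < C & forall rho : R, 0 < rho ->
  (\int[lebesgue_rV R m.+1]_(x in euclidean_ball rho) (expR (x ord0 ord0))%:E
    <= (C * Num.sqrt rho ^+ m * expR rho)%:E)%E.
Proof.
pose D : R := (2 * Num.sqrt 2) ^+ m * (m`!%:R * expR 1).
have D0 : 0 < D.
  by rewrite mulr_gt0 ?exprn_gt0 ?mulr_gt0 ?sqrtr_gt0 ?expR_gt0// ltr0n fact_gt0.
exists (2 * D); first by rewrite mulr_gt0.
move=> rho r0.
pose G (x : 'rV[R]_m.+1) : \bar R :=
  (expR (x ord0 ord0) * \1_(euclidean_ball rho : set 'rV[R]_m.+1) x)%:E.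
have mG : measurable_fun [set: 'rV[R]_m.+1] G.
  apply/measurable_EFinP; apply: measurable_funM.
    apply: (@measurableT_comp _ _ _ _ _ _ (@expR R)); first exact: measurable_expR.
    exact: measurable_rV_coord.
  by apply: measurable_indic; exact: measurable_euclidean_ball.
have G0 x : (0 <= G x)%E by rewrite lee_fin mulr_ge0 ?expR_ge0.
rewrite integral_mkcond (_ : _ \_ _ = G); last first.
  apply/funext => x; rewrite patchE /G indicE; case: ifP => _.
    by rewrite mulr1.
  by rewrite mulr0.
rewrite integral_rV_cons//.
(* After (rho - t)^(m/2) is absorbed, e^t e^((rho - t)/2) = e^(rho/2) e^(t/2) is left, and its
   integral in t is at most 2 e^rho. *)
pose H (t : R) : \bar R := (D * Num.sqrt rho ^+ m * expR (rho / 2) *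
  (expR (2^-1 * t) * \1_(`[- rho, rho]%classic) t))%:E.
have inner (t : R) : (\int[lebesgue_rV R m]_y G (rV_cons (t, y)) <= H t)%E.
  have consE y : G (rV_cons (t, y)) = (expR t *
      \1_(euclidean_ball rho : set 'rV[R]_m.+1) (rV_cons (t, y)))%:E.
    by rewrite /G mxE split1 unlift_none /= mxE mulr1n.
  have slabE y : euclidean_ball rho (rV_cons (t, y) : 'rV[R]_m.+1) ->
      `|t| <= rho /\ slab rho t y.
    move=> /(euclidean_ball_slab r0); rewrite mxE split1 unlift_none /= mxE mulr1n.
    move=> [tr ty]; split=> // j; have := ty j.
    by rewrite !mxE split1 liftK.
  have [tr|tr] := leP `|t| rho; last first.
    rewrite (eq_integral (fun=> 0%E)) ?integral0.
      by rewrite lee_fin !mulr_ge0 ?expR_ge0 ?exprn_ge0 ?sqrtr_ge0 ?(ltW D0).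
    move=> y _; rewrite consE indicE memNset ?mulr0// => /slabE[].
    by rewrite leNgt tr.
  have /andP[tr1 tr2] : - rho <= t <= rho by rewrite -ler_norml.
  have mslab : measurable (slab rho t : set 'rV[R]_m).
    rewrite (_ : slab rho t = \bigcap_(j in [set: 'I_m]) (@rV_coord R m j @^-1`
       `[- Num.sqrt (2 * rho * (rho - t)), Num.sqrt (2 * rho * (rho - t))]%classic)).
      apply: fin_bigcap_measurable => [|i _]; first exact: finite_finset.
      by rewrite -[X in measurable X]setTI; exact: measurable_rV_coord.
    by apply/seteqP; split=> y yt i; [move=> _|]; exact: yt.
  apply: (@le_trans _ _ (\int[lebesgue_rV R m]_y
      ((expR t)%:E * (\1_(slab rho t : set 'rV[R]_m) y)%:E))%E).
    apply: ge0_le_integral => //=.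
    - apply: (measurableT_comp mG); apply: (measurableT_comp (@measurable_rV_cons R m)).
      apply/measurable_fun_pairP; split; first exact: measurable_cst.
      exact: measurable_id.
    - apply: measurable_funeM; apply/measurable_EFinP; exact: measurable_indic.
    - move=> y _; rewrite consE -EFinM lee_fin ler_wpM2l ?expR_ge0// !indicE.
      have [/set_mem/slabE[_ ys]|] := boolP (_ \in _); last by rewrite ler0n.
      by rewrite (mem_set ys).
  rewrite ge0_integralZl//=; last by apply/measurable_EFinP; exact: measurable_indic.
  rewrite integral_indic// setIT.
  rewrite -[X in (_ * X <= _)%E]/(lebesgue_rV R m (slab rho t)) slab_measure//.
  rewrite -EFinM lee_fin.
  rewrite indicE mem_set ?mulr1; last by rewrite /= in_itv/= tr1.
  have -> : 2 * Num.sqrt (2 * rho * (rho - t)) =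
      2 * Num.sqrt 2 * Num.sqrt rho * Num.sqrt (rho - t).
    by rewrite sqrtrM ?mulr_ge0 ?(ltW r0)// sqrtrM// !mulrA.
  have rt : 0 <= rho - t by rewrite subr_ge0.
  have := sqrt_exprn_le m rt => Hs.
  rewrite /D.
  have E : expR (rho / 2) * expR (2^-1 * t) = expR t * expR ((rho - t) / 2).
    by rewrite -!expRD; congr expR; field.
  set a := (2 * Num.sqrt 2) ^+ m; set b := Num.sqrt rho ^+ m.
  have -> : (2 * Num.sqrt 2 * Num.sqrt rho * Num.sqrt (rho - t)) ^+ m =
     a * b * Num.sqrt (rho - t) ^+ m by rewrite [LHS]exprMn [X in X * _]exprMn.
  have ab0 : 0 <= a * b by rewrite mulr_ge0 ?exprn_ge0 ?mulr_ge0 ?sqrtr_ge0.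
  have := ler_wpM2l (mulr_ge0 (expR_ge0 t) ab0) Hs.
  have -> : a * (m`!%:R * expR 1) * b * expR (rho / 2) * expR (2^-1 * t) =
     expR t * (a * b) * (m`!%:R * expR 1 * expR ((rho - t) / 2)).
    by rewrite -[LHS]mulrA E; ring.
  by rewrite !mulrA.
apply: (@le_trans _ _ (\int[lebesgue_measure]_t H t)%E).
  apply: ge0_le_integral => //=.
  - by move=> t _; apply: integral_ge0.
  - have mGc : measurable_fun [set: measurableTypeR R * 'rV[R]_m] (fun z => G (rV_cons z)).
      by apply: (measurableT_comp mG); exact: measurable_rV_cons.
    exact: (measurable_fun_fubini_tonelli_F (m2 := lebesgue_rV R m) _ mGc (fun z => G0 _)).
  - apply/measurable_EFinP; apply: measurable_funM => //; apply: measurable_funM.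
      by apply: continuous_measurable_fun => t; exact: (der_continuous (der_expR_lin t 2^-1)).
    by apply: measurable_indic; exact: measurable_itv.
have K0 : 0 <= D * Num.sqrt rho ^+ m * expR (rho / 2).
  by rewrite !mulr_ge0 ?exprn_ge0 ?sqrtr_ge0 ?expR_ge0 ?(ltW D0).
have -> : (\int[lebesgue_measure]_t H t = (D * Num.sqrt rho ^+ m * expR (rho / 2))%:E *
    \int[lebesgue_measure]_(t in `[(- rho)%R, rho]) (expR (2^-1 * t))%:E)%E.
  rewrite [in RHS]integral_mkcond -ge0_integralZl//=.
  - apply: eq_integral => t _; rewrite /H patchE indicE EFinM.
    by case: (t \in _); rewrite ?mulr1 ?mulr0 ?mule0.
  - apply/(measurable_restrictT _ _).1; first exact: measurable_itv.
    apply/measurable_EFinP; apply: measurable_funTS.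
    by apply: continuous_measurable_fun => t; exact: (der_continuous (der_expR_lin t 2^-1)).
  - by move=> t _; rewrite patchE; case: ifP => _ //; rewrite lee_fin expR_ge0.
apply: (@le_trans _ _ ((D * Num.sqrt rho ^+ m * expR (rho / 2))%:E *
   (2 * expR (2^-1 * rho))%:E)%E).
  by rewrite lee_wpmul2l ?lee_fin// integral_expR_half.
rewrite -EFinM lee_fin.
have <- : expR (rho / 2) * expR (2^-1 * rho) = expR rho.
  by rewrite -expRD; congr expR; field.
by rewrite le_eqVlt; apply/orP; left; apply/eqP; ring.
Qed.

End ball_integral.

(** * The solution tested with a truncated plane wave *)

Section propagation.
Context {R : realType} {n : nat}.
Local Notation E := 'rV[R]_n.
Local Notation mu := (lebesgue_rV R n).
Implicit Types f g psi : E -> R.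

Lemma left_derivative_eq0 (a : R -> R) (t d : R) : 0 < t -> is_derive t 1 a d ->
  (forall s, 0 < s <= t -> a s = 0) -> d = 0.
Proof.
move=> t0 /is_derive1_caratheodory[g [ag cg <-]] a0; apply: contrapT => /eqP gt0.
have N0 : 0 < `|g t| by rewrite normr_gt0.
have /cvgrPdist_lt/(_ _ N0)/nbhs_ballP[e /= e0 He] : g s @[s --> t] --> g t by exact: cg.
(* A point to the left of t, closer to t than e, and still positive, so that a vanishes at it. *)
pose s := Num.max (t / 2) (t - e / 2).
have s0 : 0 < s by rewrite lt_max divr_gt0.
have st : s < t by rewrite gt_max; apply/andP; split; lra.
have : ball t e s.
  suff : `|t - s| < e by [].
  have : t - e / 2 <= s by rewrite le_max lexx orbT.
  by move=> es; rewrite ger0_norm; lra.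
move=> /He /=; have := ag s; rewrite !a0 ?t0 ?lexx ?s0 ?ltW// subr0.
move=> /esym/eqP; rewrite mulf_eq0 subr_eq0 (lt_eqF st) orbF => /eqP ->.
by rewrite subr0 ltxx.
Qed.

Lemma L2_le f g : measurable_fun [set: E] (f : E -> measurableTypeR R) ->
  (forall x, `|f x| <= `|g x|) -> L2 g -> L2 f.
Proof.
move=> mf fg g2; rewrite /L2 inE; apply/andP; split; first by rewrite inE.
rewrite inE/= /finite_norm unlock poweR_lty//.
have /integrableP[mg2 ig] := Lfun_integrable (ler1n R 2) g2.
apply: le_lt_trans ig; apply: ge0_le_integral => //=.
- apply/measurable_EFinP; apply: (measurableT_comp (measurable_powR 2)).
  exact: measurableT_comp.
- by apply/measurable_EFinP; apply: measurableT_comp => //; exact/measurable_EFinP.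
- move=> x _; rewrite lee_fin [X in _ <= X]ger0_norm ?powR_ge0//.
  by apply: ge0_ler_powR; rewrite ?nnegrE.
Qed.

Lemma L2_indic (A : set E) f : measurable A -> L2 f -> L2 (fun x => f x * \1_A x).
Proof.
move=> mA f2; apply: (L2_le _ _ f2).
  by apply: measurable_funM; [exact: (L2_measurable f2)|exact: measurable_indic].
move=> x; rewrite normrM indicE; case: (x \in A); first by rewrite normr1 mulr1.
by rewrite normr0 mulr0.
Qed.

Lemma L2_sq_eq0 f : L2 f -> \int[mu]_x (f x * f x) = 0 -> {ae mu, forall x, f x = 0}.
Proof.
move=> f2 f0; have fi := L2_mul_integrable f2 f2.
have I0 : (\int[mu]_x `|(f x * f x)%:E| = 0)%E.
  rewrite (eq_integral (fun x => (f x * f x)%:E)).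
    rewrite -[LHS]fineK; first by rewrite -[X in X%:E]/(\int[mu]_x (f x * f x)) f0.
    by apply: integrable_fin_num.
  by move=> x _; rewrite gee0_abs// lee_fin -expr2 sqr_ge0.
have /integrableP[mff _] := fi.
have /(ae_eq_integral_abs mu measurableT mff) := I0.
apply: filterS => x /(_ I) /= [] /eqP; rewrite mulf_eq0 orbb => /eqP //.
Qed.

Lemma euclidean_ballS (r s : R) : r <= s -> (euclidean_ball r : set E) `<=` euclidean_ball s.
Proof. by move=> rs x /= xr; exact: le_trans xr rs. Qed.

(* Testing [u s] with [v t * \1_A], for [A] the complement of the ball, gives 0 for all
   [s <= t], so the derivative at [t] of this pairing, which is the integral of [(v t)^2]
   over [A], vanishes. *)
Lemma velocity_support (T : \bar R) k (r : R) (u v : R -> E -> R) :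
  (forall t, time_interval T t -> L2 (u t)) ->
  (forall t, time_interval T t -> L2 (v t)) ->
  sobolev_derivative k T u v ->
  (forall t : R, 0 < t -> (t%:E < T)%E ->
    {ae mu, forall x, ~ euclidean_ball (t + r) x -> u t x = 0}) ->
  forall t : R, 0 < t -> (t%:E < T)%E ->
    {ae mu, forall x, ~ euclidean_ball (t + r) x -> v t x = 0}.
Proof.
move=> u2 v2 duv supp t t0 tT.
have tiT : time_interval T t by split=> //; exact: ltW.
pose A : set E := ~` euclidean_ball (t + r).
have mA : measurable A by apply: measurableC; exact: measurable_euclidean_ball.
pose psi x := v t x * \1_A x.
have p2 : L2 psi by apply: L2_indic => //; exact: v2.
have dpsi := sobolev_derivative_pairing p2 u2 v2 duv t0 tT.
have int0 : \int[mu]_x (v t x * psi x) = 0.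
  apply: (left_derivative_eq0 t0 dpsi) => s /andP[s0 st].
  have sT : (s%:E < T)%E by apply: le_lt_trans tT; rewrite lee_fin.
  have us2 : L2 (u s) by apply: u2; split=> //; exact: ltW.
  rewrite (@ae_eq_Rintegral _ _ _ (fun=> 0)) ?Rintegral_cst ?mul0r//.
    by apply: measurable_funM; [exact: (L2_measurable us2)|exact: (L2_measurable p2)].
  apply: filterS (supp s s0 sT) => x xs; rewrite /psi indicE.
  have [/set_mem xA|_] := boolP (x \in A); last by rewrite mulr0 mulr0.
  rewrite xs ?mul0r// => xB; apply: xA.
  by apply: euclidean_ballS xB; rewrite lerD2r.
have : \int[mu]_x (psi x * psi x) = 0.
  rewrite -int0; apply: eq_Rintegral => x _; rewrite /psi indicE.
  by case: (x \in A); rewrite ?mulr1// !mulr0.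
move=> /(L2_sq_eq0 p2); apply: filterS => x + xA.
by rewrite /psi indicE mem_set// mulr1.
Qed.

Lemma Rintegral_sum_ord (F : 'I_n -> E -> R) :
  (forall i, mu.-integrable setT (EFin \o F i)) ->
  \int[mu]_x (\sum_(i < n) F i x) = \sum_(i < n) (\int[mu]_x F i x) /\
  mu.-integrable setT (EFin \o (fun x => \sum_(i < n) F i x)).
Proof.
move=> iF; elim: (index_enum 'I_n) => [|i s [IH1 IH2]].
  split.
    rewrite big_nil (@eq_Rintegral _ _ _ mu setT (fun=> 0)) ?Rintegral_cst ?mul0r//.
    by move=> x _; rewrite big_nil.
  rewrite (_ : _ \o _ = cst 0%E); first exact: (integrable0 mu setT).
  by apply/funext => x /=; rewrite big_nil.
have E1 : (fun x => \sum_(j <- i :: s) F j x) = (fun x => F i x + \sum_(j <- s) F j x).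
  by apply/funext => x; rewrite big_cons.
rewrite E1; split; first by rewrite RintegralD// IH1 big_cons.
by have := integrableD measurableT (iF i) IH2.
Qed.

(** The weak derivative is moved onto the derivative of the bump, itself a test function. Where f
    lives the Laplacian of the bump is the bump; the ramps of the truncation lie outside the support
    of f. The strict rho < M puts the closed ball inside the open cube. *)
Lemma laplacian_pairing (i0 : 'I_n) (M rho : R) f : rho < M -> sobolev 1 f ->
  {ae mu, forall x, ~ euclidean_ball rho x -> f x = 0} ->
  \int[mu]_x (\sum_i weak_derivative i f x * 'D_(basis_vector i) (wave_bump i0 M) x) =
    - (\int[mu]_x (f x * wave_bump i0 M x)) /\
  mu.-integrable setT (EFin \o (fun x =>
    \sum_i weak_derivative i f x * 'D_(basis_vector i) (wave_bump i0 M) x)).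
Proof.
move=> rM sf f0; have f2 := sobolev_L2 sf.
set psi := wave_bump i0 M.
have tpsi : test_function psi by exact: test_function_wave_bump.
have tdpsi i : test_function ('D_(basis_vector i) psi) by exact: test_function_derive.
have wi i : mu.-integrable setT (EFin \o (fun x =>
    weak_derivative i f x * 'D_(basis_vector i) psi x)).
  have [w2 _] := weak_derivativeP i sf.
  by apply: L2_mul_integrable => //; exact: test_function_L2.
have [-> intg] := Rintegral_sum_ord wi; split=> //.
have term i : \int[mu]_x (weak_derivative i f x * 'D_(basis_vector i) psi x) =
    - ((i == i0)%:R * \int[mu]_x (f x * psi x)).
  have [_ /(_ _ (tdpsi i)) H] := weak_derivativeP i sf.
  rewrite -[LHS]opprK -H; congr (- _).
  rewrite -RintegralZl//; last by apply: L2_mul_integrable => //; exact: test_function_L2.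
  have L2d : L2 ('D_(basis_vector i) ('D_(basis_vector i) psi)).
    by apply: test_function_L2; exact: test_function_derive.
  have mpsi : measurable_fun [set: E] (psi : E -> measurableTypeR R).
    exact: (L2_measurable (test_function_L2 tpsi)).
  apply: ae_eq_Rintegral.
  - by apply: measurable_funM; [exact: (L2_measurable f2)|exact: (L2_measurable L2d)].
  - apply: measurable_funM => //; apply: measurable_funM => //.
    exact: (L2_measurable f2).
  apply: filterS f0 => x xf; have [xr|/xf ->] := pselect (euclidean_ball rho x); last first.
    by rewrite !mul0r mulr0.
  have xM j : - M < x ord0 j < M.
    by rewrite -ltr_norml; apply: le_lt_trans rM; exact: euclidean_ball_coord.
  rewrite derive2_wave_bump// /psi wave_bump_cube; first by ring.
  by move=> j; have /andP[/ltW -> /ltW ->] := xM j.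
rewrite (eq_bigr _ (fun i _ => term i)) sumrN (bigD1 i0)//= eqxx mul1r big1 ?addr0//.
by move=> i /negbTE ->; rewrite mul0r.
Qed.

End propagation.

(** * Freezing time outside a compact interval *)

Section clamp.
Context {R : realType}.

(** Composition with [clamp tau] extends a function continuous relative to [0, T) to one continuous
    on the whole line, as the comparison lemmas require, without changing it on [0, tau]. *)
Definition clamp (tau s : R) : R := Num.min tau (Num.max 0 s).

Lemma clamp_id (tau s : R) : 0 <= s <= tau -> clamp tau s = s.
Proof. by move=> /andP[s0 st]; rewrite /clamp max_r// min_r. Qed.

Lemma clamp_itv (tau s : R) : 0 <= tau -> 0 <= clamp tau s <= tau.
Proof. by move=> t0; rewrite /clamp le_min t0 le_max lexx ge_min lexx. Qed.

Lemma continuous_clamp (tau : R) : continuous (clamp tau).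
Proof.
move=> s; apply: (@continuous_min _ _ (fun=> tau) (fun s : R => Num.max 0 s)).
  exact: cvg_cst.
by apply: (@continuous_max _ _ (fun=> 0) id); [exact: cvg_cst|exact: cvg_id].
Qed.

Lemma time_interval_clamp (T : \bar R) (tau s : R) : 0 <= tau -> (tau%:E < T)%E ->
  time_interval T (clamp tau s).
Proof.
move=> t0 tT; have /andP[c0 ct] := clamp_itv s t0; split=> //.
by apply: le_lt_trans tT; rewrite lee_fin.
Qed.

Lemma continuous_comp_clamp (T : \bar R) (tau : R) (F : R -> R) :
  0 <= tau -> (tau%:E < T)%E ->
  (forall t, time_interval T t -> F s @[s --> within (time_interval T) (nbhs t)] --> F t) ->
  continuous (fun s => F (clamp tau s)).
Proof.
move=> t0 tT cF s U FU.
have /cF/(_ U FU) := time_interval_clamp s t0 tT.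
rewrite /within /= => H.
have H' : \forall y \near s, time_interval T (clamp tau y) -> U (F (clamp tau y)).
  exact: (@continuous_clamp tau s _ H).
suff : \forall y \near s, U (F (clamp tau y)) by [].
near=> y; have yT : time_interval T (clamp tau y) by exact: time_interval_clamp.
by move: yT; near: y.
Unshelve. all: by end_near. Qed.

Lemma der_comp_clamp (tau : R) (F : R -> R) (d s : R) : 0 < s < tau ->
  is_derive s 1 F d -> is_derive s 1 (fun s => F (clamp tau s)) d.
Proof.
move=> /andP[s0 st] Fd; apply: (near_eq_is_derive _ Fd).
near=> r; rewrite clamp_id//; apply/andP; split; apply: ltW.
  by near: r; exact: lt_nbhsr.
by near: r; exact: lt_nbhsl.
Unshelve. all: by end_near. Qed.

(** The integrand is the derivative of e^(-s) F. Hence both time integrals on the left of the tested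
    equation are boundary terms. *)
Lemma integral_expRN_der (F G : R -> R) (t : R) : 0 < t ->
  continuous F -> continuous G -> (forall s : R, 0 < s < t -> is_derive s 1 F (G s)) ->
  \int[lebesgue_measure]_(s in `[0, t]) (expR (- s) * (G s - F s)) =
    expR (- t) * F t - F 0.
Proof.
move=> t0 cF cG dF.
have cE : continuous (fun s : R => expR (- s)).
  move=> s; have := der_continuous (der_expR_lin s (- 1)).
  by rewrite (_ : (fun y : R => _) = fun y => expR (- y))//; apply/funext => y; rewrite mulN1r.
have cEF : continuous (fun s => expR (- s) * F s).
  by move=> s; apply: cvgM; [exact: cE|exact: cF].
have dEF (s : R) : 0 < s < t ->
    is_derive s 1 (fun s => expR (- s) * F s) (expR (- s) * (G s - F s)).
  move=> st; have := derM (der_expR_lin s (- 1)) (dF s st).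
  rewrite (_ : (fun y : R => _) = fun y => expR (- y) * F y); last first.
    by apply/funext => y; rewrite mulN1r.
  by move=> H; apply: (der_eq H); rewrite !mulN1r; ring.
rewrite /Rintegral (@continuous_FTC2 R _ (fun s => expR (- s) * F s))//.
- by rewrite oppr0 expR0 mul1r.
- apply: continuous_subspaceT => s; apply: cvgM; first exact: cE.
  by apply: cvgB; [exact: cG|exact: cF].
- split.
  + by move=> s; rewrite in_itv/= => /dEF[].
  + by apply: cvg_at_right_filter; exact: cEF.
  + by apply: cvg_at_left_filter; exact: cEF.
- by move=> s; rewrite in_itv/= => st; rewrite derive1E; have [] := dEF s st.
Qed.

End clamp.

Section weak_identity.
Context {R : realType} {n : nat}.
Local Notation E := 'rV[R]_n.
Local Notation mu := (lebesgue_rV R n).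
Local Notation leb := (@lebesgue_measure R).

Lemma sobolevS k (f : E -> R) : sobolev k.+1 f -> sobolev k f.
Proof.
elim: k f => [|k IH] f [f2 df]; first by split.
by split=> // i; have [g [fg sg]] := df i; exists g; split=> //; exact: IH.
Qed.

(** The test function is [decay_cutoff] times the bump. In each time integral the gradient term
    contributes minus the pairing of the lower derivative and the term with phi_t = - phi plus the
    pairing of the higher one, which explains the differences A2 - A1 and A1 - A0. *)
Lemma wave_identity (i0 : 'I_n) (beta p eps r tau d M : R) (T : \bar R)
    (u1 u2 : E -> R) (u ut utt : R -> E -> R) :
  0 < tau -> 0 < d -> ((tau + d + d)%:E < T)%E -> tau + r < M ->
  sobolev_continuous 2 T u -> sobolev_continuous 1 T ut -> sobolev_continuous 0 T utt ->
  (forall s : R, 0 <= s <= tau ->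
    {ae mu, forall x, ~ euclidean_ball (s + r) x -> u s x = 0} /\
    {ae mu, forall x, ~ euclidean_ball (s + r) x -> ut s x = 0}) ->
  weak_formulation beta p eps u1 u2 T u ut utt ->
  let psi := wave_bump i0 M in
  let A0 s := \int[mu]_x (u s x * psi x) in
  let A1 s := \int[mu]_x (ut s x * psi x) in
  let A2 s := \int[mu]_x (utt s x * psi x) in
  forall t : R, 0 < t <= tau ->
    expR (- t) * (beta * A2 t + A1 t)
    - beta * eps * (\int[mu]_x (u2 x * psi x)) - eps * (\int[mu]_x (u1 x * psi x))
    + beta * (\int[leb]_(s in `[0, t]) (expR (- s) * (A2 s - A1 s)))
    + \int[leb]_(s in `[0, t]) (expR (- s) * (A1 s - A0 s))
    = \int[leb]_(s in `[0, t]) \int[mu]_x (`|ut s x| `^ p * (expR (- s) * psi x)).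
Proof.
move=> tau0 d0 dT Mr [su _] [sut _] [sutt _] supp wf psi A0 A1 A2 t /andP[t0 tt].
pose th := decay_cutoff tau d.
pose phi (z : R * E) := th z.1 * psi z.2.
have tpsi : test_function psi by exact: test_function_wave_bump.
have sth : smooth th by exact: smooth_decay_cutoff.
have psi2 : L2 psi by exact: test_function_L2.
have tphi : spacetime_test_function T phi.
  apply: (spacetime_test_function_prod sth tpsi dT (a := - 1 - d)) => s.
  exact: decay_cutoff_support.
have tT : (t%:E < T)%E by apply: le_lt_trans dT; rewrite lee_fin; lra.
have thE (s : R) : 0 <= s <= tau -> th s = expR (- s) by exact: decay_cutoffE.
have tiT (s : R) : 0 <= s <= tau -> time_interval T s.
  by move=> /andP[s0 st]; split=> //; apply: le_lt_trans dT; rewrite lee_fin; lra.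
have := wf phi tphi t t0 tT.
have ttau : 0 <= t <= tau by rewrite ltW.
have pair_th (g : E -> R) (s : R) : 0 <= s <= tau -> L2 g ->
    \int[mu]_x (g x * phi (s, x)) = expR (- s) * \int[mu]_x (g x * psi x).
  move=> st g2; rewrite -RintegralZl//; last exact: L2_mul_integrable.
  by apply: eq_Rintegral => x _; rewrite /phi/= thE//; ring.
have ut2 := sobolev_L2 (sut _ (tiT _ ttau)).
have utt2 := sobolev_L2 (sutt _ (tiT _ ttau)).
rewrite (pair_th _ _ ttau utt2) (pair_th _ _ ttau ut2).
have pair0 (g : E -> R) : \int[mu]_x (g x * phi (0, x)) = \int[mu]_x (g x * psi x).
  apply: eq_Rintegral => x _; rewrite /phi/= thE ?oppr0 ?expR0 ?mul1r//.
  by rewrite lexx ltW.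
rewrite !pair0.
have term (f g : E -> R) (s : R) : 0 <= s <= tau -> sobolev 1 f -> L2 g ->
    {ae mu, forall x, ~ euclidean_ball (s + r) x -> f x = 0} ->
    \int[mu]_x (\sum_i weak_derivative i f x * d_x i phi (s, x)
      - g x * d_t phi (s, x)) =
    expR (- s) * (\int[mu]_x (g x * psi x) - \int[mu]_x (f x * psi x)).
  move=> st sf g2 f0.
  have sM : s + r < M by move: st => /andP[_]; lra.
  have [L Li] := laplacian_pairing i0 sM sf f0.
  have gi := L2_mul_integrable g2 psi2.
  transitivity (\int[mu]_x (expR (- s) *
      (\sum_i weak_derivative i f x * 'D_(basis_vector i) psi x + g x * psi x))).
    apply: eq_Rintegral => x _; rewrite (d_t_prod _ sth) derive_decay_cutoff//.
    rewrite mulrDr mulr_sumr; congr (_ + _); last by ring.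
    apply: eq_bigr => i _; rewrite (d_x_prod _ tpsi) thE//; ring.
  rewrite RintegralZl//; last by have := integrableD measurableT Li gi.
  by rewrite RintegralD// L addrC.
have integrand1 : \int[leb]_(s in `[0, t]) \int[mu]_x
      (\sum_i weak_derivative i (ut s) x * d_x i phi (s, x) - utt s x * d_t phi (s, x)) =
    \int[leb]_(s in `[0, t]) (expR (- s) * (A2 s - A1 s)).
  apply: eq_Rintegral => s; rewrite inE/= in_itv/= => /andP[s0 st].
  have stau : 0 <= s <= tau by rewrite s0 (le_trans st).
  apply: term => //; first by apply: sut; exact: tiT.
    by apply: sobolev_L2 (sutt _ _); exact: tiT.
  by have [] := supp s stau.
have integrand0 : \int[leb]_(s in `[0, t]) \int[mu]_x
      (\sum_i weak_derivative i (u s) x * d_x i phi (s, x) - ut s x * d_t phi (s, x)) =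
    \int[leb]_(s in `[0, t]) (expR (- s) * (A1 s - A0 s)).
  apply: eq_Rintegral => s; rewrite inE/= in_itv/= => /andP[s0 st].
  have stau : 0 <= s <= tau by rewrite s0 (le_trans st).
  apply: term => //; first by apply: sobolevS; apply: su; exact: tiT.
    by apply: sobolev_L2 (sut _ _); exact: tiT.
  by have [] := supp s stau.
rewrite integrand1 integrand0.
have -> : \int[leb]_(s in `[0, t]) \int[mu]_x (`|ut s x| `^ p * phi (s, x)) =
    \int[leb]_(s in `[0, t]) \int[mu]_x (`|ut s x| `^ p * (expR (- s) * psi x)).
  apply: eq_Rintegral => s; rewrite inE/= in_itv/= => /andP[s0 st].
  by apply: eq_Rintegral => x _; rewrite /phi/= thE// s0 (le_trans st).
move=> <-; rewrite -/(A1 t) -/(A2 t).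
move: (\int[leb]_(s in `[0, t]) (expR (- s) * (A2 s - A1 s)))
  (\int[leb]_(s in `[0, t]) (expR (- s) * (A1 s - A0 s)))
  (\int[mu]_x (u2 x * psi x)) (\int[mu]_x (u1 x * psi x)) => j2 j1 i2 i1.
by move: (A1 t) (A2 t) => a1 a2; ring.
Qed.

End weak_identity.

(** * Lower bound of the nonlinear term *)

Section nonlinearity.
Context {R : realType} {n : nat}.
Local Notation E := 'rV[R]_n.
Local Notation mu := (lebesgue_rV R n).
Local Notation leb := (@lebesgue_measure R).

Lemma measurable_time_interval (T : \bar R) :
  measurable (time_interval T : set (measurableTypeR R)).
Proof.
case: T => [T| |].
- rewrite (_ : time_interval _ = `[0, T[%classic); first exact: measurable_itv.
  by apply/seteqP; split=> s /=; rewrite in_itv/= /time_interval/= lte_fin => /andP.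
- rewrite (_ : time_interval _ = `[0, +oo[%classic); first exact: measurable_itv.
  apply/seteqP; split=> s /=; rewrite in_itv/= andbT; first by case.
  by move=> s0; split=> //; rewrite ltry.
- rewrite (_ : time_interval _ = set0); first exact: measurable0.
  by apply/seteqP; split=> // s [].
Qed.

(** The slices v s are given separately, so Tonelli is applied to the jointly measurable
    representative w of [Lp_loc] and transferred slice by slice. Being finite only for almost every
    s, the extended integral agrees with the real-valued P only almost everywhere. *)
Lemma powR_pairing_integrable (p : R) (T : \bar R) (tau M : R) (psi : E -> R)
    (v : R -> E -> R) :
  p != 0 -> (tau%:E < T)%E -> test_function psi -> (forall x, 0 <= psi x) ->
  (forall x, psi x != 0 -> cube M x) ->
  Lp_loc p T v -> (forall s, time_interval T s -> L2 (v s)) ->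
  let P s := \int[mu]_x (`|v s x| `^ p * (expR (- s) * psi x)) in
  leb.-integrable `[0, tau] (EFin \o P) /\
  {ae leb, forall s, 0 <= s <= tau ->
    (P s)%:E = (\int[mu]_x (`|v s x| `^ p * (expR (- s) * psi x))%:E)%E}.
Proof.
move=> p0 tauT tpsi psi0 psiM [w [mw wv wK]] v2 P.
have [B B0 HB] := test_function_bounded tpsi.
have mpsi : measurable_fun [set: E] (psi : E -> measurableTypeR R).
  exact: (L2_measurable (test_function_L2 tpsi)).
have tiT (s : R) : 0 <= s <= tau -> time_interval T s.
  by move=> /andP[s0 st]; split=> //; apply: le_lt_trans tauT; rewrite lee_fin.
pose D : set (measurableTypeR R * E) := `[0, tau]%classic `*` [set: E].
have mD : measurable D by apply: measurableX => //; exact: measurable_itv.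
have mDT : measurable (time_interval T `*` [set: E] : set (measurableTypeR R * E)).
  apply: measurableX => //.
  exact: measurable_time_interval.
(* Extension by 0 makes w measurable on the whole product, on which Tonelli is stated. *)
pose W : measurableTypeR R * E -> measurableTypeR R := w \_ D.
have mW : measurable_fun [set: measurableTypeR R * E] W.
  apply/(measurable_restrictT _ mD); apply: measurable_funS mw => //.
  move=> -[s x] [/= + _]; rewrite in_itv/= => st; split=> //=; exact: tiT.
pose G (z : measurableTypeR R * E) : R := `|W z| `^ p * (expR (- z.1) * psi z.2).
have mG : measurable_fun [set: measurableTypeR R * E] (EFin \o G).
  apply/measurable_EFinP; apply: measurable_funM.
    by apply: (measurableT_comp (measurable_powR p)); exact: measurableT_comp.
  apply: measurable_funM; last by apply: (measurableT_comp mpsi); exact: measurable_snd.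
  apply: (@measurableT_comp _ _ _ _ _ _ (@expR R)); first exact: measurable_expR.
  by apply: (@measurableT_comp _ _ _ _ _ _ (@GRing.opp R)) => //; exact: measurable_fst.
have G0 z : (0 <= (EFin \o G) z)%E.
  by rewrite lee_fin mulr_ge0 ?powR_ge0 ?mulr_ge0 ?expR_ge0.
pose K : set (R * E) := `[0, tau]%classic `*` cube M.
have mK : measurable (K : set (measurableTypeR R * E)).
  by apply: measurableX; [exact: measurable_itv|exact: measurable_cube].
have KT : K `<=` time_interval T `*` [set: E].
  by move=> -[s x] [/= + _]; rewrite in_itv/= => st; split=> //=; exact: tiT.
have cK : compact K by apply: compact_setX; [exact: segment_compact|exact: compact_cube].
(* Local integrability suffices: psi restricts x to a cube, psi <= B and e^(-s) <= 1. Outside the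
   strip W = 0, and 0 to the power p is 0 because p is nonzero. *)
have intG : (\int[leb \x mu]_z (EFin \o G) z < +oo)%E.
  apply: (@le_lt_trans _ _
      (\int[leb \x mu]_(z in K) (B%:E * (`|w z| `^ p)%:E))%E); last first.
    rewrite ge0_integralZl//=.
    - by rewrite lte_mul_pinfty// ?lee_fin//; exact: wK.
    - apply/measurable_EFinP; apply: (measurableT_comp (measurable_powR p)).
      by apply: measurableT_comp => //; exact: measurable_funS mw.
  rewrite [leRHS]integral_mkcond; apply: ge0_le_integral => //.
  - apply/(measurable_restrictT _ _).1; first exact: mK.
    apply: measurable_funeM; apply/measurable_EFinP.
    apply: (measurableT_comp (measurable_powR p)).
    by apply: measurableT_comp => //; exact: measurable_funS mw.
  - move=> -[s x] _; rewrite patchE; case: ifPn => [/set_mem[/= + xM]|zK].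
      rewrite in_itv/= => /[dup] st /andP[s0 _].
      rewrite -EFinM lee_fin /G/= /W patchE mem_set/=; last by split=> //=; rewrite in_itv.
      rewrite mulrC ler_wpM2r ?powR_ge0//.
      apply: le_trans (HB x); rewrite (ger0_norm (psi0 x)).
      by rewrite ler_piMl// expR_le1 oppr_le0.
    rewrite lee_fin /G/=.
    have [->|px] := eqVneq (psi x) 0; first by rewrite !mulr0.
    rewrite /W patchE memNset ?normr0 ?powR0 ?mul0r//.
    move=> [/= st _]; move: zK; rewrite notin_setE; apply; split=> //=.
    exact: psiM.
rewrite fubini_tonelli1// in intG.
have mF := measurable_fun_fubini_tonelli_F (m2 := mu) _ mG G0.
set F := fubini_F _ _ in intG mF.
have F0 s : (0 <= F s)%E by apply: integral_ge0 => x _; exact: G0.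
have iF : leb.-integrable [set: measurableTypeR R] F.
  apply/integrableP; split => //.
  by rewrite (eq_integral F)// => s _; rewrite gee0_abs.
have FE (s : R) : 0 <= s <= tau ->
    F s = (\int[mu]_x (`|v s x| `^ p * (expR (- s) * psi x))%:E)%E.
  move=> st; apply: ge0_ae_eq_integral => //=.
  - by apply: (measurable_fun_pair2 s mG).
  - apply/measurable_EFinP; apply: measurable_funM.
      apply: (measurableT_comp (measurable_powR p)); apply: measurableT_comp => //.
      exact: (L2_measurable (v2 _ (tiT _ st))).
    by apply: measurable_funM.
  - by move=> x _; exact: (G0 (s, x)).
  - by move=> x _; rewrite lee_fin mulr_ge0 ?powR_ge0 ?mulr_ge0 ?expR_ge0.
  - apply: filterS (wv s (tiT _ st)) => x /= wx _.
    by rewrite /G/= /W patchE mem_set/= ?wx//; split=> //=; rewrite in_itv.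
have PF (s : R) : 0 <= s <= tau -> P s = fine (F s) by move=> st; rewrite FE.
have iFtau : leb.-integrable `[0, tau] F.
  by apply: integrableS iF => //; exact: measurable_itv.
split.
- have mI : measurable (`[0, tau]%classic : set (measurableTypeR R)).
    exact: measurable_itv.
  apply: (eq_integrable mI (fun s => (fine (F s))%:E)).
  + by move=> s; rewrite inE/= in_itv/= => st; rewrite PF.
  + apply: le_integrable iFtau; first exact: measurable_itv.
      apply: measurableT_comp => //; apply: (measurableT_comp (fine_measurable _)) => //.
      exact: measurable_funTS.
    move=> s _ /=; have := F0 s; case: (F s) => [y| |]//= _.
    by rewrite leey.
- have := integrable_ae measurableT iF; apply: filterS => s /(_ I) Ffin st.
  by rewrite (PF s st) -(FE s st) (fineK Ffin).
Qed.

End nonlinearity.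

Section hoelder_lower_bound.
Context {R : realType}.

(** Split |v| psi = (|v| psi^(1/p)) (psi^(1/q) 1_A) with 1/p + 1/q = 1; the indicator is free since
    v vanishes off A, and it limits the mass of psi to A. *)
Lemma hoelder_pairing n (p N V : R) (A : set 'rV[R]_n) (v psi : 'rV[R]_n -> R) :
  1 < p -> 0 <= N -> 0 <= V -> measurable A -> L2 v -> L2 psi -> (forall x, 0 <= psi x) ->
  {ae lebesgue_rV R n, forall x, ~ A x -> v x = 0} ->
  (\int[lebesgue_rV R n]_x (`|v x| `^ p * psi x)%:E = N%:E)%E ->
  (\int[lebesgue_rV R n]_(x in A) (psi x)%:E <= V%:E)%E ->
  `|\int[lebesgue_rV R n]_x (v x * psi x)| `^ p <= N * V `^ (p - 1).
Proof.
move=> p1 N0 V0 mA v2 psi2 psi0 vA EN EV; set mu := lebesgue_rV R n in vA EN EV *.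
have p0 : 0 < p by lra.
pose q := p / (p - 1).
have q0 : 0 < q by rewrite divr_gt0//; lra.
have pq : p^-1 + q^-1 = 1.
  by rewrite /q invf_div; field; rewrite gt_eqF.
pose f x := `|v x| * psi x `^ p^-1.
pose g x := psi x `^ q^-1 * \1_A x.
have mv := L2_measurable v2; have mpsi := L2_measurable psi2.
have mf : measurable_fun [set: 'rV[R]_n] (f : _ -> measurableTypeR R).
  apply: measurable_funM; first exact: measurableT_comp.
  exact: (measurableT_comp (measurable_powR p^-1)).
have mg : measurable_fun [set: 'rV[R]_n] (g : _ -> measurableTypeR R).
  apply: measurable_funM; last exact: measurable_indic.
  exact: (measurableT_comp (measurable_powR q^-1)).
have fg x : f x * g x = `|v x| * psi x * \1_A x.
  have psiE : psi x `^ p^-1 * psi x `^ q^-1 = psi x.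
    by rewrite -powRD ?pq ?powRr1// oner_eq0.
  rewrite /f /g -[in RHS]psiE; ring.
have L1 : ('N[mu]_1[EFin \o (f \* g)%R] = (\int[mu]_x `|v x * psi x|)%:E)%E.
  rewrite Lnorm1 fineK; last first.
    apply: integrable_fin_num => //.
    exact: (integrable_norm (L2_mul_integrable v2 psi2)).
  apply: ge0_ae_eq_integral => //.
  - by apply: measurableT_comp => //; apply/measurable_EFinP; apply: measurable_funM.
  - apply/measurable_EFinP; apply: measurableT_comp => //; exact: measurable_funM.
  - apply: filterS vA => x xA _ /=; rewrite fg; congr EFin.
    rewrite !normrM normr_id (ger0_norm (psi0 x)).
    have [Ax|Ax] := pselect (A x); first by rewrite indicE mem_set// normr1 mulr1.
    by rewrite xA// normr0 !mul0r.
have Lp : ('N[mu]_p%:E[EFin \o f] = (N `^ p^-1)%:E)%E.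
  rewrite unlock -poweR_EFin; congr (_ `^ _)%E; rewrite -EN.
  apply: eq_integral => x _ /=; congr EFin.
  rewrite /f normrM normr_id ger0_norm ?powR_ge0// powRM ?powR_ge0// -powRrM mulVf ?gt_eqF//.
  by rewrite powRr1.
have Lq : ('N[mu]_q%:E[EFin \o g] <= (V `^ q^-1)%:E)%E.
  rewrite unlock -poweR_EFin; apply: gt0_ler_poweR.
  - by rewrite invr_ge0 ltW.
  - by rewrite in_itv/= leey andbT; apply: integral_ge0 => x _; rewrite lee_fin powR_ge0.
  - by rewrite in_itv/= leey andbT lee_fin.
  apply: le_trans EV; rewrite [leRHS]integral_mkcond.
  rewrite (eq_integral (fun x => ((fun y => (psi y)%:E) \_ A) x))// => x _ /=.
  rewrite patchE /g indicE; case: (x \in A); last by rewrite mulr0 normr0 powR0 ?gt_eqF.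
  rewrite mulr1 ger0_norm ?powR_ge0// -powRrM mulVf ?gt_eqF// powRr1//.
have H := hoelder mu mf mg p0 q0 pq.
rewrite L1 Lp in H.
have {}H : \int[mu]_x `|v x * psi x| <= N `^ p^-1 * V `^ q^-1.
  rewrite -lee_fin EFinM; apply: (le_trans H).
  by apply: lee_wpmul2l => //; rewrite lee_fin powR_ge0.
have A_le := le_trans (le_normr_Rintegral measurableT (L2_mul_integrable v2 psi2)) H.
have : `|\int[mu]_x (v x * psi x)| `^ p <= (N `^ p^-1 * V `^ q^-1) `^ p.
  by apply: ge0_ler_powR; rewrite ?nnegrE ?mulr_ge0 ?powR_ge0 ?(ltW p0).
rewrite powRM ?powR_ge0// -!powRrM mulVf ?gt_eqF// powRr1//.
suff -> : q^-1 * p = p - 1 by [].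
by rewrite /q invf_div divfK// gt_eqF.
Qed.

(** The constant is uniform in s, v and the truncation M, because the ball of radius s + r lies in
    the cube where the bump is the pure exponential. *)
Lemma source_lower_bound m (p r : R) : 1 < p -> 0 < r ->
  exists2 k : R, 0 < k & forall (s P M : R) (v : 'rV[R]_m.+1 -> R),
    0 <= s -> s + r <= M -> L2 v ->
    {ae lebesgue_rV R m.+1, forall x, ~ euclidean_ball (s + r) x -> v x = 0} ->
    (P%:E = \int[lebesgue_rV R m.+1]_x
       (`|v x| `^ p * (expR (- s) * wave_bump ord0 M x))%:E)%E ->
    k * (1 + s) `^ (- (m%:R * (p - 1) / 2)) *
      `|expR (- s) * \int[lebesgue_rV R m.+1]_x (v x * wave_bump ord0 M x)| `^ p <= P.
Proof.
move=> p1 r0; have [C C0 HC] := @ball_integral_bound R m.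
(* The factor e^r is e^(-s) e^(s + r), and the root comes from s + r <= (1 + r) (1 + s). *)
pose C1 := C * expR r * Num.sqrt (1 + r) ^+ m.
have C10 : 0 < C1.
  by rewrite !mulr_gt0 ?expR_gt0 ?exprn_gt0 ?sqrtr_gt0 ?addr_gt0.
exists (C1 `^ (- (p - 1))); first exact: powR_gt0.
move=> s P M v s0 sM v2 vA PE; set psi := wave_bump ord0 M in PE *.
have psi2 : L2 psi by apply: test_function_L2; exact: test_function_wave_bump.
have s10 : 0 < 1 + s by lra.
pose V := C1 * (1 + s) `^ (m%:R / 2).
have V0 : 0 < V by rewrite mulr_gt0// powR_gt0.
have Vle : (\int[lebesgue_rV R m.+1]_(x in euclidean_ball (s + r)) (expR (- s) * psi x)%:E
    <= V%:E)%E.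
  have sr0 : 0 < s + r by lra.
  rewrite (eq_integral (fun x : 'rV[R]_m.+1 =>
    (expR (- s))%:E * (expR (x ord0 ord0))%:E)%E); last first.
    move=> x /set_mem xs; rewrite -EFinM; congr (_ * _)%:E; apply: wave_bump_cube => i.
    by rewrite -ler_norml; apply: le_trans sM; exact: euclidean_ball_coord.
  rewrite ge0_integralZl//=; last 2 first.
  - exact: measurable_euclidean_ball.
  - apply/measurable_EFinP; apply: measurable_funTS.
    apply: (@measurableT_comp _ _ _ _ _ _ (@expR R)); first exact: measurable_expR.
    exact: measurable_rV_coord.
  apply: (@le_trans _ _ ((expR (- s))%:E *
     (C * Num.sqrt (s + r) ^+ m * expR (s + r))%:E)%E).
    by apply: lee_wpmul2l; [rewrite lee_fin expR_ge0|exact: HC].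
  rewrite -EFinM lee_fin.
  have -> : expR (- s) * (C * Num.sqrt (s + r) ^+ m * expR (s + r)) =
      C * expR r * Num.sqrt (s + r) ^+ m.
    have E1 : expR (- s) * expR (s + r) = expR r by rewrite -expRD addKr.
    by rewrite -E1; ring.
  rewrite /V /C1 -[X in _ <= X]mulrA ler_pM2l ?mulr_gt0 ?expR_gt0//.
  have -> : (1 + s) `^ (m%:R / 2) = Num.sqrt (1 + s) ^+ m.
    by rewrite mulrC powRrM powR12_sqrt ?(ltW s10)// powR_mulrn ?sqrtr_ge0.
  rewrite -exprMn -sqrtrM; last by lra.
  apply: lerXn2r; rewrite ?nnegrE ?sqrtr_ge0//; apply: ler_wsqrtr.
  by have := mulr_ge0 s0 (ltW r0); lra.
have epsi2 : L2 (fun x => expR (- s) * psi x) by exact: L2Z.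
have epsi0 x : 0 <= expR (- s) * psi x by rewrite mulr_ge0 ?expR_ge0 ?wave_bump_ge0.
have P0 : 0 <= P.
  rewrite -lee_fin PE; apply: integral_ge0 => x _.
  by rewrite lee_fin mulr_ge0 ?powR_ge0.
have HX : `|\int[lebesgue_rV R m.+1]_x (v x * (expR (- s) * psi x))| `^ p
    <= P * V `^ (p - 1).
  apply: (@hoelder_pairing _ _ _ _ (euclidean_ball (s + r))) => //.
  - exact: ltW.
  - exact: measurable_euclidean_ball.
have E1 : \int[lebesgue_rV R m.+1]_x (v x * (expR (- s) * psi x)) =
    expR (- s) * \int[lebesgue_rV R m.+1]_x (v x * psi x).
  rewrite -RintegralZl//; last exact: L2_mul_integrable.
  by apply: eq_Rintegral => x _; ring.
rewrite E1 in HX; set X := `|_| `^ p in HX *.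
have VE : V `^ (p - 1) = C1 `^ (p - 1) * (1 + s) `^ (m%:R * (p - 1) / 2).
  by rewrite powRM ?powR_ge0 ?(ltW C10)// -powRrM mulrAC.
have Vp0 : 0 < V `^ (p - 1) by rewrite powR_gt0.
have -> : C1 `^ (- (p - 1)) * (1 + s) `^ (- (m%:R * (p - 1) / 2)) = (V `^ (p - 1))^-1.
  by rewrite !powRN VE invfM.
by rewrite mulrC ler_pdivrMr.
Qed.

End hoelder_lower_bound.

(** * Lifespan estimates *)

Section blow_up.
Context {R : realType}.
Local Notation leb := (@lebesgue_measure R).

Lemma ae_lebesgueS (A B : R -> Prop) : (forall s, A s -> B s) ->
  {ae leb, forall s, A s} -> {ae leb, forall s, B s}.
Proof.
by move=> AB; apply: negligibleS => s /= nB As; apply: nB; exact: AB.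
Qed.

Lemma Rintegral_itv_nondecreasing (P : R -> R) (x y tau : R) :
  0 <= x -> x <= y -> y <= tau -> (forall s, 0 <= P s) ->
  leb.-integrable `[0, tau] (EFin \o P) ->
  \int[leb]_(s in `[0, x]) P s <= \int[leb]_(s in `[0, y]) P s.
Proof.
move=> x0 xy yt P0 iP; rewrite -subr_ge0.
rewrite (@Rintegral_itvB _ P (BLeft 0) (BRight y) x) ?bnd_simp//.
  by apply: Rintegral_ge0.
by apply: integrableS iP => //; apply: subset_itvl; rewrite bnd_simp.
Qed.

Lemma le_Rintegral_ae (F P : R -> R) (x tau : R) : x <= tau ->
  continuous F -> (forall s, 0 <= F s) -> (forall s, 0 <= P s) ->
  leb.-integrable `[0, tau] (EFin \o P) ->
  {ae leb, forall s, 0 <= s <= tau -> F s <= P s} ->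
  \int[leb]_(s in `[0, x]) F s <= \int[leb]_(s in `[0, x]) P s.
Proof.
move=> xt cF F0 P0 iP FP.
have iF : leb.-integrable `[0, x] (EFin \o F).
  by apply: continuous_compact_integrable; [exact: segment_compact|exact: continuous_subspaceT].
have iPx : leb.-integrable `[0, x] (EFin \o P).
  by apply: integrableS iP => //; apply: subset_itvl; rewrite bnd_simp.
have mI : measurable (`[0, x]%classic : set (measurableTypeR R)) by exact: measurable_itv.
apply: fine_le; [exact: integrable_fin_num|exact: integrable_fin_num|].
apply: ae_ge0_le_integral => //.
- by move=> s _; rewrite lee_fin.
- exact: (measurable_int leb iF).
- by move=> s _; rewrite lee_fin.
- exact: (measurable_int leb iPx).
- apply: ae_lebesgueS FP => s sFP; rewrite /= in_itv/= => /andP[s0 sx].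
  by rewrite lee_fin sFP// s0 (le_trans sx).
Qed.

Lemma L2_pairing_ae n (f g psi : 'rV[R]_n -> R) : L2 f -> L2 g -> L2 psi ->
  {ae lebesgue_rV R n, forall x, f x = g x} ->
  \int[lebesgue_rV R n]_x (f x * psi x) = \int[lebesgue_rV R n]_x (g x * psi x).
Proof.
move=> f2 g2 p2 fg; have mp := L2_measurable p2; apply: ae_eq_Rintegral.
- exact: (measurable_funM (L2_measurable f2) mp).
- exact: (measurable_funM (L2_measurable g2) mp).
- by apply: filterS fg => x ->.
Qed.

Lemma initial_pairing_ge0 n (i0 : 'I_n) (M : R) (g : 'rV[R]_n -> R) : L2 g ->
  {ae lebesgue_rV R n, forall x, 0 <= g x} ->
  0 <= \int[lebesgue_rV R n]_x (g x * wave_bump i0 M x).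
Proof.
move=> g2 g0; have p2 := test_function_L2 (test_function_wave_bump i0 M).
have mg := L2_measurable g2; have mp := L2_measurable p2.
rewrite (@ae_eq_Rintegral _ _ _ (fun x => `|g x| * wave_bump i0 M x)).
- by apply: Rintegral_ge0 => x _; rewrite mulr_ge0 ?wave_bump_ge0.
- exact: measurable_funM.
- by apply: measurable_funM => //; exact: measurableT_comp.
- by apply: filterS g0 => x gx; rewrite ger0_norm.
Qed.

(** A nonnegative integrand of integral 0 vanishes almost everywhere, and the weight is positive on
    the ball. Contraposed, nontrivial data have a positive pairing. *)
Lemma initial_pairing_eq0 n (i0 : 'I_n) (r : R) (g : 'rV[R]_n -> R) : L2 g ->
  {ae lebesgue_rV R n, forall x, 0 <= g x} ->
  {ae lebesgue_rV R n, forall x, ~ euclidean_ball r x -> g x = 0} ->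
  \int[lebesgue_rV R n]_x (g x * wave_bump i0 r x) = 0 ->
  {ae lebesgue_rV R n, forall x, g x = 0}.
Proof.
move=> g2 g0 gr I0; have p2 := test_function_L2 (test_function_wave_bump i0 r).
have gi := L2_mul_integrable g2 p2.
have /integrableP[mgp _] := gi.
have J0 : (\int[lebesgue_rV R n]_x `|(g x * wave_bump i0 r x)%:E| = 0)%E.
  transitivity (\int[lebesgue_rV R n]_x (g x * wave_bump i0 r x)%:E)%E.
    apply: ae_eq_integral => //; first exact: measurableT_comp.
    apply: filterS g0 => x gx _; rewrite gee0_abs// lee_fin mulr_ge0//.
    exact: wave_bump_ge0.
  rewrite -[LHS]fineK; last exact: integrable_fin_num.
  by rewrite -[X in X%:E]/(\int[lebesgue_rV R n]_x (g x * wave_bump i0 r x)) I0.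
have /(ae_eq_integral_abs _ measurableT mgp) := J0.
apply: filterS2 gr => x xr /(_ I) /= [] /eqP; rewrite mulf_eq0 => /orP[/eqP//|].
have [xb|/xr//] := pselect (euclidean_ball r x).
rewrite wave_bump_cube ?expR_eq0// => j.
by rewrite -ler_norml; exact: euclidean_ball_coord.
Qed.

(** The truncation M grows with the time considered; this keeps the constants built from the initial
    pairings independent of it. *)
Lemma initial_pairingE n (i0 : 'I_n) (r M : R) (g : 'rV[R]_n -> R) : L2 g -> r <= M ->
  {ae lebesgue_rV R n, forall x, ~ euclidean_ball r x -> g x = 0} ->
  \int[lebesgue_rV R n]_x (g x * wave_bump i0 M x) =
  \int[lebesgue_rV R n]_x (g x * wave_bump i0 r x).
Proof.
move=> g2 rM gr.
have mg := L2_measurable g2.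
have mp (N : R) := L2_measurable (test_function_L2 (test_function_wave_bump i0 N)).
apply: ae_eq_Rintegral; try by apply: measurable_funM => //; exact: mp.
apply: filterS gr => x xr.
have [xb|/xr ->] := pselect (euclidean_ball r x); last by rewrite !mul0r.
have xc j : `|x ord0 j| <= r by exact: euclidean_ball_coord.
by rewrite !wave_bump_cube// => j; rewrite -ler_norml// (le_trans (xc j)).
Qed.

Lemma powR_pairing_ge0 n (p s : R) (v psi : 'rV[R]_n -> R) : (forall x, 0 <= psi x) ->
  0 <= \int[lebesgue_rV R n]_x (`|v x| `^ p * (expR (- s) * psi x)).
Proof.
move=> psi0; apply: Rintegral_ge0 => x _.
by rewrite mulr_ge0 ?powR_ge0 ?mulr_ge0 ?expR_ge0.
Qed.

(** A0, A1, A2 stand for the pairings of u, u_t, u_tt with the bump, and J0, J1, J2 for the pairings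
    of the scaled initial data; only scalar functions of time remain. *)
Lemma lifespan_of_identity (beta p k g kap c l J0 J1 J2 tau : R) (T : \bar R)
    (A0 A1 A2 P Lam : R -> R) :
  let q0 := beta * J2 + (beta + 1) * J1 + J0 in
  0 < beta -> 1 < p -> 0 < k -> 0 <= g ->
  (beta + 1)^-1 <= kap -> kap < 1 -> J1 + J0 <= kap * q0 ->
  c = (1 - kap) / beta -> 0 < l -> l <= 1 -> l * (p + 2) <= k * c `^ p ->
  0 < q0 -> 0 <= J1 -> 1 <= tau -> (tau%:E < T)%E ->
  (forall A, [\/ A = A0, A = A1 | A = A2] -> forall t, time_interval T t ->
    A s @[s --> within (time_interval T) (nbhs t)] --> A t) ->
  (forall s : R, 0 < s -> (s%:E < T)%E -> is_derive s 1 A0 (A1 s)) ->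
  (forall s : R, 0 < s -> (s%:E < T)%E -> is_derive s 1 A1 (A2 s)) ->
  A0 0 = J0 -> A1 0 = J1 ->
  (forall t : R, 0 < t <= tau ->
    expR (- t) * (beta * A2 t + A1 t) - beta * J2 - J1
    + beta * (\int[leb]_(s in `[0, t]) (expR (- s) * (A2 s - A1 s)))
    + \int[leb]_(s in `[0, t]) (expR (- s) * (A1 s - A0 s))
    = \int[leb]_(s in `[0, t]) P s) ->
  (forall s, 0 <= P s) -> leb.-integrable `[0, tau] (EFin \o P) ->
  {ae leb, forall s, 0 <= s <= tau ->
    k * (1 + s) `^ (- g) * `|expR (- s) * A1 s| `^ p <= P s} ->
  (forall x : R, 0 < x -> is_derive x 1 Lam ((1 + x) `^ (- g))) ->
  l * (Lam tau - Lam 1) <=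
    ((q0 / 3) `^ (- (p - 1)) + 2 * (q0 / 3) `^ (- ((p - 1) / 2))) / (p - 1).
Proof.
move=> q0 b0 p1 k0 g0 bkap kap1 m0 cE l0 l1 lk q00 J10 tau1 tauT cA dA0 dA1 A00 A10 ident
  P0 iP Plb dLam.
have tau0 : 0 < tau by exact: lt_le_trans tau1.
have tau00 : 0 <= (0 : R) <= tau by rewrite lexx ltW.
pose F0 s := A0 (clamp tau s); pose F1 s := A1 (clamp tau s); pose F2 s := A2 (clamp tau s).
have cF0 : continuous F0.
  by apply: (continuous_comp_clamp (ltW tau0) tauT); apply: cA; constructor 1.
have cF1 : continuous F1.
  by apply: (continuous_comp_clamp (ltW tau0) tauT); apply: cA; constructor 2.
have cF2 : continuous F2.
  by apply: (continuous_comp_clamp (ltW tau0) tauT); apply: cA; constructor 3.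
have FE (s : R) : 0 <= s <= tau -> [/\ F0 s = A0 s, F1 s = A1 s & F2 s = A2 s].
  by move=> st; rewrite /F0 /F1 /F2 clamp_id.
have FE' (s : R) : 0 < s < tau -> [/\ F0 s = A0 s, F1 s = A1 s & F2 s = A2 s].
  by move=> /andP[s0 st]; apply: FE; rewrite !ltW.
have sT (s : R) : 0 < s < tau -> (s%:E < T)%E.
  by move=> /andP[_ st]; apply: lt_trans tauT; rewrite lte_fin.
have dF0 (s : R) : 0 < s < tau -> is_derive s 1 F0 (F1 s).
  move=> st; have [_ -> _] := FE' s st; apply: der_comp_clamp => //.
  by apply: dA0; [case/andP: st|exact: sT].
have dF1 (s : R) : 0 < s < tau -> is_derive s 1 F1 (F2 s).
  move=> st; have [_ _ ->] := FE' s st; apply: der_comp_clamp => //.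
  by apply: dA1; [case/andP: st|exact: sT].
have [F00 F10 _] := FE 0 tau00.
pose Q x := q0 + \int[leb]_(s in `[0, x]) P s.
have dE (s : R) : is_derive s 1 (fun s : R => expR (- s)) (- expR (- s)).
  have := der_expR_lin s (- 1).
  rewrite (_ : (fun y : R => _) = fun y => expR (- y)); last first.
    by apply/funext => y; rewrite mulN1r.
  by rewrite !mulN1r.
have cE' : continuous (fun s : R => expR (- s)) by move=> s; exact: der_continuous (dE s).
pose f s := expR (- s) * F1 s; pose al s := expR (- s) * F0 s.
pose df s := expR (- s) * (F2 s - F1 s).
have cf : continuous f by move=> s; apply: cvgM; [exact: cE'|exact: cF1].
have f00 : f 0 = J1 by rewrite /f oppr0 expR0 mul1r F10.
have al00 : al 0 = J0 by rewrite /al oppr0 expR0 mul1r F00.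
apply: (@ode_lifespan _ p k g beta kap c l q0 tau f df al Q Lam) => //.
- exact: ltW.
- by move=> s; apply: cvgM; [exact: cE'|exact: cF0].
- move=> s st; apply: (der_eq (derM (dE s) (dF1 s st))).
  by rewrite /df; ring.
- move=> s st; apply: (der_eq (derM (dE s) (dF0 s st))).
  by rewrite /f /al; ring.
(* Once both time integrals are evaluated, the identity reads e^(-x) (beta A2 + (beta + 1) A1 + A0)
   = Q; with e^(-x) A2 = f' + f this is the equation for f. *)
- move=> x xt; have /andP[x0 xtau] := xt.
  have := ident x; rewrite x0 (ltW xtau) => /(_ isT).
  have -> : \int[leb]_(s in `[0, x]) (expR (- s) * (A2 s - A1 s)) =
      expR (- x) * F1 x - F1 0.
    have dFx (s : R) : 0 < s < x -> is_derive s 1 F1 (F2 s).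
      by move=> /andP[s0' sx]; apply: dF1; rewrite s0' (lt_trans sx).
    have <- := integral_expRN_der x0 cF1 cF2 dFx.
    apply: eq_Rintegral => s; rewrite inE/= in_itv/= => /andP[s0' sx].
    by have [|_ -> ->] := FE s; first by rewrite s0' (le_trans sx)// ltW.
  have -> : \int[leb]_(s in `[0, x]) (expR (- s) * (A1 s - A0 s)) =
      expR (- x) * F0 x - F0 0.
    have dFx (s : R) : 0 < s < x -> is_derive s 1 F0 (F1 s).
      by move=> /andP[s0' sx]; apply: dF0; rewrite s0' (lt_trans sx).
    have <- := integral_expRN_der x0 cF0 cF1 dFx.
    apply: eq_Rintegral => s; rewrite inE/= in_itv/= => /andP[s0' sx].
    by have [|-> -> _] := FE s; first by rewrite s0' (le_trans sx)// ltW.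
  have [E0 E1 E2] := FE' x xt.
  rewrite F00 F10 A00 A10 /Q => <-.
  by rewrite /df /f /al E0 E1 E2 /q0; ring.
- move=> x y x0 xy yt; rewrite /Q lerD2l.
  exact: (Rintegral_itv_nondecreasing x0 xy yt P0 iP).
- move=> x /andP[x0 xt]; rewrite /Q lerD2l.
  apply: (le_Rintegral_ae xt) => //.
  + by apply: continuous_weighted_powR cf; exact: lt_trans p1.
  + by move=> s; rewrite !mulr_ge0 ?powR_ge0 ?(ltW k0).
  + apply: ae_lebesgueS Plb => s Pls st; have /andP[s0' st'] := st.
    by rewrite (ger0_norm s0') /f; have [_ -> _] := FE s st; exact: Pls.
- by rewrite f00.
- by rewrite f00 al00.
Qed.

(** The conditions on k, kap, c and l involve neither eps nor tau. The one on kap is homogeneous in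
    the data, so it survives their multiplication by eps. *)
Lemma lifespan_inequality m (beta p r k kap c l eps tau : R) (T : \bar R) (Lam : R -> R)
    (u0 u1 u2 : 'rV[R]_m.+1 -> R) (u : R -> 'rV[R]_m.+1 -> R) :
  let pair g := \int[lebesgue_rV R m.+1]_x (g x * wave_bump ord0 r x) in
  let q1 := beta * pair u2 + (beta + 1) * pair u1 + pair u0 in
  let g := m%:R * (p - 1) / 2 in
  0 < beta -> 1 < p -> 0 < r -> 0 < k ->
  (forall (s P M : R) (v : 'rV[R]_m.+1 -> R),
    0 <= s -> s + r <= M -> L2 v ->
    {ae lebesgue_rV R m.+1, forall x, ~ euclidean_ball (s + r) x -> v x = 0} ->
    (P%:E = \int[lebesgue_rV R m.+1]_x
       (`|v x| `^ p * (expR (- s) * wave_bump ord0 M x))%:E)%E ->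
    k * (1 + s) `^ (- g) *
      `|expR (- s) * \int[lebesgue_rV R m.+1]_x (v x * wave_bump ord0 M x)| `^ p <= P) ->
  (beta + 1)^-1 <= kap -> kap < 1 -> pair u1 + pair u0 <= kap * q1 ->
  c = (1 - kap) / beta -> 0 < l -> l <= 1 -> l * (p + 2) <= k * c `^ p ->
  0 < q1 -> 0 <= pair u1 ->
  sobolev 2 u0 -> sobolev 1 u1 -> sobolev 0 u2 ->
  ess_support u0 `<=` euclidean_ball r ->
  ess_support u1 `<=` euclidean_ball r ->
  ess_support u2 `<=` euclidean_ball r ->
  0 < eps -> energy_solution beta p eps u0 u1 u2 T u ->
  (forall t : R, 0 < t -> (t%:E < T)%E ->
    ess_support (u t) `<=` euclidean_ball (t + r)) ->
  (forall x : R, 0 < x -> is_derive x 1 Lam ((1 + x) `^ (- g))) ->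
  1 <= tau -> (tau%:E < T)%E ->
  l * (Lam tau - Lam 1) <=
    ((eps * q1 / 3) `^ (- (p - 1)) + 2 * (eps * q1 / 3) `^ (- ((p - 1) / 2))) / (p - 1).
Proof.
move=> pair q1 g b0 p1 r0 k0 Hk bkap kap1 m0 cE l0 l1 lk q10 I10 s0 s1 s2 r0_ r1_ r2_ e0.
pose M := tau + r + 1.
have Mr : tau + r < M by rewrite /M ltrDl.
have sM (s : R) : s <= tau -> s + r <= M by move=> st; rewrite /M; lra.
have rM : 1 <= tau -> r <= M by rewrite /M; lra.
have p0 : p != 0 by rewrite gt_eqF// (lt_trans ltr01).
have g0 : 0 <= g.
  apply: divr_ge0 => //; apply: mulr_ge0 => //.
  by rewrite subr_ge0 ltW.
have qE : eps * q1 = beta * (eps * pair u2) + (beta + 1) * (eps * pair u1) + eps * pair u0.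
  by rewrite /q1; ring.
have em0 : eps * pair u1 + eps * pair u0 <= kap * (beta * (eps * pair u2) +
    (beta + 1) * (eps * pair u1) + eps * pair u0).
  by rewrite -qE -mulrDr mulrCA ler_pM2l.
have eq10 : 0 < beta * (eps * pair u2) + (beta + 1) * (eps * pair u1) + eps * pair u0.
  by rewrite -qE mulr_gt0.
have eI10 : 0 <= eps * pair u1 by rewrite mulr_ge0// ltW.
move=> [ut [utt [[cu du cut] [dut cutt] Lp [u0E ut0E] wf]]] supp dLam tau1 tauT.
have {}rM := rM tau1.
have tau0 : 0 < tau by lra.
have [d d0 dT] : exists2 d : R, 0 < d & ((tau + d + d)%:E < T)%E.
  case: T tauT {cu du cut dut cutt Lp wf supp} => [T| |]//=.
    rewrite lte_fin => tT; exists ((T - tau) / 3); first by lra.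
    by rewrite lte_fin; lra.
  by move=> _; exists 1 => //; rewrite ltry.
have tiT (s : R) : 0 <= s <= tau -> time_interval T s.
  by move=> /andP[s0' st]; split=> //; apply: le_lt_trans tauT; rewrite lee_fin.
have u2T (s : R) : time_interval T s -> L2 (u s) by move=> sT; exact: sobolev_L2 (cu.1 _ sT).
have ut2T (s : R) : time_interval T s -> L2 (ut s).
  by move=> sT; exact: sobolev_L2 (cut.1 _ sT).
have utt2T (s : R) : time_interval T s -> L2 (utt s).
  by move=> sT; exact: sobolev_L2 (cutt.1 _ sT).
have u02 := sobolev_L2 s0; have u12 := sobolev_L2 s1; have u22 := sobolev_L2 s2.
have z0 := ess_support_ae r0_; have z1 := ess_support_ae r1_; have z2 := ess_support_ae r2_.
have usupp (s : R) : 0 < s -> (s%:E < T)%E ->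
    {ae lebesgue_rV R m.+1, forall x, ~ euclidean_ball (s + r) x -> u s x = 0}.
  by move=> s0' sT; exact: ess_support_ae (supp s s0' sT).
have utsupp := velocity_support u2T ut2T du usupp.
have supports (s : R) : 0 <= s <= tau ->
    {ae lebesgue_rV R m.+1, forall x, ~ euclidean_ball (s + r) x -> u s x = 0} /\
    {ae lebesgue_rV R m.+1, forall x, ~ euclidean_ball (s + r) x -> ut s x = 0}.
  (* The support hypothesis concerns positive times; at s = 0 the supports of the initial data take
     over. *)
  move=> /[dup] sT /andP[]; rewrite le_eqVlt => /predU1P[<- _|s0' _]; last first.
    by have [_ ?] := tiT s sT; split; [exact: usupp|exact: utsupp].
  rewrite add0r; split.
    by apply: filterS2 u0E z0 => x -> zx /zx ->; rewrite mulr0.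
  by apply: filterS2 ut0E z1 => x -> zx /zx ->; rewrite mulr0.
pose psi : 'rV[R]_m.+1 -> R := wave_bump ord0 M.
have tpsi : test_function psi by exact: test_function_wave_bump.
have psi2 := test_function_L2 tpsi.
pose A0 s := \int[lebesgue_rV R m.+1]_x (u s x * psi x).
pose A1 s := \int[lebesgue_rV R m.+1]_x (ut s x * psi x).
pose A2 s := \int[lebesgue_rV R m.+1]_x (utt s x * psi x).
have ident := @wave_identity _ _ ord0 beta p eps r tau d M T u1 u2 u ut utt
  tau0 d0 dT Mr cu cut cutt supports wf.
rewrite -/psi in ident.
have I2E : \int[lebesgue_rV R m.+1]_x (u2 x * psi x) = pair u2 by exact: initial_pairingE.
have I1E : \int[lebesgue_rV R m.+1]_x (u1 x * psi x) = pair u1 by exact: initial_pairingE.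
have I0E : \int[lebesgue_rV R m.+1]_x (u0 x * psi x) = pair u0 by exact: initial_pairingE.
have ti0 : time_interval T 0 by apply: tiT; rewrite lexx ltW.
have A00 : A0 0 = eps * pair u0.
  have := L2_pairingZ eps u02 psi2; rewrite I0E => <-.
  exact: (L2_pairing_ae (u2T _ ti0) (L2Z eps u02) psi2 u0E).
have A10 : A1 0 = eps * pair u1.
  have := L2_pairingZ eps u12 psi2; rewrite I1E => <-.
  exact: (L2_pairing_ae (ut2T _ ti0) (L2Z eps u12) psi2 ut0E).
pose P s := \int[lebesgue_rV R m.+1]_x (`|ut s x| `^ p * (expR (- s) * psi x)).
have P0 s : 0 <= P s := powR_pairing_ge0 p s (ut s) (@wave_bump_ge0 _ _ ord0 M).
have [iP PE] := @powR_pairing_integrable _ _ p T tau (M + 1) psi ut p0 tauT tpsi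
  (@wave_bump_ge0 _ _ ord0 M) (@wave_bump_support _ _ ord0 M) Lp ut2T.
have Plb : {ae leb, forall s, 0 <= s <= tau ->
    k * (1 + s) `^ (- g) * `|expR (- s) * A1 s| `^ p <= P s}.
  apply: ae_lebesgueS PE => s PEs st; have /andP[s0' st'] := st.
  exact: (Hk s (P s) M (ut s) s0' (sM s st') (ut2T _ (tiT _ st)) (supports s st).2 (PEs st)).
rewrite qE.
apply: (@lifespan_of_identity beta p k g kap c l (eps * pair u0) (eps * pair u1)
  (eps * pair u2) tau T A0 A1 A2 P Lam b0 p1 k0 g0 bkap kap1 em0 cE l0 l1 lk eq10 eI10 tau1 tauT
  _ _ _ A00 A10 _ P0 iP Plb dLam).
- move=> A [] ->.
  + exact: (sobolev_continuous_pairing psi2 cu).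
  + exact: (sobolev_continuous_pairing psi2 cut).
  + exact: (sobolev_continuous_pairing psi2 cutt).
- move=> s s0' sT; exact: (sobolev_derivative_pairing psi2 u2T ut2T du s0' sT).
- move=> s s0' sT; exact: (sobolev_derivative_pairing psi2 ut2T utt2T dut s0' sT).
- move=> t tt; have := ident t tt; rewrite I2E I1E -mulrA; exact.
Qed.

End blow_up.

Lemma le_of_forall_lt {R : realType} (T : \bar R) (B : R) : 0 <= B ->
  (forall t : R, 0 < t -> (t%:E < T)%E -> t <= B) -> (T <= B%:E)%E.
Proof.
move=> B0 TB; rewrite leNgt; apply/negP => BT.
have [t [Bt tT]] : exists t : R, B < t /\ (t%:E < T)%E.
  case: T BT {TB} => [T| |]//=.
    by rewrite lte_fin => BT; exists ((B + T) / 2); rewrite lte_fin; split; lra.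
  by move=> _; exists (B + 1); rewrite ltry; split=> //; lra.
by have := TB t (le_lt_trans B0 Bt) tT; rewrite leNgt Bt.
Qed.

Theorem theorem1p1 (R : realType) (n : nat) (beta p r : R)
    (u0 u1 u2 : 'rV[R]_n -> R) :
  (1 <= n)%N -> 0 < beta -> 1 < p -> (p%:E <= p_Gla R n)%E ->
  sobolev 2 u0 -> sobolev 1 u1 -> sobolev 0 u2 ->
  {ae lebesgue_rV R n, forall x, 0 <= u0 x} ->
  {ae lebesgue_rV R n, forall x, 0 <= u1 x} ->
  {ae lebesgue_rV R n, forall x, 0 <= u2 x} ->
  0 < r ->
  ess_support u0 `<=` euclidean_ball r ->
  ess_support u1 `<=` euclidean_ball r ->
  ess_support u2 `<=` euclidean_ball r ->
  ~ {ae lebesgue_rV R n, forall x, u1 x = 0} \/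
  ~ {ae lebesgue_rV R n, forall x, u2 x = 0} ->
  exists eps0 C : R, [/\ 0 < eps0, 0 < C &
    forall (eps : R) (u : R -> 'rV[R]_n -> R) (T : \bar R),
      0 < eps -> eps <= eps0 ->
      lifespan beta p eps u0 u1 u2 u T ->
      (forall t : R, 0 < t -> (t%:E < T)%E ->
        ess_support (u t) `<=` euclidean_ball (t + r)) ->
      [/\ (T < +oo)%E,
          (p%:E < p_Gla R n)%E ->
            (T <= (C * eps `^ (- ((p - 1)^-1 - (n%:R - 1) / 2)^-1))%:E)%E &
          p%:E = p_Gla R n ->
            (T <= (expR (C * eps `^ (- (p - 1))))%:E)%E]].
Proof.
case: n u0 u1 u2 => [//|m] u0 u1 u2 _ b0 p1 pG s0 s1 s2 u0_ge u1_ge u2_ge r0 r0_ r1_ r2_ nz.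
pose pair (g : 'rV[R]_m.+1 -> R) :=
  \int[lebesgue_rV R m.+1]_x (g x * wave_bump ord0 r x).
have I0 : 0 <= pair u0 := initial_pairing_ge0 _ _ (sobolev_L2 s0) u0_ge.
have I1 : 0 <= pair u1 := initial_pairing_ge0 _ _ (sobolev_L2 s1) u1_ge.
have I2 : 0 <= pair u2 := initial_pairing_ge0 _ _ (sobolev_L2 s2) u2_ge.
have I12 : 0 < pair u1 + pair u2.
  rewrite lt0r addr_ge0// andbT; apply/eqP => E.
  have E1 : pair u1 = 0 by lra.
  have E2 : pair u2 = 0 by lra.
  case: nz; apply.
  - exact: initial_pairing_eq0 (sobolev_L2 s1) u1_ge (ess_support_ae r1_) E1.
  - exact: initial_pairing_eq0 (sobolev_L2 s2) u2_ge (ess_support_ae r2_) E2.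
pose q1 := beta * pair u2 + (beta + 1) * pair u1 + pair u0.
pose g : R := m%:R * (p - 1) / 2.
have bI12 : 0 < beta * (pair u1 + pair u2) by exact: mulr_gt0.
have q10 : 0 < q1 by rewrite /q1; lra.
(* The second entry is m(0)/Q(0) and is below 1 because q1 - (pair u1 + pair u0) = beta (pair u1 +
   pair u2) > 0. *)
pose kap := Num.max (beta + 1)^-1 ((pair u1 + pair u0) / q1).
have kap1 : kap < 1.
  rewrite gt_max; apply/andP; split; first by rewrite invf_lt1 ?ltrDr//; lra.
  by rewrite ltr_pdivrMr// mul1r /q1; lra.
have kapb : (beta + 1)^-1 <= kap by rewrite le_max lexx.
have kapm : pair u1 + pair u0 <= kap * q1.
  by rewrite -ler_pdivrMr// le_max lexx orbT.
have [k k0 Hk] := source_lower_bound m p1 r0.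
pose c := (1 - kap) / beta.
have c0 : 0 < c by rewrite divr_gt0// subr_gt0.
pose l := Num.min 1 (k * c `^ p / (p + 2)).
have p20 : 0 < p + 2 by lra.
have l0 : 0 < l by rewrite lt_min ltr01 divr_gt0// mulr_gt0// powR_gt0.
have l1 : l <= 1 by rewrite ge_min lexx.
have lk : l * (p + 2) <= k * c `^ p by rewrite -ler_pdivlMr// ge_min lexx orbT.
have main (Lam : R -> R) (eps t : R) (u : R -> 'rV[R]_m.+1 -> R) (T : \bar R) :
    (forall x : R, 0 < x -> is_derive x 1 Lam ((1 + x) `^ (- g))) ->
    0 < eps -> lifespan beta p eps u0 u1 u2 u T ->
    (forall t : R, 0 < t -> (t%:E < T)%E ->
      ess_support (u t) `<=` euclidean_ball (t + r)) ->
    (t%:E < T)%E -> 1 <= t -> l * (Lam t - Lam 1) <=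
    ((eps * q1 / 3) `^ (- (p - 1)) + 2 * (eps * q1 / 3) `^ (- ((p - 1) / 2))) / (p - 1).
  move=> dLam e0 [_ sol _] supp tT t1.
  exact: (@lifespan_inequality R m beta p r k kap c l eps t T Lam u0 u1 u2 u b0 p1 r0 k0 Hk
    kapb kap1 kapm erefl l0 l1 lk q10 I1 s0 s1 s2 r0_ r1_ r2_ e0 sol supp dLam t1 tT).
have d1 (x : R) : is_derive x 1 (fun y : R => 1 + y) 1.
  by apply: (der_eq (derD (is_derive_cst (1 : R) x 1) (is_derive_id x 1))); rewrite add0r.
(* With n = m + 1 the Glassey exponent is (m + 2) / m, so g = m (p - 1) / 2 is below 1 exactly in
   the subcritical range. For m = 0, g = 0 and the exponent is infinite. *)
have gE : g < 1 -> (p%:E = p_Gla R m.+1) -> False.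
  rewrite /p_Gla; case: ifPn => [//|m1] g1 [pE].
  have m0 : 0 < m%:R :> R by rewrite ltr0n lt0n; move: m1; rewrite eqSS.
  move: g1; rewrite /g pE -natr1 => g1.
  have : m%:R * ((m%:R + 1 + 1) / (m%:R + 1 - 1) - 1) / 2 = 1 :> R.
    by field; rewrite addrK gt_eqF.
  by move=> E; rewrite E ltxx in g1.
have gle : ~~ (g < 1) -> g = 1 /\ ~ (p%:E < p_Gla R m.+1)%E.
  rewrite -leNgt => g1.
  have m0 : 0 < m%:R :> R.
    rewrite lt0r ler0n andbT; apply/eqP => m0; move: g1; rewrite /g m0 !mul0r.
    by rewrite ler10.
  have m1 : (m.+1 == 1)%N = false.
    by apply/negbTE; rewrite eqSS -lt0n -(ltr0n R).
  move: pG; rewrite /p_Gla m1 !lee_fin !lte_fin -natr1 addrK => pG.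
  have mp : m%:R * (p - 1) <= 2.
    have : m%:R * p <= m%:R + 1 + 1 by rewrite mulrC -ler_pdivlMr.
    by rewrite mulrBr mulr1; lra.
  have mp2 : 2 <= m%:R * (p - 1) by move: g1; rewrite /g; lra.
  split; first by rewrite /g; lra.
  move=> pG'; have : m%:R * p < m%:R + 1 + 1 by rewrite mulrC -ltr_pdivlMr.
  by move: mp2; rewrite mulrBr mulr1; lra.
have [g1|/gle[g1 pnG]] := boolP (g < 1).
- have [C C0 HC] := algebraic_lifespan p1 g1 l0 q10.
  have dLam (x : R) : 0 < x ->
      is_derive x 1 (fun x => (1 + x) `^ (1 - g) / (1 - g)) ((1 + x) `^ (- g)).
    move=> x0; have x1 : 0 < 1 + x by lra.
    have := derZ (1 - g)^-1 (der_powR_comp (1 - g) (d1 x) x1).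
    rewrite (_ : (fun y : R => _) = fun x => (1 + x) `^ (1 - g) / (1 - g)); last first.
      by apply/funext => y; rewrite mulrC.
    move=> H; apply: (der_eq H); rewrite mulr1 mulrA mulVf ?mul1r; last first.
      by rewrite subr_eq0 gt_eqF.
    by congr (_ `^ _); ring.
  (* eps0 = 1 suffices, since eps <= 1 is only needed to compare powers of eps; the size of the data
     enters through C. *)
  exists 1, C; split=> // eps u T e0 e1 life supp.
  have TB : (T <= (C * eps `^ (- ((p - 1) / (1 - g))))%:E)%E.
    apply: le_of_forall_lt => [|t t0 tT]; first by rewrite mulr_ge0 ?powR_ge0// ltW.
    apply: HC => // t1.
    exact: (main _ eps t u T dLam e0 life supp tT t1).
  split.
  + by apply: le_lt_trans TB _; rewrite ltry.
  + move=> _; rewrite (_ : (_ - _)^-1 = (p - 1) / (1 - g))//.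
    have g1' : 1 - g != 0 by rewrite subr_eq0 gt_eqF.
    have p1' : p - 1 != 0 by rewrite subr_eq0 gt_eqF.
    have -> : (p - 1)^-1 - (m.+1%:R - 1) / 2 = (1 - g) / (p - 1).
      by rewrite -natr1 addrK /g; field.
    by rewrite invf_div.
  + by move=> /(gE g1).
- have [C C0 HC] := exponential_lifespan p1 l0 q10.
  have dLam (x : R) : 0 < x -> is_derive x 1 (fun x => ln (1 + x)) ((1 + x) `^ (- g)).
    move=> x0; have x1 : 0 < 1 + x by lra.
    have := der_comp (is_derive1_ln x1) (d1 x).
    by move=> H; apply: (der_eq H); rewrite mulr1 g1 powR_inv1 ?ltW.
  exists 1, C; split=> // eps u T e0 e1 life supp.
  have TB : (T <= (expR (C * eps `^ (- (p - 1))))%:E)%E.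
    apply: le_of_forall_lt => [|t t0 tT]; first exact: expR_ge0.
    apply: HC => // t1.
    exact: (main _ eps t u T dLam e0 life supp tT t1).
  by split=> // ; apply: le_lt_trans TB _; rewrite ltry.
Qed.
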